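(* Let $\lambda>0$ and $\varepsilon\in(0,1)$. Let $M^{(1)},\ldots,M^{(d)}\in\mathbb{R}^{n\times k}$ and let $b^{(1)},\ldots,b^{(d)}\in\mathbb{R}^n$ be column vectors. Let $s=\max_i \mathrm{sd}_\lambda(M^{(i)})$, and let $S\in\mathbb{R}^{\ell\times n}$ be sampled from $\mathcal{D}$ with $\ell=\Theta\!\left(\frac{1}{\varepsilon}(s+\log(1/\varepsilon))\right)$. For each $i$ define $$x^{(i)}=\arg\min_x \|M^{(i)}x-b^{(i)}\|^2+\lambda\|x\|^2,\qquad y^{(i)}=\arg\min_y \|S(M^{(i)}y-b^{(i)})\|^2+\lambda\|y\|^2.$$ Then, with constant probability, $$\sum_{i=1}^d \|M^{(i)}y^{(i)}-b^{(i)}\|^2+\lambda\|y^{(i)}\|^2\le(1+\varepsilon)\left(\sum_{i=1}^d \|M^{(i)}x^{(i)}-b^{(i)}\|^2+\lambda\|x^{(i)}\|^2\right).$$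
   Context: For a matrix $M$ with singular values $\sigma_i$ and $\lambda>0$, the statistical dimension is $\mathrm{sd}_\lambda(M)=\sum_i 1/(1+\lambda/\sigma_i^2)$ (sum over nonzero singular values). $\mathcal{D}$ denotes a distribution over $\ell\times n$ sketching matrices: matrices whose entries are i.i.d. Gaussian with mean $0$ and variance $1/\ell$ (or $\ell\times n$ CountSketch matrices). Norms of vectors are Euclidean.
   Formalization: The distribution D is taken to be only the i.i.d. Gaussian matrices; the alternative of CountSketch matrices is dropped, because with this ℓ the claim fails for CountSketch (e.g. d=1, M the k×k identity, b all ones, ε=1/2, λ≤1/k, k large). *)

(* Defs.v *)
From HB Require Import structures.
From mathcomp Require Import all_boot all_order all_algebra.
From mathcomp Require Import polyrcf.
From mathcomp Require Import all_classical all_reals all_analysis.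

Set Implicit Arguments.
Unset Strict Implicit.
Unset Printing Implicit Defensive.

Import Order.TTheory GRing.Theory Num.Theory.
Import numFieldNormedType.Exports.

Local Open Scope classical_set_scope.
Local Open Scope ring_scope.

(* The norm `|v| that the library puts on matrices is the sup norm. *)
Definition l2norm (R : realType) (n : nat) (v : 'cV[R]_n) : R :=
  Num.sqrt (\sum_(i < n) v i ord0 ^+ 2).

(* Square roots of the eigenvalues of M^T M, repeated according to their
   algebraic multiplicity.  This gives k values for an n x k matrix, rather than
   minn n k; the possible extra ones are zero. *)
Definition singular_values (R : realType) (n k : nat) (M : 'M[R]_(n, k)) :
    seq R :=
  let p := char_poly (M^T *m M) in
  flatten [seq nseq (mup mu p) (Num.sqrt mu) | mu <- rootsR p].

Definition stat_dim (R : realType) (n k : nat) (lambda : R)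
    (M : 'M[R]_(n, k)) : R :=
  \sum_(sigma <- singular_values M | sigma != 0)
    1 / (1 + lambda / sigma ^+ 2).

(* The default value 0 only matters for d = 0, as stat_dim is nonnegative for
   lambda > 0. *)
Definition max_stat_dim (R : realType) (n k d : nat) (lambda : R)
    (M : 'I_d -> 'M[R]_(n, k)) : R :=
  \big[Num.max/0]_(i < d) stat_dim lambda (M i).

Definition ridge_cost (R : realType) (n k : nat) (lambda : R)
    (M : 'M[R]_(n, k)) (b : 'cV[R]_n) (x : 'cV[R]_k) : R :=
  l2norm (M *m x - b) ^+ 2 + lambda * l2norm x ^+ 2.

Definition sketched_ridge_cost (R : realType) (l n k : nat) (lambda : R)
    (S : 'M[R]_(l, n)) (M : 'M[R]_(n, k)) (b : 'cV[R]_n) (y : 'cV[R]_k) : R :=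
  l2norm (S *m (M *m y - b)) ^+ 2 + lambda * l2norm y ^+ 2.

Definition is_argmin (R : realType) (T : Type) (f : T -> R) (x : T) : Prop :=
  forall z : T, f x <= f z.

Definition mutually_independent (R : realType) (dT : measure_display)
    (T : measurableType dT) (P : probability T R) (I : finType)
    (X : I -> {RV P >-> R}) : Prop :=
  forall (J : {set I}) (B : I -> set R),
    (forall i, measurable (B i)) ->
    P (\bigcap_(i in [set` J]) (X i @^-1` B i)) =
      (\prod_(i in J) P (X i @^-1` B i))%E.

(* normal_prob takes the standard deviation, not the variance.  The laws are
   compared on measurable sets only: the library's measures are functions on all
   sets, with unspecified values outside the sigma-algebra. *)
Definition gaussian_sketch (R : realType) (dT : measure_display)
    (T : measurableType dT) (P : probability T R) (l n : nat)
    (S : 'I_l * 'I_n -> {RV P >-> R}) : Prop :=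
  mutually_independent S /\
  forall ij (B : set R), measurable B ->
    distribution P (S ij) B = normal_prob 0 (Num.sqrt (l%:R^-1)) B.

Definition sketch_at (R : realType) (dT : measure_display)
    (T : measurableType dT) (P : probability T R) (l n : nat)
    (S : 'I_l * 'I_n -> {RV P >-> R}) (w : T) : 'M[R]_(l, n) :=
  \matrix_(i < l, j < n) S (i, j) w.

Definition sketch_size (R : realType) (eps s : R) : R :=
  1 / eps * (s + ln (1 / eps)).

(* The integer l lies between the ceilings of c1 * q and c2 * q. *)
Definition theta_between (R : realType) (c1 c2 q : R) (l : nat) : Prop :=
  c1 * q <= l%:R /\ l%:R < c2 * q + 1.

(* Main.v *)
(* Let r = b - M x be the optimal residual, so that M^T r = lambda x, and let
   X be the sketch.  Then y = x + z with
     (lambda + M^T X^T X M) z = M^T (X^T X r - r),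
   and the cost of y exceeds that of x by exactly |M z|^2 + lambda |z|^2.  No
   subspace embedding is used: since excesses add up over i, it suffices to bound
   the expectation of each one by eps/2 times its cost, and then to apply Markov's
   inequality to the sum.

   The expectation is bounded by Gaussian integration by parts,
     E <X, F X> = (1/l) E div F,
   applied to F X = psi X * X (r - M z) (M z)^T, for which <X, F X> is
   psi * lambda <z, x + z>.  The divergence contains -(l - h) |M z|^2, where
   h = tr (X M (lambda + M^T X^T X M)^-1 M^T X^T) is the effective dimension of
   the sketched problem, plus terms of relative size s/l.  As h may be close to l
   on a rare event, F carries the weight psi = 1 + |X M Pi|_F^2 / (lambda l), with Pi
   the spectral projector of M^T M onto the eigenvalues below lambda; for it,
   psi (l - h) >= l - 2 m everywhere, m being the number of eigenvalues above
   lambda.  Both m and |M Pi|_F^2 / lambda are at most 2 s.  The moments of psi, of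
   the trace of M (lambda + M^T X^T X M)^-1 M^T and of |X r|^2 that are needed come
   from further integrations by parts.  When s < 1/2 no eigenvalue is above lambda,
   and the crude bound |z| <= |M^T (X^T X r - r)| / lambda suffices. *)

Require Import Defs.
From HB Require Import structures.
From mathcomp Require Import all_boot all_order all_algebra.
From mathcomp Require Import spectral complex polyrcf.
From mathcomp Require Import all_classical all_reals all_analysis.
From mathcomp Require Import measurable_realfun.
From mathcomp Require Import ring lra.
Import Order.TTheory GRing.Theory Num.Theory.
Import numFieldNormedType.Exports.
Local Open Scope classical_set_scope.
Local Open Scope ring_scope.

Set Implicit Arguments.
Unset Strict Implicit.
Unset Printing Implicit Defensive.

(** * Gaussian moments and integration by parts *)

(** The sketch size does not grow with d while one event must serve all d problems, so a union bound
    is out of reach; means, on the contrary, can be added, at the price of controlling rare sketches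
    in mean. The field X (r - M z) (M z)^T is chosen for a cancellation: both sides of the
    integrated identity contain l psi lam <z, x>. Without it, l psi lam |z|^2 + psi (l - h) |M z|^2
    is left on one side, which is the excess up to a constant factor. The main term left on the
    other side is - psi h <M z, r>, which Young's inequality handles because h^2 <= l (m + T) with T
    = |X M Pi|_F^2 / lam. The weight psi is a polynomial in X, so its moments come from the same
    integration by parts. All functions involved are built from the entries of X by sums, products
    and inverses of functions bounded below, the ridge determinant being at least lam^k. This class
    is stable under derivatives and has polynomial growth, so that integrability holds by
    construction. The bound so obtained has the form (m + a + 1) / l up to a constant, with a the
    mean of T. Its additive 1 is harmless only if s is bounded below; hence the separate case s <
    1/2. *)

Section normal_law.
Variable R : realType.
Local Notation mu := (@lebesgue_measure R).

(** The Radon-Nikodym derivative of the law agrees almost everywhere with the density, both having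
    the same integral on every measurable set. *)
Lemma integral_normal_prob (m sigma : R) f :
  measurable_fun setT f ->
  (\int[normal_prob m sigma]_x `|f x| < +oo)%E ->
  (\int[normal_prob m sigma]_x f x =
   \int[mu]_x (f x * (normal_pdf m sigma x)%:E))%E.
Proof.
move=> mf finf.
rewrite -(Radon_Nikodym_change_of_variables (normal_prob_dominates m sigma))//=; last first.
  by apply/integrableP; split.
apply: ae_eq_integral => //.
- apply: emeasurable_funM => //; apply: (measurable_int mu).
  by apply: Radon_Nikodym_integrable; exact: normal_prob_dominates.
- apply: emeasurable_funM => //=; apply/measurableT_comp => //=.
  exact: measurable_normal_pdf.
- apply: ae_eqe_mul2l => /=.
  rewrite Radon_NikodymE//=; first exact: normal_prob_dominates.
  move=> abmu.
  case: cid => /= h [h1 h2 h3].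
  apply: integral_ae_eq => //=.
  + by apply/measurableT_comp =>//; exact: measurable_normal_pdf.
  + by move=> E E01 mE; rewrite -h3.
Qed.

(** With y = 1 + x^2, exp (c y) is the (p+1)-st power of exp (c y / (p+1)), hence dominates (c y /
    (p+1))^p; the factor exp c pays for the shift from x^2 to y. *)
Lemma poly_gauss_bounded (p : nat) (c : R) : 0 < c ->
  exists2 K, 0 <= K & forall x : R, (1 + x ^+ 2) ^+ p * expR (- (c * x ^+ 2)) <= K.
Proof.
move=> c0.
exists ((c / p.+1%:R) ^- p * expR c); first by rewrite mulr_ge0 ?expR_ge0// invr_ge0 exprn_ge0// divr_ge0// ltW.
move=> x; set y := 1 + x ^+ 2.
have y1 : 1 <= y by rewrite lerDl sqr_ge0.
have -> : - (c * x ^+ 2) = c - c * y by rewrite /y; ring.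
rewrite expRD mulrCA mulrC ler_pM2r ?expR_gt0//.
have cp : 0 < c / p.+1%:R by rewrite divr_gt0.
rewrite -(@ler_pM2l _ ((c / p.+1%:R) ^+ p)) ?exprn_gt0// mulfV ?gt_eqF ?exprn_gt0//.
rewrite mulrA -exprMn expRN ler_pdivrMr ?expR_gt0// mul1r.
have -> : c * y = p.+1%:R * (c / p.+1%:R * y) by field; rewrite nat1r pnatr_eq0.
rewrite expRM_natl.
have h : c / p.+1%:R * y <= expR (c / p.+1%:R * y).
  by rewrite (le_trans _ (expR_ge1Dx _))// lerDr.
have h0 : 0 <= c / p.+1%:R * y by rewrite mulr_ge0 ?(ltW cp)// (le_trans _ y1).
have h1 : 1 <= expR (c / p.+1%:R * y) by rewrite (le_trans _ (expR_ge1Dx _))// lerDl.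
rewrite exprS.
apply: (@le_trans _ _ (expR (c / p.+1%:R * y) ^+ p)).
  by apply: lerXn2r => //; rewrite nnegrE ?expR_ge0.
by rewrite ler_peMl// exprn_ge0// expR_ge0.
Qed.

(** Up to a constant, the density of deviation sigma is exp (- 3 x^2 / (8 sigma^2)) times the
    density of deviation 2 sigma, and this exponential absorbs the polynomial. *)
Lemma normal_moment_integrable (sigma : R) (p : nat) : sigma != 0 ->
  mu.-integrable setT (fun x => ((1 + x ^+ 2) ^+ p * normal_pdf 0 sigma x)%:E).
Proof.
move=> s0.
have s2 : 0 < sigma ^+ 2 by rewrite exprn_even_gt0.
have [K K0 HK] := @poly_gauss_bounded p (3 / (8 * sigma ^+ 2)) (divr_gt0 (ltr0n _ 3) (mulr_gt0 (ltr0n _ 8) s2)).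
have s'0 : 2 * sigma != 0 by rewrite mulf_neq0// pnatr_eq0.
pose C := normal_peak sigma * K / normal_peak (2 * sigma).
apply: (@le_integrable _ _ _ mu setT measurableT _
   (fun x => (C * normal_pdf 0 (2 * sigma) x)%:E)).
- apply/measurable_EFinP; apply: measurable_funM; last exact: measurable_normal_pdf.
  by apply: measurable_funX; apply: measurable_funD => //; apply: measurable_funX.
- move=> x _ /=; rewrite lee_fin.
  rewrite ger0_norm; last by rewrite mulr_ge0 ?normal_pdf_ge0// exprn_ge0// addr_ge0 ?sqr_ge0.
  rewrite ger0_norm; last first.
    by rewrite mulr_ge0 ?normal_pdf_ge0// /C divr_ge0 ?mulr_ge0 ?normal_peak_ge0.
  rewrite !normal_pdfE// /C /normal_fun !subr0.
  have e1 : - x ^+ 2 / (sigma ^+ 2 *+ 2) = - (3 / (8 * sigma ^+ 2) * x ^+ 2) + - x ^+ 2 / ((2 * sigma) ^+ 2 *+ 2).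
    by field.
  rewrite e1 expRD.
  have -> : (normal_peak sigma * K / normal_peak (2 * sigma) *
     (normal_peak (2 * sigma) * expR (- x ^+ 2 / ((2 * sigma) ^+ 2 *+ 2)))) = 
     K * (normal_peak sigma * expR (- x ^+ 2 / ((2 * sigma) ^+ 2 *+ 2))).
    by field; rewrite gt_eqF// normal_peak_gt0.
  have reorder (a b c d : R) : a * (b * (c * d)) = a * c * (b * d) by ring.
  rewrite reorder.
  by rewrite ler_wpM2r// mulr_ge0 ?normal_peak_ge0 ?expR_ge0.
- under eq_fun do rewrite EFinM.
  exact: integrableZl (integrable_normal_pdf _ _).
Qed.

(** Finiteness is the point here, so the transfer from the density to the law goes through the
    change of variables for nonnegative functions instead of [integral_normal_prob], which
    presupposes it. *)
Lemma normal_prob_moment_integrable (sigma : R) (p : nat) : sigma != 0 ->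
  (normal_prob 0 sigma).-integrable setT (fun x => ((1 + x ^+ 2) ^+ p)%:E).
Proof.
move=> s0.
have m0 : measurable_fun setT (fun x : R => (1 + x ^+ 2) ^+ p).
  by apply: measurable_funX; apply: measurable_funD => //; apply: measurable_funX.
have p0 (x : R) : 0 <= (1 + x ^+ 2) ^+ p by rewrite exprn_ge0// addr_ge0 ?sqr_ge0.
apply/integrableP; split; first exact/measurable_EFinP.
under eq_integral do rewrite gee0_abs ?lee_fin//.
have := @normal_moment_integrable sigma p s0 => /integrableP[m1].
apply: le_lt_trans.
have := Radon_Nikodym_SigmaFinite.change_of_variables (normal_prob_dominates 0 sigma)
  (f := fun x => ((1 + x ^+ 2) ^+ p)%:E) (fun x => p0 x) measurableT.
move=> <-; last exact/measurable_EFinP.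
rewrite le_eqVlt; apply/orP; left; apply/eqP.
apply: ae_eq_integral => //.
- apply: emeasurable_funM => //; first exact/measurable_EFinP.
  apply: (measurable_int mu).
  exact: Radon_Nikodym_SigmaFinite.f_integrable (normal_prob_dominates 0 sigma).
- exact: measurableT_comp.
- rewrite (_ : (fun x => `|_|%E) = (fun x : R => ((1 + x ^+ 2) ^+ p)%:E * (normal_pdf 0 sigma x)%:E)%E); last first.
    by apply/funext => x; rewrite -EFinM gee0_abs// lee_fin mulr_ge0// normal_pdf_ge0.
  apply: ae_eqe_mul2l => /=.
  apply: integral_ae_eq => //=.
  + exact: Radon_Nikodym_SigmaFinite.f_integrable (normal_prob_dominates 0 sigma).
  + by apply/measurableT_comp =>//; exact: measurable_normal_pdf.
  + by move=> E _ mE; rewrite -(Radon_Nikodym_SigmaFinite.f_integral (normal_prob_dominates 0 sigma)).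
Qed.

End normal_law.

Section stein.
Variable R : realType.
Local Notation mu := (@lebesgue_measure R).

Lemma is_derive_normal_pdf (sigma x : R) : sigma != 0 ->
  is_derive x 1 (normal_pdf 0 sigma) (- (x / sigma ^+ 2) * normal_pdf 0 sigma x).
Proof.
move=> s0.
pose q : R -> R := fun y => - (sigma ^+ 2 *+ 2)^-1 * (y * y).
have -> : normal_pdf 0 sigma = cst (normal_peak sigma) * (expR \o q).
  apply/funext => y; rewrite normal_pdfE// /normal_fun subr0 /q.
  rewrite [RHS]/GRing.mul /=; congr (_ * expR _).
  by field.
have dq : is_derive x 1 q (- (x / sigma ^+ 2)).
  have -> : q = cst (- (sigma ^+ 2 *+ 2)^-1) * (id * id) by apply/funext.
  apply: is_derive_eq; rewrite /GRing.scale /= !mulr1 mulr0 addr0.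
  by field.
have de := @is_derive1_comp R expR q x _ _ (is_derive_expR (q x)) dq.
apply: is_derive_eq.
rewrite /GRing.scale /=. rewrite fctE /=; ring.
Qed.

(** The integrand is the derivative of u times the density. On [-n-1, n+1] the integral is a
    boundary term that tends to 0, and dominated convergence passes to the whole line. *)
Lemma stein_normal_pdf (sigma : R) (u u' : R -> R) (C : R) (p : nat) :
  sigma != 0 -> (forall x : R, is_derive x (1 : R) u (u' x)) -> continuous u' ->
  (forall x, `|u x| <= C * (1 + x ^+ 2) ^+ p) ->
  (forall x, `|u' x| <= C * (1 + x ^+ 2) ^+ p) ->
  (\int[mu]_x ((u' x - x / sigma ^+ 2 * u x) * normal_pdf 0 sigma x)%:E = 0)%E.
Proof.
move=> s0 du cu' uC u'C.
set phi := normal_pdf 0 sigma.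
have s2 : 0 < sigma ^+ 2 by rewrite exprn_even_gt0.
have phi0 x : 0 <= phi x := normal_pdf_ge0 _ _ _.
have cu : continuous u.
  by move=> x; apply/differentiable_continuous/derivable1_diffP; case: (du x).
have cphi : continuous phi by exact: continuous_normal_pdf.
pose g x := (u' x - x / sigma ^+ 2 * u x) * phi x.
pose G := u * phi.
have dG (x : R) : is_derive x (1 : R) G (g x).
  have h1 := du x; have h2 := is_derive_normal_pdf x s0.
  apply: is_derive_eq.
  rewrite /g /phi /GRing.scale /=; ring.
have cg : continuous g.
  move=> x; apply: cvgM; last exact: cphi.
  apply: cvgB; first exact: cu'.
  apply: cvgM; last exact: cu.
  by apply: cvgM; [exact: cvg_id|exact: cvg_cst].
have C0 : 0 <= C.
  by have := le_trans (normr_ge0 _) (uC 0); rewrite expr0n/= addr0 expr1n mulr1.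
pose D := C + C / sigma ^+ 2.
have gD x : `|g x| <= D * ((1 + x ^+ 2) ^+ p.+1 * phi x).
  rewrite normrM (ger0_norm (phi0 x)) mulrA ler_wpM2r//.
  rewrite (le_trans (ler_normB _ _))// mulrDl lerD//.
    rewrite (le_trans (u'C x))// ler_wpM2l//.
    by rewrite (exprS _ p) ler_peMl ?exprn_ge0 ?addr_ge0 ?sqr_ge0// lerDl sqr_ge0.
  rewrite normrM (exprS _ p).
  have -> : C / sigma ^+ 2 * ((1 + x ^+ 2) * (1 + x ^+ 2) ^+ p) =
    ((1 + x ^+ 2) / sigma ^+ 2) * (C * (1 + x ^+ 2) ^+ p) by ring.
  apply: ler_pM => //.
  rewrite normrM normfV (gtr0_norm s2) ler_pM2r ?invr_gt0//.
  have := sqr_ge0 (`|x| - 1); rewrite -(real_normK (num_real x)); nra.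
have mg : measurable_fun setT g by exact: continuous_measurable_fun.
have iD : mu.-integrable setT (fun x => (D * ((1 + x ^+ 2) ^+ p.+1 * phi x))%:E).
  under eq_fun do rewrite EFinM.
  by apply: integrableZl => //; exact: normal_moment_integrable.
pose f_ n := (EFin \o g) \_ (`[- n.+1%:R, n.+1%:R]%classic : set R).
(* One factor 1 + x^2 more than the growth of u requires; it survives as the decay of [G] at
   infinity. *)
have [K K0 HK] : exists2 K, 0 <= K & forall x, (1 + x ^+ 2) ^+ p.+1 * phi x <= K.
  have [K K0 HK] := @poly_gauss_bounded R p.+1 (sigma ^+ 2 *+ 2)^-1 ltac:(by rewrite invr_gt0 pmulrn_lgt0).
  exists (normal_peak sigma * K); first by rewrite mulr_ge0 ?normal_peak_ge0.
  move=> x; rewrite /phi normal_pdfE// /normal_fun subr0 mulrCA.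
  by rewrite ler_wpM2l ?normal_peak_ge0// mulNr (mulrC (x ^+ 2)).
have Gle x : `|G x| <= C * K / (1 + x ^+ 2).
  have x1 : 0 < 1 + x ^+ 2 by rewrite ltr_pwDl// sqr_ge0.
  rewrite ler_pdivlMr// /G normrM (ger0_norm (phi0 x)).
  apply: (@le_trans _ _ (C * ((1 + x ^+ 2) ^+ p.+1 * phi x))); last by rewrite ler_wpM2l.
  rewrite (exprS _ p).
  have -> : C * ((1 + x ^+ 2) * (1 + x ^+ 2) ^+ p * phi x) = C * (1 + x ^+ 2) ^+ p * phi x * (1 + x ^+ 2) by ring.
  by rewrite ler_pM2r// ler_wpM2r.
have If n : (\int[mu]_x f_ n x = (G n.+1%:R - G (- n.+1%:R))%:E)%E.
  rewrite -integral_mkcond /= EFinB (@continuous_FTC2 R g G)//.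
  - by rewrite gtrN.
  - by apply: continuous_subspaceT => x; exact: cg.
  - have cG : continuous G.
      by move=> x; apply/differentiable_continuous/derivable1_diffP; case: (dG x).
    split.
    + by move=> x _; case: (dG x).
    + by apply: cvg_at_right_filter; exact: cG.
    + by apply: cvg_at_left_filter; exact: cG.
  - by move=> x _; rewrite derive1E; case: (dG x).
have := @dominated_convergence _ _ _ mu setT measurableT f_ (EFin \o g) _ _ _ _ iD _.
case=> //.
- move=> n; apply/measurable_restrict => //=; rewrite setTI.
  by apply: measurable_funTS; apply/measurable_EFinP.
- exact/measurable_EFinP.
- apply: aeW => x _.
  apply: cvg_near_cst.
  exists (Num.truncn `|x|) => // n /= nx.
  rewrite /f_ patchE mem_set// /= in_itv /= -ler_norml.
  rewrite ltW// (lt_le_trans (truncnS_gt _))// ler_nat ltnS//.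
- apply: aeW => x n _; rewrite /f_ patchE; case: ifPn => _.
    by rewrite /= lee_fin.
  by rewrite abse0 lee_fin (le_trans _ (gD x)).
move=> _ _ cvgI.
rewrite -[LHS](cvg_lim _ cvgI)//.
apply: cvg_lim => //.
under eq_fun do rewrite If.
apply: cvg_EFin; first exact: nearW.
rewrite /=.
apply: (@squeeze_cvgr _ _ _ _ (fun n => - (2 * (C * K) * n.+1%:R^-1)) (fun n => 2 * (C * K) * n.+1%:R^-1)).
- apply: nearW => n /=; rewrite -ler_norml.
  have b (s : R) : s ^+ 2 = n.+1%:R ^+ 2 -> C * K / (1 + s ^+ 2) <= C * K * n.+1%:R^-1.
    move=> ->; rewrite ler_wpM2l ?mulr_ge0// lef_pV2 ?posrE// ?ltr_pwDl ?sqr_ge0//.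
    by rewrite (@le_trans _ _ (n.+1%:R ^+ 2)) ?lerDr// -natrX ler_nat expnS expn1 leq_pmulr.
  rewrite (le_trans (ler_normB _ _))// -mulrA mulr_natl mulr2n.
  by rewrite lerD// (le_trans (Gle _))// b// sqrrN.
- rewrite -oppr0; apply: cvgN; rewrite -(mulr0 (2 * (C * K))); apply: cvgMr.
  exact: cvg_harmonic.
- rewrite -(mulr0 (2 * (C * K))); apply: cvgMr.
  exact: cvg_harmonic.
Qed.

End stein.

(** * Smooth functions of polynomial growth *)

(** Reduces the integrability of a polynomial in all the entries to moments of single entries, with
    no appeal to independence. *)
Lemma expr_sum_bound (R : realDomainType) (I : Type) (r : seq I) (p : nat) :
  exists2 K : R, 0 <= K & forall a : I -> R, (forall i, 0 <= a i) ->
    (1 + \sum_(i <- r) a i) ^+ p <= K * (1 + \sum_(i <- r) (1 + a i) ^+ p).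
Proof.
elim: r => [|i r [K K0 IH]].
  by exists 1 => // a _; rewrite !big_nil !addr0 expr1n mul1r.
exists (2 ^+ p * (K + 1)); first by rewrite mulr_ge0 ?exprn_ge0 ?addr_ge0.
move=> a a0; rewrite !big_cons.
set s := \sum_(j <- r) a j; set t := \sum_(j <- r) (1 + a j) ^+ p.
have s0 : 0 <= s by apply: sumr_ge0.
have t0 : 0 <= t by apply: sumr_ge0 => j _; rewrite exprn_ge0 ?addr_ge0.
have h := IH a a0; rewrite -/s -/t in h.
have q0 : 0 <= (1 + a i) ^+ p by rewrite exprn_ge0 ?addr_ge0.
apply: (@le_trans _ _ (2 ^+ p * ((1 + s) ^+ p + (1 + a i) ^+ p))); last first.
  rewrite -mulrA ler_wpM2l ?exprn_ge0//.
  have : 0 <= K * (1 + a i) ^+ p by rewrite mulr_ge0.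
  nra.
have [sa|sa] := leP s (a i).
  apply: (@le_trans _ _ (2 ^+ p * (1 + a i) ^+ p)).
    rewrite -exprMn lerXn2r ?nnegrE ?addr_ge0 ?mulr_ge0 ?addr_ge0//; have := a0 i; lra.
  by rewrite ler_wpM2l ?exprn_ge0// lerDr exprn_ge0 ?addr_ge0.
apply: (@le_trans _ _ (2 ^+ p * (1 + s) ^+ p)).
  rewrite -exprMn lerXn2r ?nnegrE ?addr_ge0 ?mulr_ge0 ?addr_ge0//; have := a0 i; lra.
by rewrite ler_wpM2l ?exprn_ge0// lerDl.
Qed.

Section tame.
Variables (R : realType) (N n : nat).
Local Notation MX := 'M[R]_(N, n).
Implicit Types (X V : MX) (f g : MX -> R).

(** Stable under directional derivatives, measurable and of polynomial growth. The constant lower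
    bound in the inverse case preserves the growth, and still admits the entries of ridge inverses
    through Cramer's rule. *)
Inductive tame : (MX -> R) -> Prop :=
| tame_cst c : tame (fun=> c)
| tame_coord i j : tame (fun X => X i j)
| tameD f g : tame f -> tame g -> tame (fun X => f X + g X)
| tameM f g : tame f -> tame g -> tame (fun X => f X * g X)
| tameV c g : 0 < c -> (forall X, c <= g X) -> tame g -> tame (fun X => (g X)^-1).

Lemma tameN f : tame f -> tame (fun X => - f X).
Proof.
move=> tf; have -> : (fun X => - f X) = (fun X => (-1) * f X).
  by apply/funext => X; rewrite mulN1r.
by apply: tameM => //; exact: tame_cst.
Qed.

Lemma tameB f g : tame f -> tame g -> tame (fun X => f X - g X).
Proof. by move=> tf tg; apply: tameD => //; exact: tameN. Qed.

Lemma tameZ c f : tame f -> tame (fun X => c * f X).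
Proof. by move=> tf; apply: tameM => //; exact: tame_cst. Qed.

Lemma tame_sum (I : Type) (r : seq I) (P : pred I) (F : I -> MX -> R) :
  (forall i, tame (F i)) -> tame (fun X => \sum_(i <- r | P i) F i X).
Proof.
move=> tF; elim: r => [|i r IH].
  have -> : (fun X => \sum_(i <- [::] | P i) F i X) = fun=> 0.
    by apply/funext => X; rewrite big_nil.
  exact: tame_cst.
have -> : (fun X => \sum_(j <- i :: r | P j) F j X) =
    (fun X => (if P i then F i X else 0) + \sum_(j <- r | P j) F j X).
  by apply/funext => X; rewrite big_cons; case: ifP => _; rewrite ?add0r.
by apply: tameD => //; case: (P i) => //; exact: tame_cst.
Qed.

Lemma tame_prod (I : Type) (r : seq I) (P : pred I) (F : I -> MX -> R) :
  (forall i, tame (F i)) -> tame (fun X => \prod_(i <- r | P i) F i X).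
Proof.
move=> tF; elim: r => [|i r IH].
  have -> : (fun X => \prod_(i <- [::] | P i) F i X) = fun=> 1.
    by apply/funext => X; rewrite big_nil.
  exact: tame_cst.
have -> : (fun X => \prod_(j <- i :: r | P j) F j X) =
    (fun X => (if P i then F i X else 1) * \prod_(j <- r | P j) F j X).
  by apply/funext => X; rewrite big_cons; case: ifP => _; rewrite ?mul1r.
by apply: tameM => //; case: (P i) => //; exact: tame_cst.
Qed.

Lemma tame_measurable f : tame f ->
  forall d (T : measurableType d) (h : T -> MX),
  (forall i j, measurable_fun setT (fun w => h w i j)) ->
  measurable_fun setT (fun w => f (h w)).
Proof.
move=> tf d T h mh; elim: tf => [c|i j|{}f g _ mf _ mg|{}f g _ mf _ mg|c g c0 cg _ mg].
- exact: measurable_cst.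
- exact: mh.
- exact: measurable_funD.
- exact: measurable_funM.
(* Truncating at c makes the inverse continuous on the whole line. *)
- have -> : (fun w => (g (h w))^-1) =
      (fun z : R => (Num.max z c)^-1) \o (fun w => g (h w)).
    by apply/funext => w /=; rewrite max_l.
  apply: (@measurableT_comp _ _ _ _ _ _ (fun z : R => (Num.max z c)^-1)) => //.
  apply: continuous_measurable_fun => z; apply: cvgV.
    by rewrite gt_eqF// lt_max c0 orbT.
  apply: (@continuous_max R R (fun z : R => z) (fun=> c)); first exact: cvg_id.
  exact: cvg_cst.
Qed.

Definition sqnorm X : R := \sum_(ij : 'I_N * 'I_n) X ij.1 ij.2 ^+ 2.

Lemma sqnorm_ge0 X : 0 <= sqnorm X.
Proof. by apply: sumr_ge0 => ij _; exact: sqr_ge0. Qed.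

Lemma tame_growth f : tame f ->
  exists C p, 0 <= C /\ forall X, `|f X| <= C * (1 + sqnorm X) ^+ p.
Proof.
have s1 X : 1 <= 1 + sqnorm X by rewrite lerDl sqnorm_ge0.
elim => [c|i j|{}f g _ [C [p [C0 fC]]] _ [D [q [D0 gD]]]|
         {}f g _ [C [p [C0 fC]]] _ [D [q [D0 gD]]]|c g c0 cg _ _].
- by exists `|c|, 0; split => // X; rewrite expr0 mulr1.
- exists 1, 1; split => // X; rewrite expr1 mul1r.
  have le1 : X i j ^+ 2 <= sqnorm X.
    rewrite /sqnorm (bigD1 (i, j))//= lerDl; apply: sumr_ge0 => ij _; exact: sqr_ge0.
  have := sqr_ge0 (`|X i j| - 1); have := real_normK (num_real (X i j)); nra.
- exists (C + D), (maxn p q); split; first exact: addr_ge0.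
  move=> X; rewrite (le_trans (ler_normD _ _))// mulrDl lerD//.
    by rewrite (le_trans (fC X))// ler_wpM2l// ler_weXn2l// leq_maxl.
  by rewrite (le_trans (gD X))// ler_wpM2l// ler_weXn2l// leq_maxr.
- exists (C * D), (p + q)%N; split; first exact: mulr_ge0.
  move=> X; rewrite normrM exprD mulrACA.
  by apply: ler_pM.
- exists c^-1, 0; split; first by rewrite invr_ge0 ltW.
  move=> X; rewrite expr0 mulr1 gtr0_norm ?invr_gt0 ?(lt_le_trans c0)//.
  by rewrite lef_pV2 ?posrE ?(lt_le_trans c0).
Qed.

(** A derivative at 0 along a line, so that one-variable calculus suffices. *)
Definition ddir f X V (d : R) := is_derive (0 : R) (1 : R) (fun t : R => f (X + t *: V)) d.

Lemma ddir_cst (c : R) X V : ddir (fun=> c) X V 0.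
Proof. exact: is_derive_cst. Qed.

Lemma ddir_coord i j X V : ddir (fun X => X i j) X V (V i j).
Proof.
rewrite /ddir.
have -> : (fun t : R => (X + t *: V) i j) = cst (X i j) + id * cst (V i j).
  by apply/funext => t; rewrite !mxE.
by apply: is_derive_eq; rewrite /GRing.scale /=; ring.
Qed.

Lemma ddirD f g X V df dg : ddir f X V df -> ddir g X V dg ->
  ddir (fun X => f X + g X) X V (df + dg).
Proof. by move=> hf hg; apply: is_deriveD. Qed.

Lemma ddirN f X V df : ddir f X V df -> ddir (fun X => - f X) X V (- df).
Proof. by move=> hf; apply: is_deriveN. Qed.

Lemma ddirM f g X V df dg : ddir f X V df -> ddir g X V dg ->
  ddir (fun X => f X * g X) X V (df * g X + f X * dg).
Proof.
move=> hf hg; have h := is_deriveM hf hg.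
apply: (@is_derive_eq _ _ _ _ _ _ _ _ h).
by rewrite !scale0r !addr0 /GRing.scale /= addrC (mulrC (g X)).
Qed.

Lemma ddirV f X V df : f X != 0 -> ddir f X V df ->
  ddir (fun X => (f X)^-1) X V (- (f X)^-1 * df * (f X)^-1).
Proof.
move=> fX hf; have h := @is_deriveV _ (fun t : R => f (X + t *: V)) 0 df 1.
rewrite scale0r addr0 in h; apply: (is_derive_eq (h fX hf)).
by rewrite /GRing.scale /= expr2 invfM; ring.
Qed.

Lemma ddir_unique f X V d1 d2 : ddir f X V d1 -> ddir f X V d2 -> d1 = d2.
Proof. by move=> [_ <-] [_ <-]. Qed.

Lemma tame_ddir f V : tame f -> exists2 df, tame df & forall X, ddir f X V (df X).
Proof.
elim => [c|i j|{}f g tf [df tdf hdf] tg [dg tdg hdg]|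
         {}f g tf [df tdf hdf] tg [dg tdg hdg]|c g c0 cg tg [dg tdg hdg]].
- by exists (fun=> 0); [exact: tame_cst|move=> X; exact: ddir_cst].
- exists (fun=> V i j); [exact: tame_cst|move=> X; exact: ddir_coord].
- by exists (fun X => df X + dg X); [exact: tameD|move=> X; exact: ddirD].
- exists (fun X => df X * g X + f X * dg X); last by move=> X; exact: ddirM.
  by apply: tameD; exact: tameM.
- exists (fun X => - (g X)^-1 * dg X * (g X)^-1).
    have tV : tame (fun X => (g X)^-1) by exact: tameV cg tg.
    by apply: tameM => //; apply: tameM => //; exact: tameN.
  by move=> X; apply: ddirV => //; rewrite gt_eqF// (lt_le_trans c0).
Qed.

(** Derivatives are unique, so any closed formula found for one inherits tameness and needs no check
    of its own. *)
Lemma ddir_tame f (df : MX -> R) V : tame f -> (forall X, ddir f X V (df X)) -> tame df.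
Proof.
move=> tf hdf; have [dg tdg hdg] := tame_ddir V tf.
suff -> : df = dg by [].
by apply/funext => X; exact: ddir_unique (hdf X) (hdg X).
Qed.

End tame.

(** * Expectation over a Gaussian matrix *)

Definition pushforward_measure d d' (T1 : measurableType d) (T2 : measurableType d')
    (R : realType) (m : {measure set T1 -> \bar R}) (f : T1 -> T2)
    (mf : measurable_fun setT f) : {measure set T2 -> \bar R} :=
  measure_function_pushforward__canonical__measure_function_Measure m mf.

(** * Replacing one entry of a matrix, and measurable boxes of matrices *)

Section resample.
Variables (R : realType) (N n : nat).
Local Notation MX := 'M[R]_(N, n).

(** Written as a move along [delta_mx i j], so that differentiating in x is a derivative in the
    sense of [ddir]. *)
Definition set_entry (X : MX) (i : 'I_N) (j : 'I_n) (x : R) : MX :=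
  X + (x - X i j) *: delta_mx i j.

Lemma set_entryE X i j x k l :
  set_entry X i j x k l = if (k == i) && (l == j) then x else X k l.
Proof.
rewrite !mxE; case: ifP => [/andP[/eqP-> /eqP->]|_]; rewrite ?mulr1 ?mulr0 ?addr0//.
by rewrite addrC subrK.
Qed.

Lemma sqnorm_set_entry X i j x : sqnorm (set_entry X i j x) <= sqnorm X + x ^+ 2.
Proof.
rewrite /sqnorm (bigD1 (i, j))//= set_entryE !eqxx/= addrC lerD2r.
rewrite [leRHS](bigD1 (i, j))//= [leLHS](_ : _ = \sum_(ij | ij != (i, j)) X ij.1 ij.2 ^+ 2); last first.
  apply: eq_bigr => -[k l] /=; rewrite xpair_eqE => /negbTE h.
  by rewrite set_entryE h.
by rewrite lerDr sqr_ge0.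
Qed.

(** Measurable boxes: a pi-system whose generated sigma-algebra makes the entries measurable, so
    laws of random matrices can be compared on boxes alone. *)
Definition rects : set (set MX) :=
  [set A | exists B : 'I_N * 'I_n -> set R, (forall ij, measurable (B ij)) /\
     A = [set X : MX | forall ij, B ij (X ij.1 ij.2)]].

Lemma rects_setI : setI_closed rects.
Proof.
move=> A A' [B [mB ->]] [B' [mB' ->]].
exists (fun ij => B ij `&` B' ij); split; first by move=> ij; exact: measurableI.
apply/seteqP; split => [X [h h'] ij|X h]; first by split.
by split => ij; case: (h ij).
Qed.

Lemma rects_setT : rects setT.
Proof. by exists (fun=> setT); split => //; apply/seteqP; split. Qed.

Local Notation MXs := (g_sigma_algebraType rects).

Lemma measurable_entry i j : measurable_fun setT (fun X : MXs => (X : MX) i j).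
Proof.
move=> _ B mB; rewrite setTI; apply: sub_sigma_algebra.
exists (fun ij => if ij == (i, j) then B else setT); split.
  by move=> ij; case: ifP.
apply/seteqP; split => [X /= BX ij|X /=].
  by case: ifP => // /eqP ->.
by move=> /(_ (i, j)); rewrite eqxx.
Qed.

Lemma measurable_to_rects d (T : measurableType d) (h : T -> MX) :
  (forall i j, measurable_fun setT (fun w => h w i j)) ->
  measurable_fun setT (h : T -> MXs).
Proof.
move=> mh; apply: (@measurability _ _ _ MXs setT _ rects) => //.
move=> _ [_ [B [mB ->]] <-].
rewrite setTI.
have -> : h @^-1` [set X : MX | forall ij, B ij (X ij.1 ij.2)] =
   \bigcap_(ij in [set` [set: 'I_N * 'I_n]%SET]) ((fun w => h w ij.1 ij.2) @^-1` B ij).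
  by apply/seteqP; split => [w hw ij _|w hw ij]; [exact: hw|apply: hw => /=; rewrite inE].
apply: fin_bigcap_measurable => // ij _.
by rewrite -[X in measurable X]setTI; exact: mh.
Qed.

End resample.

Section gaussian.
Context (R : realType) (dT : measure_display) (T : measurableType dT).
Variables (P : probability T R) (N n : nat) (S : 'I_N * 'I_n -> {RV P >-> R}).
Hypothesis gS : gaussian_sketch S.
Local Notation MX := 'M[R]_(N, n).
Local Notation MXs := (g_sigma_algebraType (@rects R N n)).
Local Notation sigma := (Num.sqrt (N%:R^-1 : R)).
Local Notation Sm := (sketch_at S).
Implicit Types (f : MX -> R).

Lemma measurable_sketch i j : measurable_fun setT (fun w => Sm w i j).
Proof.
have -> : (fun w => Sm w i j) = S (i, j) by apply/funext => w; rewrite mxE.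
exact: measurable_funP.
Qed.

Lemma sigma_neq0 (i : 'I_N) : sigma != 0.
Proof.
by rewrite gt_eqF// sqrtr_gt0 invr_gt0 ltr0n; case: N i => // -[].
Qed.

(* The library has two measurable structures on R with the same measurable sets:
   normal_prob lives on measurableTypeR R, real random variables take values in R. *)
Lemma measurable_idR : measurable_fun setT (fun x : measurableTypeR R => x : R).
Proof. by move=> _ B mB; rewrite setTI. Qed.

Lemma integral_sketch_law ij (g : R -> \bar R) :
  (\int[distribution P (S ij)]_x g x =
   \int[pushforward (normal_prob (0 : R) sigma) (fun x : measurableTypeR R => x : R)]_x g x)%E.
Proof.
pose m2 := pushforward_measure (normal_prob (0 : R) sigma) measurable_idR.
transitivity (\int[m2]_x g x)%E; last by [].
by apply: (eq_measure_integral m2) => A mA _; exact: (gS.2 ij A mA).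
Qed.

Lemma moment_sketch_integrable ij p :
  P.-integrable setT (fun w => ((1 + S ij w ^+ 2) ^+ p)%:E).
Proof.
have m0 : measurable_fun setT (fun x : R => (1 + x ^+ 2) ^+ p).
  by apply: measurable_funX; apply: measurable_funD => //; apply: measurable_funX.
have p0 (x : R) : 0 <= (1 + x ^+ 2) ^+ p by rewrite exprn_ge0// addr_ge0 ?sqr_ge0.
have mE : measurable_fun setT (fun x : R => ((1 + x ^+ 2) ^+ p)%:E) by exact/measurable_EFinP.
apply/integrableP; split.
  by apply: (measurableT_comp mE); exact: measurable_funP.
have /integrableP[_] := normal_prob_moment_integrable p (sigma_neq0 ij.1).
apply: le_lt_trans.
rewrite (eq_integral ((fun x : R => `|((1 + x ^+ 2) ^+ p)%:E|%E) \o S ij)); last by [].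
rewrite -ge0_integral_distribution//; last exact: measurableT_comp.
rewrite integral_sketch_law (ge0_integral_pushforward measurable_idR)//.
exact: measurableT_comp.
Qed.

Lemma tame_integrable f : tame f -> P.-integrable setT (fun w => (f (Sm w))%:E).
Proof.
move=> tf; have [C [p [C0 fC]]] := tame_growth tf.
have [K K0 HK] := expr_sum_bound R (index_enum ('I_N * 'I_n)%type) p.
apply: (@le_integrable _ _ _ P setT measurableT _
  (fun w => (C * K)%:E * (1 + \sum_ij ((1 + S ij w ^+ 2) ^+ p)%:E))%E).
- apply/measurable_EFinP; apply: (tame_measurable tf); exact: measurable_sketch.
- move=> w _; rewrite sumEFin -EFinD -EFinM /= lee_fin.
  rewrite [leRHS]ger0_norm; last first.
    rewrite !mulr_ge0// addr_ge0// sumr_ge0// => ij _.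
    by rewrite exprn_ge0// addr_ge0 ?sqr_ge0.
  rewrite (le_trans (fC _))// -mulrA ler_wpM2l//.
  have := HK (fun ij => S ij w ^+ 2) (fun ij => sqr_ge0 _).
  congr (_ ^+ _ <= _); congr (_ + _); apply: eq_bigr => -[i j] _.
  by rewrite !mxE.
- apply: integrableZl => //; apply: integrableD => //.
    apply/integrableP; split => //.
    by rewrite (eq_integral (cst 1%:E)) ?integral_cst//= ?mul1e ?probability_setT ?ltry// => x _; rewrite /= normr1.
  by apply: integrable_sum => // ij *; exact: moment_sketch_integrable.
Qed.

Definition Ex f : R := \int[P]_w f (Sm w).

Lemma Ex_cst c : Ex (fun=> c) = c.
Proof. by rewrite /Ex Rintegral_cst//= (@probability_setT _ _ _ P) mulr1. Qed.

Lemma ExD f g : tame f -> tame g -> Ex (fun X => f X + g X) = Ex f + Ex g.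
Proof. by move=> tf tg; rewrite /Ex RintegralD//; exact: tame_integrable. Qed.

Lemma ExZ c f : tame f -> Ex (fun X => c * f X) = c * Ex f.
Proof. by move=> tf; rewrite /Ex RintegralZl//; exact: tame_integrable. Qed.

Lemma Ex_le f g : tame f -> tame g -> (forall X, f X <= g X) -> Ex f <= Ex g.
Proof.
move=> tf tg fg; apply: le_Rintegral => //; [exact: tame_integrable..].
Qed.

Section stein.
Variables (i0 : 'I_N) (j0 : 'I_n).
Local Notation nu := (distribution P (S (i0, j0))).
Local Notation Phi := (fun z : R * T => set_entry (Sm z.2) i0 j0 z.1).

Lemma measurable_set_entry_sketch :
  measurable_fun [set: R * T] (Phi : R * T -> MXs).
Proof.
apply: measurable_to_rects => i j.
have -> : (fun z : R * T => set_entry (Sm z.2) i0 j0 z.1 i j) =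
    if (i == i0) && (j == j0) then fst else (fun w => Sm w i j) \o snd.
  by apply/funext => z; rewrite set_entryE; case: ifP.
case: ifP => _; first exact: measurable_fst.
by apply: (measurableT_comp (measurable_sketch i j)); exact: measurable_snd.
Qed.

(** Independence enters here. On a box both sides factor into the same product over the entries, and
    boxes determine a finite measure. Thus an entry may be replaced by an independent copy. *)
Lemma law_resample (A : set MX) : (measurable (A : set MXs)) ->
  P (Sm @^-1` A) = (nu \x P)%E (Phi @^-1` A).
Proof.
have mS : measurable_fun setT (Sm : T -> MXs).
  by apply: measurable_to_rects; exact: measurable_sketch.
have mPhi := measurable_set_entry_sketch.
move=> mA.
pose M1 := pushforward_measure P mS.
pose M2 := pushforward_measure (nu \x P)%E mPhi.
suff : M1 A = M2 A by [].
apply: (@measure_unique _ R MXs (@rects R N n) (fun=> setT) _ _ _ _ M1 M2 _ _ A mA) => //.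
- exact: rects_setI.
- by move=> _; exact: rects_setT.
- by apply/seteqP; split => // x _; exists 0%N.
- move=> _ [B [mB ->]].
  change (P (Sm @^-1` [set X : MX | forall ij, B ij (X ij.1 ij.2)]) =
    (nu \x P)%E (Phi @^-1` [set X : MX | forall ij, B ij (X ij.1 ij.2)])).
  have -> : Sm @^-1` [set X : MX | forall ij, B ij (X ij.1 ij.2)] =
     \bigcap_(ij in [set` [set: 'I_N * 'I_n]%SET]) (S ij @^-1` B ij).
    apply/seteqP; split => [w hw [i j] _|w hw [i j]]; first by have := hw (i, j); rewrite /= mxE.
    by rewrite /= mxE; apply: (hw (i, j)) => /=; rewrite inE.
  have -> : Phi @^-1` [set X : MX | forall ij, B ij (X ij.1 ij.2)] =
     B (i0, j0) `*` \bigcap_(ij in [set` [set~ (i0, j0)]%SET]) (S ij @^-1` B ij).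
    apply/seteqP; split => [[x w] /= hw|[x w] /= [h1 h2] [i j]].
      split; first by have := hw (i0, j0); rewrite /= set_entryE !eqxx.
      move=> [i j] /=; rewrite !inE xpair_eqE => /negbTE h.
      by have := hw (i, j); rewrite /= set_entryE h mxE.
    rewrite /= set_entryE -xpair_eqE; case: ifPn => [/eqP ->//|h].
    by rewrite mxE; apply: (h2 (i, j)) => /=; rewrite !inE.
  have mSB ij : measurable (S ij @^-1` B ij).
    by rewrite -[X in measurable X]setTI; exact: measurable_funP.
  rewrite product_measure1E//; last first.
    by apply: fin_bigcap_measurable.
  rewrite gS.1// (bigD1 (i0, j0)) ?inE//=.
  apply: congr2; first by [].
  transitivity (\prod_(ij in [set~ (i0, j0)]%SET) P (S ij @^-1` B ij))%E.
    by apply: eq_bigl => ij; rewrite !inE.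
  by apply/esym; exact: gS.1.
- move=> _; change (P setT < +oo)%E; rewrite probability_setT; exact: ltry.
Qed.

End stein.
End gaussian.

Section gaussian_stein.
Context (R : realType) (dT : measure_display) (T : measurableType dT).
Variables (P : probability T R) (N n : nat) (S : 'I_N * 'I_n -> {RV P >-> R}).
Hypothesis gS : gaussian_sketch S.
Variables (i0 : 'I_N) (j0 : 'I_n).
Local Notation MX := 'M[R]_(N, n).
Local Notation MXs := (g_sigma_algebraType (@rects R N n)).
Local Notation sigma := (Num.sqrt (N%:R^-1 : R)).
Local Notation Sm := (sketch_at S).
Local Notation nu := (distribution P (S (i0, j0))).
Local Notation mu := (@lebesgue_measure R).
Local Notation Phi := (fun z : R * T => set_entry (Sm z.2) i0 j0 z.1).

(** Fubini after [law_resample]: the inner variable is a single Gaussian entry while all the others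
    are frozen, which is the setting of one-variable integration by parts. Integrability over the
    product is carried over from P by the equality of laws. *)
Lemma integral_resample (f : MX -> R) : tame f ->
  (\int[P]_w (f (Sm w))%:E =
   \int[P]_w \int[nu]_x (f (set_entry (Sm w) i0 j0 x))%:E)%E.
Proof.
move=> tf.
have mS : measurable_fun setT (Sm : T -> MXs).
  by apply: measurable_to_rects; exact: measurable_sketch.
have mPhi := measurable_set_entry_sketch S i0 j0.
pose M1 := pushforward_measure P mS.
pose M2 := pushforward_measure (nu \x P)%E mPhi.
have M12 (F : MXs -> \bar R) : (\int[M1]_X F X = \int[M2]_X F X)%E.
  by apply: eq_measure_integral => A mA _; exact: (law_resample gS).
have mf : measurable_fun setT (fun X : MXs => (f X)%:E).
  apply/measurable_EFinP; apply: (@tame_measurable R N n f tf _ _ (fun X : MXs => X : MX)).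
  exact: measurable_entry.
have if1 : P.-integrable setT ((fun X : MXs => (f X)%:E) \o (Sm : T -> MXs)).
  exact: (tame_integrable gS tf).
have mPhif : measurable_fun setT ((fun X : MXs => (f X)%:E) \o Phi).
  exact: (measurableT_comp mf mPhi).
have if2 : (nu \x P)%E.-integrable setT ((fun X : MXs => (f X)%:E) \o Phi).
  apply/integrableP; split => //.
  have /integrableP[_] := if1; apply: le_lt_trans.
  have h1 := ge0_integral_pushforward mPhi (nu \x P)%E measurableT
    (f := fun X : MXs => `|(f X)%:E|%E) (measurableT_comp (@abse_measurable _ _) mf) (fun _ _ => abse_ge0 _).
  have h2 := ge0_integral_pushforward mS P measurableT
    (f := fun X : MXs => `|(f X)%:E|%E) (measurableT_comp (@abse_measurable _ _) mf) (fun _ _ => abse_ge0 _).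
  rewrite -[leLHS]h1 -[leRHS]h2.
  by rewrite -[leRHS]/(\int[M1]_X `|(f X)%:E|)%E M12.
have h1 := integral_pushforward mPhi (mu := (nu \x P)%E) (D := setT) mf if2 measurableT.
have h2 := integral_pushforward mS (mu := P) (D := setT) mf if1 measurableT.
transitivity (\int[M1]_X (f X)%:E)%E; first exact: esym h2.
rewrite M12; apply: (etrans h1).
by rewrite -(integral21_prod_meas1 if2).
Qed.

Lemma integral_law_growth (g : R -> R) (C : R) (p : nat) :
  measurable_fun setT g -> (forall x, `|g x| <= C * (1 + x ^+ 2) ^+ p) ->
  (\int[nu]_x (g x)%:E = \int[mu]_x (g x * normal_pdf 0 sigma x)%:E)%E /\
  mu.-integrable setT (fun x => (g x * normal_pdf 0 sigma x)%:E).
Proof.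
move=> mg gC.
have s0 := sigma_neq0 R i0.
have mg' : measurable_fun setT (fun x : measurableTypeR R => (g x)%:E) by exact/measurable_EFinP.
have C0 : 0 <= C.
  by have := le_trans (normr_ge0 _) (gC 0); rewrite expr0n/= addr0 expr1n mulr1.
have inn : (normal_prob 0 sigma).-integrable setT (fun x : measurableTypeR R => (g x)%:E).
  apply: (@le_integrable _ _ _ (normal_prob 0 sigma) setT measurableT _
    (fun x => (C%:E * ((1 + x ^+ 2) ^+ p)%:E))%E) => //.
    move=> x _; rewrite -EFinM /= lee_fin (ger0_norm (mulr_ge0 _ _))//.
    by rewrite exprn_ge0// addr_ge0 ?sqr_ge0.
  by apply: integrableZl => //; exact: normal_prob_moment_integrable.
split.
  rewrite (integral_sketch_law gS).
  have mE : measurable_fun setT (fun x : R => (g x)%:E) by exact/measurable_EFinP.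
  apply: (etrans (integral_pushforward (@measurable_idR R) (mu := normal_prob 0 sigma)
    (D := setT) mE inn measurableT)).
  by apply: (integral_normal_prob mg'); case/integrableP : inn.
apply: (@le_integrable _ _ _ mu setT measurableT _
    (fun x => (C%:E * ((1 + x ^+ 2) ^+ p * normal_pdf 0 sigma x)%:E))%E).
- apply/measurable_EFinP; apply: measurable_funM => //.
  exact: measurable_normal_pdf.
- move=> x _; rewrite -EFinM /= lee_fin mulrA normrM [leRHS]normrM.
  rewrite ler_wpM2r// (le_trans (gC x))// ler_norm//.
- by apply: integrableZl => //; exact: normal_moment_integrable.
Qed.

Lemma stein_law (u u' : R -> R) (C : R) (p : nat) :
  (forall x : R, is_derive x (1 : R) u (u' x)) -> continuous u' ->
  (forall x, `|u x| <= C * (1 + x ^+ 2) ^+ p) ->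
  (forall x, `|u' x| <= C * (1 + x ^+ 2) ^+ p) ->
  (\int[nu]_x (x * u x)%:E = \int[nu]_x (N%:R^-1 * u' x)%:E)%E.
Proof.
move=> du cu' uC u'C.
have s0 := sigma_neq0 R i0.
have sE : sigma ^+ 2 = N%:R^-1 by rewrite sqr_sqrtr// invr_ge0.
have N0 : (N%:R : R) != 0 by rewrite -invr_eq0 -sE expf_neq0.
have cu : continuous u.
  by move=> x; apply/differentiable_continuous/derivable1_diffP; case: (du x).
have C0 : 0 <= C.
  by have := le_trans (normr_ge0 _) (uC 0); rewrite expr0n/= addr0 expr1n mulr1.
have [|x|-> i1] := @integral_law_growth (fun x => N%:R^-1 * u' x) (N%:R^-1 * C) p.
- by apply: measurable_funM => //; exact: continuous_measurable_fun.
- by rewrite normrM ger0_norm ?invr_ge0// -mulrA ler_wpM2l ?invr_ge0.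
have [|x|-> i2] := @integral_law_growth (fun x => x * u x) C p.+1.
- by apply: measurable_funM => //; exact: continuous_measurable_fun.
- rewrite normrM (exprS _ p) mulrCA; apply: ler_pM => //.
  have := sqr_ge0 (`|x| - 1); have := real_normK (num_real x); nra.
have := stein_normal_pdf s0 du cu' uC u'C; rewrite sE => h.
have f1 := integrable_fin_num measurableT i1.
have f2 := integrable_fin_num measurableT i2.
apply/eqP; rewrite eq_sym -[X in _ == X]add0e -(sube_eq f1 (fin_num_adde_defl 0%E f2)).
rewrite -integralB//.
rewrite -(mule0 (N%:R^-1)%:E) -h -integralZl//; last first.
  have := integrableZl measurableT N%:R (integrableB measurableT i1 i2).
  apply: eq_integrable => // x _ /=.
  by rewrite -EFinB -EFinM /=; congr (_%:E); rewrite invrK; field.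
apply/eqP; apply: eq_integral => x _; rewrite -!EFinM -EFinB; congr (_%:E).
by rewrite invrK; field.
Qed.

(** The identity holds already for each fixed value of the other entries. The growth constant [K]
    depends on these values, which is harmless since it is used outcome by outcome. *)
Lemma Ex_stein (f df : MX -> R) : tame f ->
  (forall X, ddir f X (delta_mx i0 j0) (df X)) ->
  Ex S (fun X => X i0 j0 * f X) = N%:R^-1 * Ex S df.
Proof.
move=> tf hdf; have tdf := ddir_tame tf hdf.
have tXf : tame (fun X : MX => X i0 j0 * f X) by apply: tameM => //; exact: tame_coord.
rewrite /Ex -RintegralZl//; last exact: tame_integrable.
rewrite /Rintegral; congr fine.
have tN : tame (fun X => N%:R^-1 * df X) by exact: tameZ.
rewrite (integral_resample tXf) (integral_resample tN).
apply: eq_integral => w _; set X := Sm w.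
under eq_integral do rewrite set_entryE !eqxx.
have [C [p [C0 fC]]] := tame_growth tf.
have [D [q [D0 dfD]]] := tame_growth tdf.
have du (x : R) : is_derive x (1 : R) (fun y => f (set_entry X i0 j0 y)) (df (set_entry X i0 j0 x)).
  have h := hdf (set_entry X i0 j0 x).
  have -> : (fun y => f (set_entry X i0 j0 y)) =
     (fun t => f (set_entry X i0 j0 x + t *: delta_mx i0 j0)) \o (fun y => y - x).
    apply/funext => y /=; congr f.
    by rewrite /set_entry -addrA -scalerDl; congr (_ + _ *: _); ring.
  have h' : is_derive (x - x) (1 : R) (fun t => f (set_entry X i0 j0 x + t *: delta_mx i0 j0)) (df (set_entry X i0 j0 x)).
    by rewrite subrr.
  have h2 : is_derive x (1 : R) (fun y : R => y - x) 1.
    by apply: is_derive_eq; rewrite subr0.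
  have := @is_derive1_comp R _ _ x _ _ h' h2.
  by rewrite mulr1.
(* The derivative is tame, hence itself differentiable along the line, hence continuous. *)
have [ddf tddf hddf] := tame_ddir (delta_mx i0 j0) tdf.
have cdf : continuous (fun y => df (set_entry X i0 j0 y)).
  move=> x; apply/differentiable_continuous/derivable1_diffP.
  have h := hddf (set_entry X i0 j0 x).
  have -> : (fun y => df (set_entry X i0 j0 y)) =
     (fun t => df (set_entry X i0 j0 x + t *: delta_mx i0 j0)) \o (fun y => y - x).
    apply/funext => y /=; congr df.
    by rewrite /set_entry -addrA -scalerDl; congr (_ + _ *: _); ring.
  have h' : is_derive (x - x) (1 : R) (fun t => df (set_entry X i0 j0 x + t *: delta_mx i0 j0)) (ddf (set_entry X i0 j0 x)).
    by rewrite subrr.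
  have h2 : is_derive x (1 : R) (fun y : R => y - x) 1.
    by apply: is_derive_eq; rewrite subr0.
  by case: (@is_derive1_comp R _ _ x _ _ h' h2).
have growth (g : MX -> R) (B : R) r : 0 <= B -> (forall Y, `|g Y| <= B * (1 + sqnorm Y) ^+ r) ->
    forall x, `|g (set_entry X i0 j0 x)| <= B * (1 + sqnorm X) ^+ r * (1 + x ^+ 2) ^+ r.
  move=> B0 gB x; rewrite (le_trans (gB _))// -mulrA -exprMn ler_wpM2l//.
  rewrite lerXn2r ?nnegrE ?mulr_ge0 ?addr_ge0 ?sqnorm_ge0 ?sqr_ge0//.
  have := sqnorm_set_entry X i0 j0 x.
  have := mulr_ge0 (sqnorm_ge0 X) (sqr_ge0 x); nra.
pose K := C * (1 + sqnorm X) ^+ p + D * (1 + sqnorm X) ^+ q.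
have K1 : 0 <= C * (1 + sqnorm X) ^+ p by rewrite mulr_ge0// exprn_ge0// addr_ge0// sqnorm_ge0.
have K2 : 0 <= D * (1 + sqnorm X) ^+ q by rewrite mulr_ge0// exprn_ge0// addr_ge0// sqnorm_ge0.
have x1 (x : R) : 1 <= 1 + x ^+ 2 by rewrite lerDl sqr_ge0.
apply: (@stein_law _ _ K (maxn p q) du cdf) => x.
- apply: (le_trans (growth f C p C0 fC x)); apply: ler_pM => //.
  + by rewrite exprn_ge0// addr_ge0// sqr_ge0.
  + by rewrite lerDl.
  + by rewrite ler_weXn2l// leq_maxl.
- apply: (le_trans (growth df D q D0 dfD x)); apply: ler_pM => //.
  + by rewrite exprn_ge0// addr_ge0// sqr_ge0.
  + by rewrite lerDr.
  + by rewrite ler_weXn2l// leq_maxr.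
Qed.
End gaussian_stein.

(** * Spectral decomposition and statistical dimension *)

Section dotm.
Variable R : realDomainType.

(** On columns this is the Euclidean inner product, so vectors and matrices share one set of
    rules. *)
Definition dotm (p q : nat) (A B : 'M[R]_(p, q)) : R := \tr (A^T *m B).

Lemma dotmE p q (A B : 'M[R]_(p, q)) : dotm A B = \sum_i \sum_j A i j * B i j.
Proof.
rewrite /dotm /mxtrace exchange_big /=; apply: eq_bigr => j _.
by rewrite mxE; apply: eq_bigr => i _; rewrite mxE.
Qed.

Lemma dotmC p q (A B : 'M[R]_(p, q)) : dotm A B = dotm B A.
Proof. by rewrite /dotm -mxtrace_tr trmx_mul trmxK. Qed.

Lemma dotmDl p q (A B C : 'M[R]_(p, q)) : dotm (A + B) C = dotm A C + dotm B C.
Proof. by rewrite /dotm linearD /= mulmxDl linearD. Qed.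

Lemma dotmDr p q (A B C : 'M[R]_(p, q)) : dotm C (A + B) = dotm C A + dotm C B.
Proof. by rewrite /dotm mulmxDr linearD. Qed.

Lemma dotmNl p q (A B : 'M[R]_(p, q)) : dotm (- A) B = - dotm A B.
Proof. by rewrite /dotm linearN /= mulNmx linearN. Qed.

Lemma dotmNr p q (A B : 'M[R]_(p, q)) : dotm A (- B) = - dotm A B.
Proof. by rewrite /dotm mulmxN linearN. Qed.

Lemma dotmBl p q (A B C : 'M[R]_(p, q)) : dotm (A - B) C = dotm A C - dotm B C.
Proof. by rewrite dotmDl dotmNl. Qed.

Lemma dotmBr p q (A B C : 'M[R]_(p, q)) : dotm C (A - B) = dotm C A - dotm C B.
Proof. by rewrite dotmDr dotmNr. Qed.

Lemma dotmZl p q c (A B : 'M[R]_(p, q)) : dotm (c *: A) B = c * dotm A B.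
Proof. by rewrite /dotm linearZ /= -scalemxAl linearZ. Qed.

Lemma dotmZr p q c (A B : 'M[R]_(p, q)) : dotm A (c *: B) = c * dotm A B.
Proof. by rewrite /dotm -scalemxAr linearZ. Qed.

Lemma dotm0l p q (A : 'M[R]_(p, q)) : dotm 0 A = 0.
Proof. by rewrite /dotm trmx0 mul0mx mxtrace0. Qed.

Lemma dotm_tr p q (A B : 'M[R]_(p, q)) : dotm A^T B^T = dotm A B.
Proof. by rewrite dotmC /dotm trmxK mxtrace_mulC. Qed.

Lemma dotm_mull p q r (A : 'M[R]_(p, q)) (B : 'M[R]_(q, r)) C :
  dotm (A *m B) C = dotm B (A^T *m C).
Proof. by rewrite /dotm trmx_mul mulmxA. Qed.

Lemma dotm_mulr p q r (A : 'M[R]_(p, q)) (B : 'M[R]_(q, r)) C :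
  dotm (A *m B) C = dotm A (C *m B^T).
Proof. by rewrite /dotm trmx_mul -mulmxA mxtrace_mulC mulmxA. Qed.

Lemma dotm_ge0 p q (A : 'M[R]_(p, q)) : 0 <= dotm A A.
Proof. by rewrite dotmE; apply: sumr_ge0 => i _; apply: sumr_ge0 => j _; rewrite -expr2 sqr_ge0. Qed.

Lemma dotm_eq0 p q (A : 'M[R]_(p, q)) : dotm A A = 0 -> A = 0.
Proof.
move=> /eqP; rewrite dotmE pair_big /= psumr_eq0; last first.
  by move=> ij _; rewrite -expr2 sqr_ge0.
move=> /allP h; apply/matrixP => i j; rewrite mxE.
by have := h (i, j) (mem_index_enum _); rewrite /= -expr2 sqrf_eq0 => /eqP.
Qed.

(* The determinant of the Gram matrix of A and B is nonnegative. *)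
Lemma dotm_cs p q (A B : 'M[R]_(p, q)) : dotm A B ^+ 2 <= dotm A A * dotm B B.
Proof.
have [B0|Bn0] := eqVneq (dotm B B) 0.
  by rewrite (dotm_eq0 B0) dotmC !dotm0l mulr0 expr0n.
have Bp : 0 < dotm B B by rewrite lt_neqAle eq_sym Bn0 dotm_ge0.
have := dotm_ge0 (dotm B B *: A - dotm A B *: B).
rewrite dotmBl !dotmBr !dotmZl !dotmZr (dotmC B A) => h.
rewrite -subr_ge0 -(pmulr_rge0 _ Bp); move: h; congr (0 <= _); ring.
Qed.

Lemma dotm_mul_le p q r (A : 'M[R]_(p, q)) (B : 'M[R]_(q, r)) :
  dotm (A *m B) (A *m B) <= dotm A A * dotm B B.
Proof.
have e (i : 'I_p) (j : 'I_r) : (A *m B) i j ^+ 2 <=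
    (\sum_k A i k ^+ 2) * (\sum_k B k j ^+ 2).
  have := dotm_cs (row i A)^T (col j B).
  rewrite !dotmE; congr (_ ^+ 2 <= _ * _).
  - by rewrite mxE; apply: eq_bigr => k _; rewrite big_ord1 !mxE.
  - by apply: eq_bigr => k _; rewrite big_ord1 !mxE expr2.
  - by apply: eq_bigr => k _; rewrite big_ord1 !mxE expr2.
rewrite !dotmE (exchange_big _ _ _ _ _ (fun i j => B i j * B i j)) /= mulr_suml.
apply: ler_sum => i _; rewrite mulr_sumr; apply: ler_sum => j _.
apply: le_trans (e i j); rewrite expr2//.
Qed.

End dotm.

(** * The spectral theorem for real symmetric matrices *)

Section spectral_real.
Variable R : rcfType.

(** Take an eigenvector p + i q with complex eigenvalue c. Symmetry gives <p A, q> = <p, q A>, that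
    is Im c (|p|^2 + |q|^2) = 0; so c is real, and p or q is a real eigenvector. *)
Lemma symmetric_eigenvector k (A : 'M[R]_k.+1) : A^T = A ->
  exists a (u : 'rV[R]_k.+1), u != 0 /\ u *m A = a *: u.
Proof.
move=> sA.
have [c /eigenvalueP [v vA v0]] := @eigenvalue_closed (R[i])%C _ (map_mx (real_complex R) A) isT.
pose p := map_mx (@complex.Re R) v; pose q := map_mx (@complex.Im R) v.
have pA : p *m A = complex.Re c *: p - complex.Im c *: q.
  apply/rowP => j; have := congr1 (fun w : 'rV_ _ => complex.Re (w 0 j)) vA.
  rewrite !mxE raddf_sum /= => h.
  have -> : complex.Re c * complex.Re (v 0 j) - complex.Im c * complex.Im (v 0 j) = complex.Re (c * v 0 j).
    by case: c (v 0 j) {h vA} => [x y] [z t] /=.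
  rewrite -h; apply: eq_bigr => i _; rewrite !mxE /=.
  by case: (v 0 i) => x y /=; rewrite mulr0 subr0.
have qA : q *m A = complex.Im c *: p + complex.Re c *: q.
  apply/rowP => j; have := congr1 (fun w : 'rV_ _ => complex.Im (w 0 j)) vA.
  rewrite !mxE raddf_sum /= => h.
  have -> : complex.Im c * complex.Re (v 0 j) + complex.Re c * complex.Im (v 0 j) = complex.Im (c * v 0 j).
    by case: c (v 0 j) {h vA pA} => [x y] [z t] /=; rewrite addrC.
  rewrite -h; apply: eq_bigr => i _; rewrite !mxE /=.
  by case: (v 0 i) => x y /=; rewrite mulr0 add0r.
have pq0 : (p != 0) || (q != 0).
  apply: contraR v0; rewrite negb_or !negbK => /andP[/eqP p0 /eqP q0].
  apply/eqP/rowP => j; have := congr1 (fun w : 'rV_ _ => w 0 j) p0.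
  have := congr1 (fun w : 'rV_ _ => w 0 j) q0.
  by rewrite !mxE; case: (v 0 j) => x y /= -> ->.
have Ic0 : complex.Im c = 0.
  have h : dotm (p *m A) q = dotm p (q *m A) by rewrite dotm_mulr sA.
  rewrite pA qA dotmBl dotmDr !dotmZl !dotmZr in h.
  have h0 : complex.Im c * (dotm p p + dotm q q) = 0 by lra.
  move/eqP: h0; rewrite mulf_eq0 => /orP[/eqP//|].
  rewrite paddr_eq0 ?dotm_ge0// => /andP[/eqP /dotm_eq0 p0 /eqP /dotm_eq0 q0].
  by move: pq0; rewrite p0 q0 eqxx.
exists (complex.Re c); case/orP: pq0 => h; [exists p|exists q]; split => //.
  by rewrite pA Ic0 scale0r subr0.
by rewrite qA Ic0 scale0r add0r.
Qed.

(* Householder reflection. *)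
Lemma reflection_to_unit k (u e : 'rV[R]_k) : dotm u u = 1 -> dotm e e = 1 ->
  exists H : 'M[R]_k, [/\ H^T = H, H *m H = 1%:M & e *m H = u].
Proof.
move=> u1 e1; have [ue|ue] := eqVneq e u.
  by exists 1%:M; rewrite trmx1 mulmx1 mulmx1.
pose w := e - u.
have w0 : dotm w w != 0.
  by apply: contra_neq ue => /dotm_eq0 /eqP; rewrite subr_eq0 => /eqP.
have dot_mx (a b : 'rV[R]_k) : a *m b^T = (dotm a b)%:M.
  by rewrite [LHS]mx11_scalar dotmC /dotm mxtrace_mulC -trace_mx11.
pose c := 2 / dotm w w.
exists (1%:M - c *: (w^T *m w)).
have sW : (w^T *m w)^T = w^T *m w by rewrite trmx_mul trmxK.
have WW : w^T *m w *m (w^T *m w) = dotm w w *: (w^T *m w).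
  by rewrite mulmxA -(mulmxA w^T) dot_mx mul_mx_scalar -scalemxAl.
have eW : e *m (w^T *m w) = dotm e w *: w by rewrite mulmxA dot_mx mul_scalar_mx.
have ww : dotm w w = 2 * dotm e w.
  by rewrite /w !dotmBr !dotmBl u1 e1 (dotmC u e); ring.
move: (w^T *m w) sW WW eW => W sW WW eW.
split.
- by rewrite linearB linearZ /= trmx1 sW.
- rewrite mulmxBl !mulmxBr !mul1mx !mulmx1 -scalemxAl -scalemxAr WW !scalerA.
  have -> : c * c * dotm w w = c + c by rewrite /c; field.
  by rewrite scalerDl opprB; apply/matrixP => i j; rewrite !mxE; ring.
- rewrite mulmxBr mulmx1 -scalemxAr eW scalerA.
  have -> : c * dotm e w = 1.
    have ew0 : dotm e w != 0 by apply: contra_neq w0 => h; rewrite ww h mulr0.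
    by rewrite /c ww; field.
  by rewrite scale1r /w opprB addrC subrK.
Qed.

(** Deflation: a reflection taking the first basis vector to a unit eigenvector conjugates A to a
    block diagonal matrix, and the induction hypothesis applies to the lower block. *)
Theorem symmetric_spectral k (A : 'M[R]_k) : A^T = A ->
  exists (U : 'M[R]_k) (d : 'rV[R]_k), U *m U^T = 1%:M /\ A = U^T *m diag_mx d *m U.
Proof.
elim: k A => [|k IH] A sA.
  by exists 1%:M, 0; split; [rewrite trmx1 mulmx1|rewrite [LHS]flatmx0 [RHS]flatmx0].
have [a [u0 [u00 uA0]]] := symmetric_eigenvector sA.
have n0 : 0 < dotm u0 u0.
  by rewrite lt_neqAle dotm_ge0 andbT eq_sym; apply: contra_neq u00 => /dotm_eq0.
pose u := (Num.sqrt (dotm u0 u0))^-1 *: u0.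
have uA : u *m A = a *: u by rewrite /u -scalemxAl uA0 !scalerA mulrC.
have u1 : dotm u u = 1.
  rewrite /u dotmZl dotmZr mulrA -expr2 exprVn sqr_sqrtr ?(ltW n0)//.
  by rewrite mulVf// gt_eqF.
pose e : 'rV[R]_(1 + k) := row_mx 1%:M 0.
have e1 : dotm e e = 1.
  rewrite /e /dotm tr_row_mx mul_col_row mxtrace_block trmx1 mul1mx.
  by rewrite trmx0 mul0mx mxtrace0 addr0 mxtrace1.
have [H [sH HH eH]] := @reflection_to_unit (1 + k) u e u1 e1.
pose A1 : 'M[R]_(1 + k) := H *m A *m H.
have sA1 : A1^T = A1 by rewrite /A1 !trmx_mul sH sA mulmxA.
have eA1 : e *m A1 = a *: e.
  rewrite /A1 !mulmxA eH uA -scalemxAl -eH -mulmxA HH mulmx1//.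
have Ul : ulsubmx A1 = a%:M.
  have := congr1 lsubmx eA1; rewrite -{1}(submxK A1) mul_row_block !mul1mx !mul0mx !addr0.
  by rewrite row_mxKl /e scale_row_mx row_mxKl scalemx1.
have Ur : ursubmx A1 = 0.
  have := congr1 rsubmx eA1; rewrite -{1}(submxK A1) mul_row_block !mul1mx !mul0mx !addr0.
  by rewrite row_mxKr /e scale_row_mx row_mxKr scaler0.
have Dl : dlsubmx A1 = 0.
  by rewrite -[A1]sA1 -trmx_ursub Ur trmx0.
pose A' := drsubmx A1.
have sA' : A'^T = A' by rewrite /A' trmx_drsub sA1.
have [U [d [OO A'E]]] := IH A' sA'.
pose B : 'M[R]_(1 + k) := block_mx 1%:M 0 0 U.
pose D : 'rV[R]_(1 + k) := row_mx a%:M d.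
have BB : B *m B^T = 1%:M.
  rewrite /B tr_block_mx mulmx_block.
  rewrite !trmx1 !trmx0 !mul0mx !mulmx0 !mulmx1 !addr0 !add0r OO.
  by apply: esym; exact: (scalar_mx_block 1 k 1).
have BDB : B^T *m diag_mx D *m B = A1.
  have -> : diag_mx D = block_mx a%:M 0 0 (diag_mx d).
    by rewrite diag_mx_row; congr block_mx; apply/matrixP => i j; rewrite !mxE !ord1 eqxx.
  rewrite tr_block_mx !trmx0 trmx1 !mulmx_block.
  rewrite !mul0mx !mulmx0 !mul1mx !mulmx1 !addr0 !add0r -A'E.
  by rewrite -[RHS]submxK Ul Ur Dl !mul0mx.
exists (B *m H), D; split.
  by rewrite trmx_mul sH mulmxA -(mulmxA _ H H) HH mulmx1.
rewrite trmx_mul sH !mulmxA -(mulmxA H) -(mulmxA H) BDB.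
by rewrite /A1 !mulmxA HH mul1mx -mulmxA HH mulmx1.
Qed.

End spectral_real.

(** * Statistical dimension in terms of eigenvalues *)

Section stat_dim.
Variable R : realType.

Lemma orthoC k (O : 'M[R]_k) : O *m O^T = 1%:M -> O^T *m O = 1%:M.
Proof. exact: mulmx1C. Qed.

Lemma char_poly_orthogonal k (O : 'M[R]_k) (d : 'rV[R]_k) : O *m O^T = 1%:M ->
  char_poly (O^T *m diag_mx d *m O) = \prod_i ('X - (d 0 i)%:P).
Proof.
move=> OO; have OO' := orthoC OO.
pose Op := map_mx polyC O.
have OpOp : Op^T *m Op = 1%:M by rewrite /Op map_trmx -map_mxM OO' map_mx1.
have -> : \prod_i ('X - (d 0 i)%:P) = char_poly (diag_mx d).
  rewrite char_poly_trig ?diag_mx_is_trig//.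
  by apply: eq_bigr => i _; rewrite mxE eqxx.
rewrite /char_poly /char_poly_mx.
have -> : 'X%:M - map_mx polyC (O^T *m diag_mx d *m O) =
    Op^T *m ('X%:M - map_mx polyC (diag_mx d)) *m Op.
  rewrite !map_mxM -map_trmx mulmxBr mulmxBl; congr (_ - _).
  by rewrite mul_mx_scalar -scalemxAl OpOp scalemx1.
rewrite !det_mulmx mulrAC -det_mulmx OpOp det1 mul1r//.
Qed.

Lemma mup_prod_XsubC (I : finType) (d : I -> R) (x : R) :
  mup x (\prod_i ('X - (d i)%:P)) = (\sum_i (d i == x))%N.
Proof.
have h (r : seq I) : \prod_(i <- r) ('X - (d i)%:P) != 0.
  by rewrite prodf_seq_neq0; apply/allP => i _; rewrite /= polyXsubC_eq0.
elim: (index_enum I) => [|i r IH].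
  by rewrite !big_nil mupNroot// root1.
rewrite !big_cons mupM ?h ?polyXsubC_eq0// IH; congr addn.
have := mup_XsubCX 1 x (d i); rewrite expr1 => ->.
by rewrite eq_sym; case: eqP.
Qed.

Lemma eigenvalue_gram_ge0 n k (M : 'M[R]_(n, k)) (O : 'M[R]_k) (d : 'rV[R]_k) :
  O *m O^T = 1%:M -> M^T *m M = O^T *m diag_mx d *m O -> forall i, 0 <= d 0 i.
Proof.
move=> OO MM i.
have h : (M *m O^T)^T *m (M *m O^T) = diag_mx d.
  rewrite trmx_mul trmxK mulmxA -(mulmxA O) MM !mulmxA OO mul1mx -mulmxA OO mulmx1//.
have := congr1 (fun A : 'M[R]_k => A i i) h; rewrite !mxE eqxx mulr1n => <-.
by apply: sumr_ge0 => j _; rewrite !mxE -expr2 sqr_ge0.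
Qed.

(** The multiplicity of a root mu counts the indices i with d_i = mu, so the sum over roots regroups
    into one over indices. Zero eigenvalues, filtered out on the left, contribute 0 on the right. *)
Lemma stat_dim_spectral n k (M : 'M[R]_(n, k)) (O : 'M[R]_k) (d : 'rV[R]_k) lambda :
  0 < lambda -> O *m O^T = 1%:M -> M^T *m M = O^T *m diag_mx d *m O ->
  stat_dim lambda M = \sum_i d 0 i / (d 0 i + lambda).
Proof.
move=> l0 OO MM; have d0 := eigenvalue_gram_ge0 OO MM.
rewrite /stat_dim /singular_values MM char_poly_orthogonal//.
set p := \prod_i _.
have p0 : p != 0 by rewrite prodf_seq_neq0; apply/allP => i _; rewrite /= polyXsubC_eq0.
pose g (x : R) := x / (x + lambda).
rewrite big_flatten big_map.
have rd i : d 0 i \in rootsR p.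
  rewrite -(roots_on_rootsR p0) in_itv/= rootE /p horner_prod.
  by apply/prodf_eq0; exists i => //; rewrite hornerXsubC subrr.
have ur : uniq (rootsR p) by exact: uniq_roots.
transitivity (\sum_(mu <- rootsR p) \sum_i (if d 0 i == mu then g mu else 0)).
  apply: eq_big_seq => mu mup_; rewrite big_nseq_cond /p mup_prod_XsubC.
  have mu0 : 0 <= mu.
    move: mup_; rewrite -(roots_on_rootsR p0) in_itv/= rootE /p horner_prod.
    by move=> /prodf_eq0[i _]; rewrite hornerXsubC subr_eq0 => /eqP ->.
  rewrite sqrtr_eq0 -ltNge; case: ifPn => [mup1|].
    rewrite sqr_sqrtr// iter_addr_0 -sumrMnr; apply: eq_bigr => i _.
    case: eqP => _; rewrite ?mulr1n ?mulr0n// /g.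
    by field; rewrite !gt_eqF ?addr_gt0.
  rewrite -leNgt => mule0; have -> : mu = 0 by apply/eqP; rewrite eq_le mu0 mule0.
  by rewrite big1// => i _; case: ifP => // _; rewrite /g mul0r.
rewrite exchange_big /=; apply: eq_bigr => i _.
rewrite (bigD1_seq (d 0 i))//= eqxx big1 ?addr0// => mu.
by rewrite eq_sym => /negbTE ->.
Qed.

Lemma stat_dim_ge0 n k (M : 'M[R]_(n, k)) lambda : 0 < lambda -> 0 <= stat_dim lambda M.
Proof.
move=> l0; rewrite /stat_dim; apply: sumr_ge0 => s s0.
by rewrite divr_ge0// addr_ge0// divr_ge0// ?sqr_ge0// ltW.
Qed.

(** Every eigenvalue of lambda + C^T C is at least lambda. Uniformity in C is what makes the entries
    of the ridge inverse tame functions of the sketch. *)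
Lemma det_ridge_ge n k (C : 'M[R]_(n, k)) lambda : 0 < lambda ->
  lambda ^+ k <= \det (lambda%:M + C^T *m C).
Proof.
move=> l0.
have [U [d [OO CC]]] :
  exists (U : 'M[R]_k) (d : 'rV[R]_k),
    U *m U^T = 1%:M /\ C^T *m C = U^T *m diag_mx d *m U.
  by apply: symmetric_spectral; rewrite trmx_mul trmxK.
have d0 := eigenvalue_gram_ge0 OO CC.
have -> : lambda%:M + C^T *m C = U^T *m diag_mx (const_mx lambda + d) *m U.
  rewrite linearD /= diag_const_mx mulmxDr mulmxDl -CC; congr (_ + _).
  by rewrite mul_mx_scalar -scalemxAl (orthoC OO) scalemx1.
rewrite !det_mulmx mulrAC -det_mulmx (orthoC OO) det1 mul1r det_diag.
rewrite -[X in _ ^+ X]card_ord -prodr_const; apply: ler_prod => i _.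
by rewrite !mxE (ltW l0) lerDl d0.
Qed.

(* Directions with squared singular value at least lambda each contribute at
   least 1/2 to the statistical dimension, so there are at most 2 s of them; the
   others contribute at least sigma^2 / (2 lambda). *)
Lemma spectral_split n k (M : 'M[R]_(n, k)) lambda : 0 < lambda ->
  exists (Pi : 'M[R]_k) (m : nat),
    [/\ Pi^T = Pi, Pi *m Pi = Pi, Pi *m (M^T *m M) = M^T *m M *m Pi,
        (\rank (M *m (1%:M - Pi)) <= m)%N /\ m%:R <= 2 * stat_dim lambda M &
        dotm (M *m Pi) (M *m Pi) <= 2 * stat_dim lambda M * lambda].
Proof.
move=> l0.
have [U [d [OO MM]]] :
  exists (U : 'M[R]_k) (d : 'rV[R]_k),
    U *m U^T = 1%:M /\ M^T *m M = U^T *m diag_mx d *m U.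
  by apply: symmetric_spectral; rewrite trmx_mul trmxK.
have OO' := orthoC OO.
have d0 := eigenvalue_gram_ge0 OO MM.
rewrite (stat_dim_spectral l0 OO MM) MM.
pose D : 'rV[R]_k := \row_i ((d 0 i < lambda)%R)%:R.
have conjM (a b : 'rV[R]_k) : U^T *m diag_mx a *m U *m (U^T *m diag_mx b *m U) =
    U^T *m (diag_mx a *m diag_mx b) *m U.
  by rewrite !mulmxA -(mulmxA (U^T *m diag_mx a)) OO mulmx1.
have tr_conj (a : 'M[R]_k) : \tr (U^T *m a *m U) = \tr a.
  by rewrite mxtrace_mulC mulmxA OO mul1mx.
have DD : diag_mx D *m diag_mx D = diag_mx D.
  rewrite mulmx_diag; congr diag_mx; apply/rowP => i; rewrite !mxE.
  by case: ltP; rewrite ?mulr0 ?mulr1.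
exists (U^T *m diag_mx D *m U), #|[pred i | (lambda <= d 0 i)%R]|.
split.
- by rewrite !trmx_mul trmxK tr_diag_mx mulmxA.
- by rewrite conjM DD.
- by rewrite !conjM diag_mx_comm.
- split; last first.
    rewrite mulr_sumr -sum1_card natr_sum big_mkcond /=; apply: ler_sum => i _.
    rewrite inE; have dl : 0 < d 0 i + lambda by rewrite ltr_wpDl.
    case: ifP => [h|_]; last by rewrite mulr_ge0 ?divr_ge0// ltW.
    by rewrite mulrA ler_pdivlMr// mul1r; lra.
  apply: leq_trans (mxrankM_maxr _ _) _.
  (* The complementary projector is a sum of rank-one matrices, one for each eigenvalue at least
     [lambda]. *)
  have -> : 1%:M - U^T *m diag_mx D *m U =
      \sum_(i in [pred i | (lambda <= d 0 i)%R]) (U^T *m delta_mx i i *m U).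
    rewrite -mulmx_suml -mulmx_sumr -[in LHS]OO' -[in X in X - _](mulmx1 U^T).
    rewrite -mulmxBl -mulmxBr; congr (_ *m _ *m _).
    apply/matrixP => i j; rewrite summxE !mxE.
    under eq_bigr do rewrite mxE.
    have [<-|ij] := eqVneq i j; last first.
      rewrite mulr0n mulr0n subr0 big1// => l _.
      by case: (eqVneq i l) => [<-|]//=; rewrite eq_sym (negbTE ij).
    rewrite !mulr1n; have [h|h] := leP lambda (d 0 i).
      rewrite subr0 (bigD1 i) ?inE//= eqxx big1 ?addr0// => l /andP[_ /negbTE].
      by rewrite eq_sym => ->.
    rewrite subrr big1// => l; rewrite inE => hl.
    by case: eqP => // il; move: hl; rewrite -il leNgt h.
  rewrite -sum1_card; elim/big_ind2 : _ => [||i _].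
  + by rewrite mxrank0.
  + by move=> A a B b hA hB; apply: leq_trans (mxrank_add _ _) _; exact: leq_add.
  + apply: leq_trans (mxrankM_maxl _ _) _; apply: leq_trans (mxrankM_maxr _ _) _.
    by rewrite mxrank_delta.
- have tPi : (U^T *m diag_mx D *m U)^T = U^T *m diag_mx D *m U.
    by rewrite !trmx_mul trmxK tr_diag_mx mulmxA.
  rewrite /dotm trmx_mul tPi -(mulmxA _ M^T) (mulmxA M^T) MM conjM mulmx_diag conjM tr_conj.
  rewrite mulmx_diag mxtrace_diag -mulrA mulr_suml mulr_sumr; apply: ler_sum => i _.
  rewrite !mxE; have dl : 0 < d 0 i + lambda by rewrite ltr_wpDl.
  have [h|h] := ltP (d 0 i) lambda; last first.
    by rewrite mul0r mulr_ge0// mulr_ge0 ?(ltW l0)// divr_ge0 ?d0// ltW.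
  rewrite mulr1 mul1r.
  have -> : 2 * (d 0 i / (d 0 i + lambda) * lambda) = 2 * d 0 i * lambda / (d 0 i + lambda) by ring.
  rewrite ler_pdivlMr//; have := d0 i; nra.
Qed.

End stat_dim.

(** * Matrix calculus *)

Section matrix_calculus.
Variables (R : realType) (N n : nat).
Local Notation MX := 'M[R]_(N, n).
Implicit Types (X V : MX) (f g : MX -> R).

Lemma ddir_sum (I : Type) (r : seq I) (F : I -> MX -> R) X V (dF : I -> R) :
  (forall i, ddir (F i) X V (dF i)) ->
  ddir (fun X => \sum_(i <- r) F i X) X V (\sum_(i <- r) dF i).
Proof.
move=> hF; elim: r => [|i r IH].
  have -> : (fun X => \sum_(i <- [::]) F i X) = fun=> 0.
    by apply/funext => Y; rewrite big_nil.
  by rewrite big_nil; exact: ddir_cst.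
have -> : (fun X => \sum_(j <- i :: r) F j X) = (fun X => F i X + \sum_(j <- r) F j X).
  by apply/funext => Y; rewrite big_cons.
by rewrite big_cons; exact: ddirD.
Qed.

Definition mtame p q (F : MX -> 'M[R]_(p, q)) := forall i j, tame (fun X => F X i j).

Definition mddir p q (F : MX -> 'M[R]_(p, q)) X V (D : 'M[R]_(p, q)) :=
  forall i j, ddir (fun X => F X i j) X V (D i j).

Lemma eq_tame f g : f =1 g -> tame f -> tame g.
Proof. by move=> /funext ->. Qed.

Lemma eq_ddir f g X V d : f =1 g -> ddir f X V d -> ddir g X V d.
Proof. by move=> /funext ->. Qed.

Lemma mtame_cst p q (A : 'M[R]_(p, q)) : mtame (fun=> A).
Proof. by move=> i j; exact: tame_cst. Qed.

Lemma mtame_id : mtame (fun X => X).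
Proof. by move=> i j; exact: tame_coord. Qed.

Lemma mtameD p q (F G : MX -> 'M[R]_(p, q)) : mtame F -> mtame G ->
  mtame (fun X => F X + G X).
Proof.
move=> tF tG i j; apply: (@eq_tame (fun X => F X i j + G X i j)).
  by move=> X; rewrite mxE.
exact: tameD.
Qed.

Lemma mtameN p q (F : MX -> 'M[R]_(p, q)) : mtame F -> mtame (fun X => - F X).
Proof.
move=> tF i j; apply: (@eq_tame (fun X => - F X i j)); last exact: tameN.
by move=> X; rewrite mxE.
Qed.

Lemma mtameB p q (F G : MX -> 'M[R]_(p, q)) : mtame F -> mtame G ->
  mtame (fun X => F X - G X).
Proof. by move=> tF tG; apply: mtameD => //; exact: mtameN. Qed.

Lemma mtameM p q r (F : MX -> 'M[R]_(p, q)) (G : MX -> 'M[R]_(q, r)) :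
  mtame F -> mtame G -> mtame (fun X => F X *m G X).
Proof.
move=> tF tG i j; apply: (@eq_tame (fun X => \sum_k F X i k * G X k j)).
  by move=> X; rewrite mxE.
by apply: tame_sum => k; exact: tameM.
Qed.

Lemma mtame_tr p q (F : MX -> 'M[R]_(p, q)) : mtame F -> mtame (fun X => (F X)^T).
Proof.
by move=> tF i j; apply: (@eq_tame (fun X => F X j i)) => // X; rewrite mxE.
Qed.

Lemma mtame_scale p q f (F : MX -> 'M[R]_(p, q)) : tame f -> mtame F ->
  mtame (fun X => f X *: F X).
Proof.
move=> tf tF i j; apply: (@eq_tame (fun X => f X * F X i j)); last exact: tameM.
by move=> X; rewrite mxE.
Qed.

Lemma tame_mxtrace p (F : MX -> 'M[R]_p) : mtame F -> tame (fun X => \tr (F X)).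
Proof. by move=> tF; apply: tame_sum => i; exact: tF. Qed.

Lemma tame_dotm p q (F G : MX -> 'M[R]_(p, q)) : mtame F -> mtame G ->
  tame (fun X => dotm (F X) (G X)).
Proof. by move=> tF tG; apply: tame_mxtrace; apply: mtameM => //; exact: mtame_tr. Qed.

Lemma tame_det p (F : MX -> 'M[R]_p) : mtame F -> tame (fun X => \det (F X)).
Proof.
move=> tF; apply: tame_sum => s; apply: tameM; first exact: tame_cst.
by apply: tame_prod => i; exact: tF.
Qed.

(** Cramer's rule: a cofactor, polynomial in the entries of Q, over a determinant bounded below. *)
Lemma mtame_invmx p (Q : MX -> 'M[R]_p) c : 0 < c -> (forall X, c <= \det (Q X)) ->
  mtame Q -> mtame (fun X => invmx (Q X)).
Proof.
move=> c0 cQ tQ i j.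
apply: (@eq_tame (fun X => (\det (Q X))^-1 * ((-1) ^+ (j + i) * \det (row' j (col' i (Q X)))))).
  move=> X; rewrite /invmx unitmxE unitfE gt_eqF ?(lt_le_trans c0)//.
  by rewrite mxE mxE.
apply: tameM; first by apply: tameV c0 cQ _; exact: tame_det.
apply: tameM; first exact: tame_cst.
apply: tame_det => a b; apply: (@eq_tame (fun X => Q X (lift j a) (lift i b))) => // X.
by rewrite !mxE.
Qed.

Lemma mddir_cst p q (A : 'M[R]_(p, q)) X V : mddir (fun=> A) X V 0.
Proof. by move=> i j; rewrite mxE; exact: ddir_cst. Qed.

Lemma mddir_id X V : mddir (fun X => X) X V V.
Proof. by move=> i j; exact: ddir_coord. Qed.

Lemma mddirD p q (F G : MX -> 'M[R]_(p, q)) X V dF dG :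
  mddir F X V dF -> mddir G X V dG -> mddir (fun X => F X + G X) X V (dF + dG).
Proof.
move=> hF hG i j; rewrite mxE; apply: (@eq_ddir (fun X => F X i j + G X i j)).
  by move=> Y; rewrite mxE.
exact: ddirD.
Qed.

Lemma mddirN p q (F : MX -> 'M[R]_(p, q)) X V dF :
  mddir F X V dF -> mddir (fun X => - F X) X V (- dF).
Proof.
move=> hF i j; rewrite mxE; apply: (@eq_ddir (fun X => - F X i j)).
  by move=> Y; rewrite mxE.
exact: ddirN.
Qed.

Lemma mddirB p q (F G : MX -> 'M[R]_(p, q)) X V dF dG :
  mddir F X V dF -> mddir G X V dG -> mddir (fun X => F X - G X) X V (dF - dG).
Proof. by move=> hF hG; apply: mddirD => //; exact: mddirN. Qed.

Lemma mddirM p q r (F : MX -> 'M[R]_(p, q)) (G : MX -> 'M[R]_(q, r)) X V dF dG :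
  mddir F X V dF -> mddir G X V dG ->
  mddir (fun X => F X *m G X) X V (dF *m G X + F X *m dG).
Proof.
move=> hF hG i j; apply: (@eq_ddir (fun X => \sum_k F X i k * G X k j)).
  by move=> Y; rewrite mxE.
have -> : (dF *m G X + F X *m dG) i j = \sum_k (dF i k * G X k j + F X i k * dG k j).
  by rewrite !mxE big_split.
by apply: ddir_sum => k; exact: ddirM.
Qed.

Lemma mddir_tr p q (F : MX -> 'M[R]_(p, q)) X V dF :
  mddir F X V dF -> mddir (fun X => (F X)^T) X V dF^T.
Proof.
move=> hF i j; rewrite mxE; apply: (@eq_ddir (fun X => F X j i)) => // Y.
by rewrite mxE.
Qed.

Lemma mddir_scale p q f (F : MX -> 'M[R]_(p, q)) X V df dF :
  ddir f X V df -> mddir F X V dF ->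
  mddir (fun X => f X *: F X) X V (df *: F X + f X *: dF).
Proof.
move=> hf hF i j; apply: (@eq_ddir (fun X => f X * F X i j)).
  by move=> Y; rewrite mxE.
by rewrite !mxE; exact: ddirM.
Qed.

Lemma ddir_mxtrace p (F : MX -> 'M[R]_p) X V dF :
  mddir F X V dF -> ddir (fun X => \tr (F X)) X V (\tr dF).
Proof. by move=> hF; apply: ddir_sum => i; exact: hF. Qed.

Lemma ddir_dotm p q (F G : MX -> 'M[R]_(p, q)) X V dF dG :
  mddir F X V dF -> mddir G X V dG ->
  ddir (fun X => dotm (F X) (G X)) X V (dotm dF (G X) + dotm (F X) dG).
Proof.
move=> hF hG; rewrite /dotm -linearD; apply: ddir_mxtrace.
by apply: mddirM => //; exact: mddir_tr.
Qed.

Lemma mddir_unique p q (F : MX -> 'M[R]_(p, q)) X V D1 D2 :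
  mddir F X V D1 -> mddir F X V D2 -> D1 = D2.
Proof. by move=> h1 h2; apply/matrixP => i j; exact: ddir_unique (h1 i j) (h2 i j). Qed.

(* Differentiate Q *m Q^-1 = 1. *)
Lemma mddir_invmx p (Q : MX -> 'M[R]_p) c X V dQ : 0 < c ->
  (forall X, c <= \det (Q X)) -> mtame Q -> mddir Q X V dQ ->
  mddir (fun X => invmx (Q X)) X V (- (invmx (Q X) *m dQ *m invmx (Q X))).
Proof.
move=> c0 cQ tQ hQ.
have uQ Y : Q Y \in unitmx by rewrite unitmxE unitfE gt_eqF// (lt_le_trans c0).
have tW := mtame_invmx c0 cQ tQ.
(* Tameness of the inverse provides the existence of its derivative; the product rule then only has
   to identify it. *)
pose D := \matrix_(i, j) 'D_1 (fun t : R => invmx (Q (X + t *: V)) i j) 0.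
have hD : mddir (fun X => invmx (Q X)) X V D.
  move=> i j; have [df _ hdf] := tame_ddir V (tW i j).
  by rewrite mxE; case: (hdf X) => h1 h2; split.
have := mddirM hQ hD => h.
have h1 : mddir (fun X => Q X *m invmx (Q X)) X V 0.
  have -> : (fun X => Q X *m invmx (Q X)) = fun=> 1%:M.
    by apply/funext => Y; rewrite mulmxV.
  exact: mddir_cst.
have e := mddir_unique h h1.
suff <- : D = - (invmx (Q X) *m dQ *m invmx (Q X)) by [].
have : invmx (Q X) *m (dQ *m invmx (Q X) + Q X *m D) = 0 by rewrite e mulmx0.
by rewrite mulmxDr !mulmxA mulVmx// mul1mx => /eqP; rewrite addrC addr_eq0 => /eqP.
Qed.

(** The trace of a linear map on matrices; for the differential of a field it is the divergence of
    the field. *)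
Definition mdiv (L : MX -> MX) : R := \sum_i \sum_j L (delta_mx i j) i j.

Lemma mdivD L1 L2 : mdiv (fun V => L1 V + L2 V) = mdiv L1 + mdiv L2.
Proof.
rewrite /mdiv -big_split; apply: eq_bigr => i _; rewrite -big_split.
by apply: eq_bigr => j _; rewrite mxE.
Qed.

Lemma mdivN L : mdiv (fun V => - L V) = - mdiv L.
Proof.
rewrite /mdiv -sumrN; apply: eq_bigr => i _; rewrite -sumrN.
by apply: eq_bigr => j _; rewrite mxE.
Qed.

Lemma mdivB L1 L2 : mdiv (fun V => L1 V - L2 V) = mdiv L1 - mdiv L2.
Proof. by rewrite mdivD mdivN. Qed.

Lemma mdivZ c L : mdiv (fun V => c *: L V) = c * mdiv L.
Proof.
rewrite /mdiv mulr_sumr; apply: eq_bigr => i _; rewrite mulr_sumr.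
by apply: eq_bigr => j _; rewrite mxE.
Qed.

(** The differentials of the unweighted fields below are sums of terms C V D and C V^T D, so this
    rule and the next one compute their divergences. *)
Lemma mdiv_sandwich (C : 'M[R]_N) (D : 'M[R]_n) :
  mdiv (fun V => C *m V *m D) = \tr C * \tr D.
Proof.
rewrite /mdiv /mxtrace mulr_suml; apply: eq_bigr => i _; rewrite mulr_sumr.
apply: eq_bigr => j _; rewrite -mulmxA mxE (bigD1 i)//= big1 ?addr0; last first.
  move=> k ki; rewrite mxE big1 ?mulr0// => l _.
  by rewrite mxE (negbTE ki) mul0r.
rewrite mxE (bigD1 j)//= big1 ?addr0; last first.
  by move=> l lj; rewrite mxE (negbTE lj) andbF mul0r.
by rewrite mxE !eqxx mul1r.
Qed.

Lemma mdiv_sandwich_tr (C D : MX) :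
  mdiv (fun V => C *m V^T *m D) = dotm C D.
Proof.
rewrite /mdiv dotmE; apply: eq_bigr => i _; apply: eq_bigr => j _.
rewrite -mulmxA mxE (bigD1 j)//= big1 ?addr0; last first.
  move=> k kj; rewrite mxE big1 ?mulr0// => l _.
  by rewrite !mxE (negbTE kj) andbF mul0r.
rewrite mxE (bigD1 i)//= big1 ?addr0; last first.
  by move=> l li; rewrite !mxE (negbTE li) mul0r.
by rewrite !mxE !eqxx mul1r.
Qed.

Lemma mdiv_dotm (G F : MX) : mdiv (fun V => dotm G V *: F) = dotm G F.
Proof.
rewrite /mdiv dotmE; apply: eq_bigr => i _; apply: eq_bigr => j _.
rewrite mxE; congr (_ * _); rewrite dotmE (bigD1 i)//= [X in _ + X]big1 ?addr0; last first.
  by move=> k ki; rewrite big1// => l _; rewrite mxE (negbTE ki) mulr0.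
rewrite (bigD1 j)//= big1 ?addr0; last first.
  by move=> l lj; rewrite mxE (negbTE lj) andbF mulr0.
by rewrite mxE !eqxx mulr1.
Qed.

Definition hgrad f (G : MX -> MX) := forall X V, ddir f X V (dotm (G X) V).

Lemma hgrad_cst (c : R) : hgrad (fun=> c) (fun=> 0).
Proof. by move=> X V; rewrite dotm0l; exact: ddir_cst. Qed.

Lemma hgradD f g F G : hgrad f F -> hgrad g G ->
  hgrad (fun X => f X + g X) (fun X => F X + G X).
Proof. by move=> hf hg X V; rewrite dotmDl; exact: ddirD. Qed.

Lemma hgradM f g F G : hgrad f F -> hgrad g G ->
  hgrad (fun X => f X * g X) (fun X => g X *: F X + f X *: G X).
Proof.
move=> hf hg X V; rewrite dotmDl !dotmZl (mulrC (g X)); exact: ddirM.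
Qed.

Lemma hgradZ c f F : hgrad f F -> hgrad (fun X => c * f X) (fun X => c *: F X).
Proof.
move=> hf X V; rewrite dotmZl.
by have := ddirM (ddir_cst c X V) (hf X V); rewrite mul0r add0r.
Qed.

(** The interface between probability and algebra: the bounds on the expected excess use only these
    properties of the expectation. *)
Record gaussian_mean (E : (MX -> R) -> R) : Prop := GaussianMean {
  gm_cst : forall c, E (fun=> c) = c;
  gmD : forall f g, tame f -> tame g -> E (fun X => f X + g X) = E f + E g;
  gmZ : forall c f, tame f -> E (fun X => c * f X) = c * E f;
  gm_le : forall f g, tame f -> tame g -> (forall X, f X <= g X) -> E f <= E g;
  gm_stein : forall f df i j, tame f -> (forall X, ddir f X (delta_mx i j) (df X)) ->
    E (fun X => X i j * f X) = N%:R^-1 * E df }.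

Section mean.
Variable E : (MX -> R) -> R.
Hypothesis hE : gaussian_mean E.

Lemma gm_ge0 f : tame f -> (forall X, 0 <= f X) -> 0 <= E f.
Proof. by move=> tf f0; rewrite -(gm_cst hE 0); apply: (gm_le hE) => //; exact: tame_cst. Qed.

Lemma gmB f g : tame f -> tame g -> E (fun X => f X - g X) = E f - E g.
Proof.
move=> tf tg; rewrite (gmD hE)//; last exact: tameN.
congr (_ + _); rewrite -mulN1r -(gmZ hE)//; congr E.
by apply/funext => X; rewrite mulN1r.
Qed.

Lemma gm_sum (I : Type) (r : seq I) (F : I -> MX -> R) : (forall i, tame (F i)) ->
  E (fun X => \sum_(i <- r) F i X) = \sum_(i <- r) E (F i).
Proof.
move=> tF; elim: r => [|i r IH].
  rewrite big_nil -[RHS](gm_cst hE); congr E.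
  by apply/funext => X; rewrite big_nil.
rewrite big_cons -IH -(gmD hE)//; last exact: tame_sum.
by congr E; apply/funext => X; rewrite big_cons.
Qed.

Lemma gm_div F dF : mtame F -> (forall X V, mddir F X V (dF X V)) ->
  E (fun X => dotm X (F X)) = N%:R^-1 * E (fun X => mdiv (dF X)).
Proof.
move=> tF hF.
have -> : (fun X => dotm X (F X)) = (fun X => \sum_i \sum_j X i j * F X i j).
  by apply/funext => X; rewrite dotmE.
have tdF i j : tame (fun X => dF X (delta_mx i j) i j).
  by apply: (ddir_tame (tF i j)) => X; exact: hF.
have tXF i j : tame (fun X => X i j * F X i j).
  by apply: tameM => //; exact: tame_coord.
rewrite /mdiv !gm_sum; [|by move=> i; exact: tame_sum..].
rewrite mulr_sumr; apply: eq_bigr => i _; rewrite !gm_sum// mulr_sumr.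
by apply: eq_bigr => j _; apply: (gm_stein hE) => // X; exact: hF.
Qed.

(** div (phi F) = phi div F + <grad phi, F>: integration by parts against a weighted field. *)
Lemma gm_div_scaled phi G F dF (D : MX -> R) : tame phi -> hgrad phi G -> mtame F ->
  (forall X V, mddir F X V (dF X V)) -> (forall X, mdiv (dF X) = D X) ->
  E (fun X => phi X * dotm X (F X)) =
  N%:R^-1 * E (fun X => phi X * D X + dotm (G X) (F X)).
Proof.
move=> tphi hphi tF hF hD.
have -> : (fun X => phi X * dotm X (F X)) = (fun X => dotm X (phi X *: F X)).
  by apply/funext => X; rewrite dotmZr.
rewrite (@gm_div _ (fun X V => dotm (G X) V *: F X + phi X *: dF X V)); last 2 first.
- exact: mtame_scale.
- by move=> X V; exact: mddir_scale.
congr (_ * E _); apply/funext => X.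
by rewrite mdivD mdivZ mdiv_dotm hD addrC.
Qed.

End mean.
End matrix_calculus.

Lemma Ex_gaussian_mean (R : realType) (dT : measure_display) (T : measurableType dT)
    (P : probability T R) (N n : nat) (S : 'I_N * 'I_n -> {RV P >-> R}) :
  gaussian_sketch S -> gaussian_mean (Ex S).
Proof.
move=> gS; split.
- exact: Ex_cst.
- exact: ExD.
- exact: ExZ.
- exact: Ex_le.
- by move=> f df i j; exact: Ex_stein.
Qed.

(** * Ridge inverses *)

Lemma dotm_young (R : realFieldType) p q (c : R) (A B : 'M[R]_(p, q)) : 0 < c ->
  2 * dotm A B <= c * dotm A A + c^-1 * dotm B B.
Proof.
move=> c0; have := dotm_ge0 (c *: A - B).
rewrite dotmBl !dotmBr !dotmZl !dotmZr (dotmC B A) => h.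
rewrite -subr_ge0 -(pmulr_rge0 _ c0).
have -> : c * (c * dotm A A + c^-1 * dotm B B - 2 * dotm A B) =
  c * (c * dotm A A) - c * dotm A B - (c * dotm A B - dotm B B) by field; rewrite gt_eqF.
by [].
Qed.

Lemma le_of_sqr_le (R : realDomainType) (x y : R) : 0 <= y -> x ^+ 2 <= y ^+ 2 -> x <= y.
Proof.
move=> y0 xy; have [//|yx] := leP x y.
have : y ^+ 2 < x ^+ 2 by nra.
by rewrite ltNge xy.
Qed.

Section projector.
Variable R : realFieldType.

(** The matrix 1 - B (B^T B)^-1 B^T, with B a basis of the column space of C. A left inverse of B
    shows that B^T B is invertible. *)
Lemma orthogonal_projector N k (C : 'M[R]_(N, k)) :
  exists P : 'M[R]_N, [/\ P^T = P, P *m P = P, P *m C = 0 &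
    \tr P = N%:R - (\rank C)%:R].
Proof.
have [B [D [B' [B'B CE]]]] : exists (B : 'M[R]_(N, \rank C)) D B',
    B' *m B = 1%:M /\ C = B *m D.
  have /row_fullP[B' B'B] := col_base_full C.
  by exists (col_base C), (row_base C), B'; rewrite mulmx_base.
pose G := B^T *m B.
have sG : G^T = G by rewrite trmx_mul trmxK.
have uG : G \in unitmx.
  rewrite -row_free_unit -kermx_eq0; set K := kermx G.
  have KG : K *m G = 0 by exact: mulmx_ker.
  have BK : B *m K^T = 0.
    have GK : G *m K^T = 0 by rewrite -{1}sG -trmx_mul KG trmx0.
    by apply: dotm_eq0; rewrite dotm_mull mulmxA GK dotmC dotm0l.
  by rewrite -(trmxK K) -[K^T]mul1mx -B'B -mulmxA BK mulmx0 trmx0.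
pose H := B *m invmx G *m B^T.
have sH : H^T = H by rewrite /H !trmx_mul trmxK trmx_inv sG mulmxA.
have HB : H *m B = B by rewrite /H -!mulmxA (mulVmx uG) mulmx1.
have HH : H *m H = H by rewrite {2 3}/H !mulmxA HB.
exists (1%:M - H); split.
- by rewrite linearB /= trmx1 sH.
- by rewrite mulmxBl !mulmxBr !mul1mx mulmx1 HH subrr subr0.
- by rewrite CE mulmxA mulmxBl mul1mx HB subrr mul0mx.
- by rewrite linearB /= mxtrace1 mxtrace_mulC mulmxA (mulmxV uG) mxtrace1.
Qed.

Lemma dotm_projector_le N k (P : 'M[R]_N) (A : 'M[R]_(N, k)) :
  P^T = P -> P *m P = P -> dotm (P *m A) (P *m A) <= dotm A A.
Proof.
move=> sP PP; have := dotm_ge0 (A - P *m A).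
rewrite dotmBl !dotmBr (dotm_mull _ A (P *m A)) sP mulmxA PP.
by rewrite (dotmC (P *m A) A); lra.
Qed.

End projector.

Section ridge_inverse.
Variables (R : realType) (N k : nat) (lam : R) (C : 'M[R]_(N, k)).
Hypothesis l0 : 0 < lam.

Definition ridge_inv : 'M[R]_k := invmx (lam%:M + C^T *m C).
Local Notation W := ridge_inv.

Lemma ridge_unit : lam%:M + C^T *m C \in unitmx.
Proof.
rewrite unitmxE unitfE gt_eqF// (lt_le_trans _ (det_ridge_ge C l0))//.
exact: exprn_gt0.
Qed.

Lemma ridge_inv_sym : W^T = W.
Proof. by rewrite /W trmx_inv linearD /= tr_scalar_mx trmx_mul trmxK. Qed.

Lemma gram_ridge_inv : C^T *m C *m W = 1%:M - lam *: W.
Proof.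
by rewrite -(mulmxV ridge_unit) -/W mulmxDl mul_scalar_mx addrAC subrr add0r.
Qed.

Lemma ridge_invE : W = lam *: (W *m W) + (C *m W)^T *m (C *m W).
Proof.
have := congr1 (mulmx W) gram_ridge_inv.
rewrite mulmxBr mulmx1 -scalemxAr => h.
rewrite trmx_mul ridge_inv_sym -mulmxA (mulmxA C^T) h.
by rewrite addrC subrK.
Qed.

(** By [ridge_invE], W = L^T L. Quadratic forms in W thus become squared Frobenius norms, to which
    submultiplicativity applies without a matrix square root. *)
Let L := col_mx (Num.sqrt lam *: W) (C *m W).

Let LL : L^T *m L = W.
Proof.
have sW : (Num.sqrt lam *: W)^T = Num.sqrt lam *: W by rewrite linearZ /= ridge_inv_sym.
rewrite /L tr_col_mx mul_row_col sW -scalemxAl -scalemxAr scalerA.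
by rewrite -expr2 sqr_sqrtr ?(ltW l0)// -ridge_invE.
Qed.

Let dotmW p (U : 'M[R]_(k, p)) : dotm U (W *m U) = dotm (L *m U) (L *m U).
Proof. by rewrite dotm_mull mulmxA LL. Qed.

Lemma dotm_ridge_invE p (U : 'M[R]_(k, p)) :
  dotm U (W *m U) = lam * dotm (W *m U) (W *m U) + dotm (C *m W *m U) (C *m W *m U).
Proof.
rewrite {1}ridge_invE mulmxDl dotmDr -scalemxAl dotmZr; congr (_ * _ + _).
  by rewrite [RHS]dotm_mull ridge_inv_sym mulmxA.
by rewrite [RHS]dotm_mull !mulmxA.
Qed.

Lemma dotm_ridge_inv_ge0 p (U : 'M[R]_(k, p)) : 0 <= dotm U (W *m U).
Proof. by rewrite dotmW dotm_ge0. Qed.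

Lemma dotm_CW_le p (U : 'M[R]_(k, p)) :
  dotm (C *m W *m U) (C *m W *m U) <= dotm U (W *m U).
Proof. by rewrite dotm_ridge_invE lerDr mulr_ge0 ?(ltW l0) ?dotm_ge0. Qed.

Lemma dotm_W_le p (U : 'M[R]_(k, p)) : lam * dotm (W *m U) (W *m U) <= dotm U (W *m U).
Proof. by rewrite dotm_ridge_invE lerDl dotm_ge0. Qed.

Lemma dotm_ridge_inv_le p (U : 'M[R]_(k, p)) : lam * dotm U (W *m U) <= dotm U U.
Proof.
have h := dotm_young U (lam *: (W *m U)) ltr01.
rewrite invr1 !mul1r !dotmZl !dotmZr in h.
have := ler_wpM2l (ltW l0) (dotm_W_le U); lra.
Qed.

Lemma dotm_BW_le p q (B : 'M[R]_(q, k)) (U : 'M[R]_(k, p)) :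
  dotm (B *m W *m U) (B *m W *m U) <= dotm B^T (W *m B^T) * dotm U (W *m U).
Proof.
have -> : B *m W *m U = (B *m L^T) *m (L *m U) by rewrite mulmxA -(mulmxA B L^T) LL.
apply: le_trans (dotm_mul_le _ _) _.
by rewrite !dotmW -dotm_tr trmx_mul trmxK.
Qed.

Lemma dotm_BWB_le p q (B : 'M[R]_(k, q)) (U : 'M[R]_(q, p)) :
  dotm (B *m U) (W *m (B *m U)) <= dotm B (W *m B) * dotm U U.
Proof. by rewrite !dotmW mulmxA; exact: dotm_mul_le. Qed.

(* Any test projector P bounds the trace of K = (1 + C C^T / lam)^-1 from below:
   expand the square of K^(1/2) - beta K^(-1/2) P. *)
Lemma trace_residual_ge (P : 'M[R]_N) (beta : R) : P^T = P -> P *m P = P ->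
  2 * beta * \tr P - beta ^+ 2 * (\tr P + dotm (P *m C) (P *m C) / lam) <=
  N%:R - dotm C^T (W *m C^T).
Proof.
move=> sP PP.
pose K := 1%:M - C *m W *m C^T.
have sK : K^T = K.
  by rewrite linearB /= trmx1 !trmx_mul trmxK ridge_inv_sym mulmxA.
have KK : dotm K K + lam * dotm (W *m C^T) (W *m C^T) = N%:R - dotm C^T (W *m C^T).
  have h := dotm_ridge_invE C^T.
  have e1 : dotm 1%:M (C *m W *m C^T) = dotm C^T (W *m C^T).
    by rewrite /dotm trmx1 mul1mx trmxK mulmxA.
  have e0 : dotm (1%:M : 'M[R]_N) 1%:M = N%:R by rewrite /dotm trmx1 mul1mx mxtrace1.
  rewrite /K dotmBl !dotmBr e0 (dotmC _ 1%:M) e1; lra.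
have KP : dotm K P + dotm (W *m C^T) (C^T *m P) = \tr P.
  rewrite /K dotmBl.
  have -> : dotm 1%:M P = \tr P by rewrite /dotm trmx1 mul1mx.
  by rewrite -mulmxA (dotm_mull C); ring.
have PPt : dotm P P = \tr P by rewrite /dotm sP PP.
have CP : dotm (C^T *m P) (C^T *m P) = dotm (P *m C) (P *m C).
  by rewrite -dotm_tr trmx_mul trmxK sP.
clearbody K.
(* The square equals |K - beta P|^2 + |lam W C^T - beta C^T P|^2 / lam, which avoids the roots of
   K. *)
have h1 := dotm_ge0 (K - beta *: P).
have h2 := dotm_ge0 (lam *: (W *m C^T) - beta *: (C^T *m P)).
rewrite dotmBl !dotmBr !dotmZl !dotmZr (dotmC P K) PPt in h1.
rewrite dotmBl !dotmBr !dotmZl !dotmZr (dotmC (C^T *m P) (W *m C^T)) CP in h2.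
have {}h2 : 0 <= lam * dotm (W *m C^T) (W *m C^T) - 2 * beta * dotm (W *m C^T) (C^T *m P)
    + beta ^+ 2 * (dotm (P *m C) (P *m C) / lam).
  rewrite -(pmulr_rge0 _ l0); move: h2; congr (0 <= _).
  by field; rewrite gt_eqF.
rewrite -KK -{1}KP mulrDr mulrDr; lra.
Qed.

End ridge_inverse.

Lemma dotm_outer (R : realDomainType) p q s (A : 'M[R]_(p, q)) (u : 'M[R]_(p, s)) (w : 'M[R]_(q, s)) :
  dotm A (u *m w^T) = dotm (A *m w) u.
Proof. by rewrite dotm_mulr. Qed.

Lemma mxtrace_outer (R : realDomainType) p (u w : 'cV[R]_p) : \tr (u *m w^T) = dotm w u.
Proof. by rewrite mxtrace_mulC. Qed.

(** * Vector fields of the sketched problem and their divergences *)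

Section sketched_ridge.
Variables (R : realType) (N n k : nat) (lam : R) (M : 'M[R]_(n, k)).
Variables (r : 'cV[R]_n) (x : 'cV[R]_k).
Hypothesis l0 : 0 < lam.
Hypothesis hr : M^T *m r = lam *: x.
Local Notation MX := 'M[R]_(N, n).
Local Notation W X := (ridge_inv lam (X *m M)).
Implicit Types X V : MX.

Definition ridge_err X : 'cV[R]_k := W X *m ((X *m M)^T *m (X *m r) - M^T *m r).
Local Notation z := ridge_err.
(** For r = b - M x this is b - M y, the residual of the sketched solution y = x + z; [rho] is its
    sketch. *)
Definition resid X : 'cV[R]_n := r - M *m z X.
Local Notation v := resid.
Local Notation y X := (x + z X).
Local Notation rho X := (X *m v X).
Definition tr_inv X : R := dotm M^T (W X *m M^T).
Local Notation t := tr_inv.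
Definition tr_hat X : R := dotm (X *m M)^T (W X *m (X *m M)^T).
Local Notation h := tr_hat.

Lemma mddir_eq p q (F : MX -> 'M[R]_(p, q)) X V D1 D2 :
  mddir F X V D1 -> D1 = D2 -> mddir F X V D2.
Proof. by move=> hF <-. Qed.

Lemma mddir_mull p q s (A : 'M[R]_(p, q)) (F : MX -> 'M[R]_(q, s)) X V dF :
  mddir F X V dF -> mddir (fun X => A *m F X) X V (A *m dF).
Proof.
move=> hF; apply: mddir_eq (mddirM (mddir_cst A X V) hF) _.
by rewrite mul0mx add0r.
Qed.

Lemma mddir_mulr p q s (F : MX -> 'M[R]_(p, q)) (A : 'M[R]_(q, s)) X V dF :
  mddir F X V dF -> mddir (fun X => F X *m A) X V (dF *m A).
Proof.
move=> hF; apply: mddir_eq (mddirM hF (mddir_cst A X V)) _.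
by rewrite mulmx0 addr0.
Qed.

Lemma mddir_lin p (A : 'M[R]_(n, p)) X V : mddir (fun X => X *m A) X V (V *m A).
Proof. by apply: mddir_mulr; exact: mddir_id. Qed.

Lemma mtame_lin p (A : 'M[R]_(n, p)) : mtame (fun X => X *m A).
Proof. by apply: mtameM; [exact: mtame_id|exact: mtame_cst]. Qed.

Let dQ X V := (V *m M)^T *m (X *m M) + (X *m M)^T *m (V *m M).

Let mtame_Q : mtame (fun X => lam%:M + (X *m M)^T *m (X *m M)).
Proof.
apply: mtameD; first exact: mtame_cst.
by apply: mtameM; [apply: mtame_tr|]; exact: mtame_lin.
Qed.

Lemma mtame_W : mtame (fun X => W X).
Proof.
apply: (@mtame_invmx _ _ _ _ _ (lam ^+ k)); [exact: exprn_gt0| |exact: mtame_Q].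
by move=> X; exact: det_ridge_ge.
Qed.

Lemma mddir_W X V : mddir (fun X => W X) X V (- (W X *m dQ X V *m W X)).
Proof.
apply: (@mddir_invmx _ _ _ _ _ (lam ^+ k)); [exact: exprn_gt0| |exact: mtame_Q|].
  by move=> Y; exact: det_ridge_ge.
apply: mddir_eq.
  apply: mddirD; first exact: mddir_cst.
  by apply: mddirM; [apply: mddir_tr|]; exact: mddir_lin.
by rewrite add0r.
Qed.

Lemma mtame_z : mtame z.
Proof.
apply: mtameM; first exact: mtame_W.
apply: mtameB; last exact: mtame_cst.
by apply: mtameM; [apply: mtame_tr|]; exact: mtame_lin.
Qed.

Lemma mtame_v : mtame v.
Proof.
apply: mtameB; first exact: mtame_cst.
by apply: mtameM; [exact: mtame_cst|exact: mtame_z].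
Qed.

Lemma mtame_rho : mtame (fun X => rho X).
Proof. by apply: mtameM; [exact: mtame_id|exact: mtame_v]. Qed.

Lemma mtame_CWM : mtame (fun X => X *m M *m W X *m M^T).
Proof.
apply: mtameM; last exact: mtame_cst.
by apply: mtameM; [exact: mtame_lin|exact: mtame_W].
Qed.

Lemma tame_t : tame t.
Proof.
apply: tame_dotm; first exact: mtame_cst.
by apply: mtameM; [exact: mtame_W|exact: mtame_cst].
Qed.

Lemma tame_h : tame h.
Proof.
have tC : mtame (fun X => (X *m M)^T) by apply: mtame_tr; exact: mtame_lin.
by apply: tame_dotm => //; apply: mtameM => //; exact: mtame_W.
Qed.

(** The derivative of W contributes - W dQ z, which turns the r in the derivative of the right-hand
    side into v = r - M z. *)
Lemma mddir_z X V :
  mddir z X V (W X *m (M^T *m V^T *m rho X + (X *m M)^T *m V *m v X)).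
Proof.
apply: mddir_eq.
  apply: mddirM; first exact: mddir_W.
  apply: mddirB; last exact: mddir_cst.
  apply: mddirM; first by apply: mddir_tr; exact: mddir_lin.
  exact: mddir_lin.
rewrite subr0 mulNmx -!mulmxA -/(z X) -mulmxN -mulmxDr; congr (_ *m _).
rewrite /dQ /v !mulmxBr mulmxDl trmx_mul !mulmxA opprD.
apply/matrixP => i j; rewrite !mxE; ring.
Qed.

Lemma ridge_err_eq X :
  (X *m M)^T *m (X *m M) *m z X + lam *: z X = (X *m M)^T *m (X *m r) - M^T *m r.
Proof.
rewrite /z mulmxA gram_ridge_inv// mulmxBl mul1mx -scalemxAl subrK//.
Qed.

(** The normal equations of the sketched problem at y. *)
Lemma kkt X : (X *m M)^T *m rho X = lam *: y X.
Proof.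
have := ridge_err_eq X; rewrite hr => e.
rewrite /v mulmxBr mulmxBr mulmxA (mulmxA X M) mulmxA.
have -> : (X *m M)^T *m X *m r = (X *m M)^T *m (X *m M) *m z X + lam *: z X + lam *: x.
  by rewrite e subrK mulmxA.
by rewrite scalerDr; apply/matrixP => i j; rewrite !mxE; ring.
Qed.

Definition grad_t X : MX := (-2) *: (X *m M *m W X *m M^T *m M *m W X *m M^T).

Lemma hgrad_t : hgrad t grad_t.
Proof.
move=> X V.
have h1 := ddir_dotm (mddir_cst M^T X V) (mddir_mulr M^T (mddir_W X V)).
suff <- : dotm 0 (W X *m M^T) + dotm M^T (- (W X *m dQ X V *m W X) *m M^T) =
  dotm (grad_t X) V by [].
pose U := W X *m M^T.
have -> : - (W X *m dQ X V *m W X) *m M^T = - (W X *m (dQ X V *m U)).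
  by rewrite mulNmx /U !mulmxA.
rewrite dotm0l add0r dotmNr -{1}(ridge_inv_sym lam (X *m M)) -dotm_mull -/U.
have e1 : dotm U ((V *m M)^T *m (X *m M) *m U) = dotm (X *m M *m U) (V *m (M *m U)).
  by rewrite -mulmxA -dotm_mull dotmC -(mulmxA V).
have e2 : dotm U ((X *m M)^T *m (V *m M) *m U) = dotm (X *m M *m U) (V *m (M *m U)).
  by rewrite -mulmxA -dotm_mull -(mulmxA V).
rewrite /dQ mulmxDl dotmDr e1 e2 dotmC dotm_mulr dotmC /grad_t dotmZl.
have -> : X *m M *m U *m (M *m U)^T = X *m M *m W X *m M^T *m M *m W X *m M^T.
  by rewrite /U !trmx_mul trmxK ridge_inv_sym !mulmxA.
ring.
Qed.

(** The inner product of this field with X is h, and its divergence contains (N - h) t; this is how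
    the mean of t gets bounded by that of h. *)
Lemma mddir_CWM X V :
  mddir (fun X => X *m M *m W X *m M^T) X V
    (1%:M *m V *m (M *m W X *m M^T)
     - X *m M *m W X *m M^T *m V^T *m (X *m M *m W X *m M^T)
     - X *m M *m W X *m (X *m M)^T *m V *m (M *m W X *m M^T)).
Proof.
apply: mddir_eq.
  apply: mddir_mulr; apply: mddirM; [exact: mddir_lin|exact: mddir_W].
rewrite /dQ mul1mx !(mulmxN, mulNmx, mulmxDl, mulmxDr, trmx_mul, mulmxA).
apply/matrixP => i j; rewrite !mxE; ring.
Qed.

Lemma tr_MWM X : \tr (M *m W X *m M^T) = t X.
Proof. by rewrite /t /dotm trmxK mulmxA. Qed.

Lemma tr_CWC X : \tr (X *m M *m W X *m (X *m M)^T) = h X.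
Proof. by rewrite /h /dotm trmxK mulmxA. Qed.

Lemma mdiv_CWM X :
  mdiv (fun V => 1%:M *m V *m (M *m W X *m M^T)
     - X *m M *m W X *m M^T *m V^T *m (X *m M *m W X *m M^T)
     - X *m M *m W X *m (X *m M)^T *m V *m (M *m W X *m M^T)) =
  N%:R * t X - dotm (X *m M *m W X *m M^T) (X *m M *m W X *m M^T) - h X * t X.
Proof.
by rewrite !mdivB !mdiv_sandwich mdiv_sandwich_tr mxtrace1 tr_MWM tr_CWC.
Qed.

Lemma mddir_rhoz X V :
  mddir (fun X => rho X *m (M *m z X)^T) X V
    (1%:M *m V *m (v X *m (M *m z X)^T)
     - X *m M *m W X *m M^T *m V^T *m (rho X *m (M *m z X)^T)
     - X *m M *m W X *m (X *m M)^T *m V *m (v X *m (M *m z X)^T)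
     + (rho X *m (rho X)^T *m V *m (M *m W X *m M^T)
        + rho X *m (v X)^T *m V^T *m (X *m M *m W X *m M^T))).
Proof.
have dz := mddir_z X V.
have dv : mddir v X V (- (M *m (W X *m (M^T *m V^T *m rho X + (X *m M)^T *m V *m v X)))).
  apply: mddir_eq; first by apply: mddirB; [exact: mddir_cst|apply: mddir_mull dz].
  by rewrite sub0r.
apply: mddir_eq.
  apply: mddirM; last by apply: mddir_tr; apply: mddir_mull dz.
  by apply: mddirM; [exact: mddir_id|exact: dv].
move=> {dz dv}; move: (M *m z X) (v X) => u w.
have trD (A B : 'cV[R]_k) : (A + B)^T = A^T + B^T by rewrite linearD.
congr (_ + _).
  by rewrite mul1mx mulmxDl mulmxN mulNmx !mulmxDr mulmxDl !mulmxA opprD addrA.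
by rewrite !trmx_mul trD mulmxDl mulmxDl mulmxDr !trmx_mul !trmxK ridge_inv_sym !mulmxA.
Qed.

Lemma dot_Mz_r X : dotm (M *m z X) r = lam * dotm (z X) x.
Proof. by rewrite dotm_mull hr dotmZr. Qed.

Lemma dot_Mz_v X :
  dotm (M *m z X) (v X) = lam * dotm (z X) x - dotm (M *m z X) (M *m z X).
Proof. by rewrite /v dotmBr dot_Mz_r. Qed.

(** Moving X, and v through its dependence on X, yields the factor N - h on <M z, v>. The terms with
    a transposed V contain (X M)^T rho, which [kkt] replaces by lam y. *)
Lemma mdiv_rhoz X :
  mdiv (fun V => 1%:M *m V *m (v X *m (M *m z X)^T)
     - X *m M *m W X *m M^T *m V^T *m (rho X *m (M *m z X)^T)
     - X *m M *m W X *m (X *m M)^T *m V *m (v X *m (M *m z X)^T)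
     + (rho X *m (rho X)^T *m V *m (M *m W X *m M^T)
        + rho X *m (v X)^T *m V^T *m (X *m M *m W X *m M^T))) =
  (N%:R - h X) * (lam * dotm (z X) x - dotm (M *m z X) (M *m z X))
  - 2 * lam * dotm (M *m z X) (M *m W X *m y X)
  + dotm (rho X) (rho X) * t X + lam ^+ 2 * dotm (y X) (W X *m x).
Proof.
rewrite !(mdivD, mdivN) !mdiv_sandwich !mdiv_sandwich_tr mxtrace1 tr_MWM tr_CWC.
rewrite !mxtrace_outer (dotm_outer _ (rho X)) dot_Mz_v.
have e1 : dotm (X *m M *m W X *m M^T *m (M *m z X)) (rho X) =
    lam * dotm (M *m z X) (M *m W X *m y X).
  rewrite -!mulmxA mulmxA dotm_mull kkt dotmZr; congr (_ * _).
  by rewrite dotm_mull ridge_inv_sym dotm_mull trmxK mulmxA.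
have e2 : dotm (rho X *m (v X)^T) (X *m M *m W X *m M^T) =
    lam ^+ 2 * dotm (y X) (W X *m x) - lam * dotm (M *m z X) (M *m W X *m y X).
  rewrite dotmC dotm_outer -!mulmxA mulmxA dotm_mull kkt dotmZr.
  rewrite /v mulmxBr hr mulmxBr dotmBl -scalemxAr dotmZl (dotmC (W X *m x)).
  have -> : dotm (W X *m (M^T *m (M *m z X))) (y X) = dotm (M *m z X) (M *m W X *m y X).
    by rewrite dotm_mull ridge_inv_sym dotm_mull trmxK mulmxA.
  rewrite (mulmxA M (W X)); ring.
rewrite e1 e2; ring.
Qed.

Lemma dotm_X_rhoz X : dotm X (rho X *m (M *m z X)^T) = lam * dotm (z X) (y X).
Proof. by rewrite dotm_outer mulmxA dotm_mull kkt dotmZr. Qed.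

(** The sketched cost of x, the unsketched optimum. *)
Definition risk0 X : R := dotm (X *m r) (X *m r) + lam * dotm x x.
Local Notation f0 := risk0.

(** Optimality of y for the sketched cost, tested against x: by the normal equations the two sides
    differ by |X M z|^2 + lam |z|^2. *)
Lemma sketched_risk_le X : dotm (rho X) (rho X) + lam * dotm (y X) (y X) <= f0 X.
Proof.
have e : X *m r = rho X + X *m M *m z X by rewrite /v mulmxBr mulmxA subrK.
have kk : dotm (X *m M *m z X) (rho X) = lam * dotm (z X) (y X).
  by rewrite dotm_mull kkt dotmZr.
have sq p (u w : 'cV[R]_p) : dotm (u + w) (u + w) = dotm u u + 2 * dotm w u + dotm w w.
  by rewrite dotmDl !dotmDr (dotmC u w); ring.
have hx : dotm x x = dotm (y X) (y X) - 2 * dotm (z X) (y X) + dotm (z X) (z X).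
  by rewrite sq dotmDr; ring.
have hs := sq _ (rho X) (X *m M *m z X); rewrite kk -e in hs.
rewrite /f0 hs hx.
have := dotm_ge0 (X *m M *m z X); have := mulr_ge0 (ltW l0) (dotm_ge0 (z X)); lra.
Qed.

Lemma t_ge0 X : 0 <= t X.
Proof. exact: dotm_ridge_inv_ge0. Qed.

Lemma f0_ge0 X : 0 <= f0 X.
Proof. by rewrite addr_ge0 ?dotm_ge0// mulr_ge0 ?dotm_ge0// ltW. Qed.

Lemma dotm_MWy_le X (w : 'cV[R]_k) :
  lam * dotm (M *m W X *m w) (M *m W X *m w) <= t X * dotm w w.
Proof.
have h1 := dotm_BW_le (X *m M) l0 M w.
have h2 := dotm_ridge_inv_le (X *m M) l0 w.
have := ler_wpM2l (ltW l0) h1; have := ler_wpM2l (t_ge0 X) h2; rewrite /t; lra.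
Qed.

Lemma lam_dotm_yWx_le X (w : 'cV[R]_k) :
  2 * (lam ^+ 2 * dotm w (W X *m x)) <= lam * dotm w w + lam * dotm x x.
Proof.
have h1 := dotm_young w (lam *: (W X *m x)) ltr01.
rewrite invr1 !mul1r !dotmZl !dotmZr in h1.
have h2 := ler_wpM2l (ltW l0) (dotm_W_le (X *m M) l0 x).
have h3 := dotm_ridge_inv_le (X *m M) l0 x.
have := ler_wpM2l (ltW l0) (le_trans (le_trans _ h2) h3) => h4.
have := ler_wpM2l (ltW l0) h1; have := ler_wpM2l (ltW l0) (le_trans h2 h3).
rewrite expr2; lra.
Qed.

(** Since M^T r = lam x, the square of the left side is at most t^2 times 4 (lam |x|^2) |X r|^2, and
    4 u v <= (u + v)^2. It controls the derivative of t along the field X r r^T. *)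
Lemma grad_t_r_le X : dotm (grad_t X) (X *m r *m r^T) <= t X * f0 X.
Proof.
rewrite dotm_outer /grad_t -scalemxAl dotmZl -(mulmxA _ M^T r) hr -scalemxAr dotmZl.
pose p := M *m W X *m x; pose U := M^T *m p.
have -> : X *m M *m W X *m M^T *m M *m W X *m x = X *m M *m W X *m U.
  by rewrite /U /p !mulmxA.
have h1 := dotm_CW_le (X *m M) l0 U.
have h2 := dotm_BWB_le (X *m M) l0 M^T p.
have h3 := dotm_MWy_le X x; rewrite -/p in h3.
have t0 := t_ge0 X.
have xx0 := dotm_ge0 x; have rr0 := dotm_ge0 (X *m r).
have h4 : lam * dotm (X *m M *m W X *m U) (X *m M *m W X *m U) <= t X ^+ 2 * dotm x x.
  have := ler_wpM2l t0 h3; have := ler_wpM2l (ltW l0) (le_trans h1 h2).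
  rewrite -/(t X) expr2; lra.
apply: le_of_sqr_le; first by rewrite mulr_ge0 ?f0_ge0.
have h5 := dotm_cs (X *m M *m W X *m U) (X *m r).
set c := dotm _ (X *m r) in h5 *.
set d := dotm (X *m M *m W X *m U) _ in h4 h5.
rewrite /f0; set e := dotm (X *m r) _ in rr0 h5 *; set g := dotm x x in xx0 h4 *.
have -> : (-2 * (lam * c)) ^+ 2 = 4 * lam * (lam * c ^+ 2) by ring.
have h6 : lam * c ^+ 2 <= t X ^+ 2 * g * e.
  have := ler_wpM2l (ltW l0) h5; have := ler_wpM2r rr0 h4; lra.
apply: (@le_trans _ _ (4 * lam * (t X ^+ 2 * g * e))).
  by rewrite ler_wpM2l// mulr_ge0// ltW.
rewrite exprMn.
have -> : 4 * lam * (t X ^+ 2 * g * e) = t X ^+ 2 * (4 * (lam * g) * e) by ring.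
rewrite ler_wpM2l ?sqr_ge0//.
by have := sqr_ge0 (e - lam * g); lra.
Qed.

End sketched_ridge.

(** * Expected excess risk *)

Lemma dotm_delta (R : realDomainType) p q (A : 'M[R]_(p, q)) i j :
  dotm A (delta_mx i j) = A i j.
Proof.
rewrite dotmE (bigD1 i)//= [X in _ + X]big1 ?addr0; last first.
  by move=> k ki; rewrite big1// => l _; rewrite mxE (negbTE ki) mulr0.
rewrite (bigD1 j)//= big1 ?addr0; last first.
  by move=> l lj; rewrite mxE (negbTE lj) andbF mulr0.
by rewrite mxE !eqxx mulr1.
Qed.

Lemma hgrad_tame (R : realType) N n (phi : 'M[R]_(N, n) -> R) G :
  tame phi -> hgrad phi G -> mtame G.
Proof.
move=> tp hG i j.
have : tame (fun X => dotm (G X) (delta_mx i j)).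
  by apply: (ddir_tame tp) => X; exact: hG.
by apply: eq_tame => X; rewrite dotm_delta.
Qed.

(** * Bounding the excess by weighted integration by parts *)

Section expected_excess.
Variables (R : realType) (N n k m : nat) (lam : R) (M : 'M[R]_(n, k)).
Variables (r : 'cV[R]_n) (x : 'cV[R]_k) (Pi : 'M[R]_k).
Variable E : ('M[R]_(N, n) -> R) -> R.
Hypothesis hE : gaussian_mean E.
Hypothesis l0 : 0 < lam.
Hypothesis hr : M^T *m r = lam *: x.
Hypothesis sPi : Pi^T = Pi.
Hypothesis PiPi : Pi *m Pi = Pi.
Hypothesis PiA : Pi *m (M^T *m M) = M^T *m M *m Pi.
Hypothesis rkM1 : (\rank (M *m (1%:M - Pi)) <= m)%N.
Local Notation MX := 'M[R]_(N, n).
Local Notation M2 := (M *m Pi).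
Local Notation W X := (ridge_inv lam (X *m M)).
Local Notation z := (ridge_err lam M r).
Local Notation v := (resid lam M r).
Local Notation y X := (x + z X).
Local Notation rho X := (X *m v X).
Local Notation t := (tr_inv lam M).
Local Notation h := (tr_hat lam M).
Local Notation f0 := (@risk0 R N n k lam r x).
Local Notation Nr := (N%:R : R).
Local Notation mr := (m%:R : R).
Implicit Types X V : MX.

(** The mean of [small_mass]. *)
Let a : R := dotm M2 M2 / lam.
Hypothesis HN : 16 * (mr + a + 1) <= Nr.

Let a0 : 0 <= a. Proof. by rewrite divr_ge0 ?dotm_ge0// ltW. Qed.
Let m0 : 0 <= mr. Proof. exact: ler0n. Qed.
Let N16 : 16 <= Nr. Proof. have := a0; have := m0; have := HN; lra. Qed.
Let N0 : 0 < Nr. Proof. have := N16; lra. Qed.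
Let Nn0 : Nr != 0. Proof. by rewrite gt_eqF. Qed.
Let lan0 : lam != 0. Proof. by rewrite gt_eqF. Qed.
Let M2M2 : dotm M2 M2 = lam * a. Proof. by rewrite /a; field. Qed.

Let M2T : M2^T = Pi *m M^T. Proof. by rewrite trmx_mul sPi. Qed.
Let PiM2 : Pi *m M2^T = M2^T. Proof. by rewrite M2T mulmxA PiPi. Qed.
Let M2Pi : M2 *m Pi = M2. Proof. by rewrite -mulmxA PiPi. Qed.
Let MtM2 : M^T *m M2 = M2^T *m M2.
Proof.
have e : Pi *m M^T *m M2 = Pi *m (M^T *m M) *m Pi by rewrite !mulmxA.
by rewrite M2T e PiA -(mulmxA _ Pi Pi) PiPi mulmxA.
Qed.
Let M2r : M2^T *m r = lam *: (Pi *m x).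
Proof. by rewrite M2T -mulmxA hr -scalemxAr. Qed.

Definition small_mass X : R := lam^-1 * dotm (X *m M2) (X *m M2).
Local Notation T := small_mass.
Definition psi X : R := 1 + Nr^-1 * T X.

Let tame_T : tame T.
Proof. by apply: tameZ; apply: tame_dotm; exact: mtame_lin. Qed.
Let tame_psi : tame psi.
Proof. by apply: tameD; [exact: tame_cst|apply: tameZ; exact: tame_T]. Qed.
Let tame_tt : tame t := tame_t N M l0.
Let tame_hh : tame h := tame_h N M l0.
Let tame_f0 : tame f0.
Proof.
apply: tameD; last exact: tame_cst.
by apply: tame_dotm; exact: mtame_lin.
Qed.

Let T_ge0 X : 0 <= T X. Proof. by rewrite mulr_ge0 ?dotm_ge0// invr_ge0 ltW. Qed.
Let t0 X : 0 <= t X. Proof. exact: t_ge0. Qed.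
Let f00 X : 0 <= f0 X. Proof. exact: f0_ge0. Qed.
Let psi1 X : 1 <= psi X.
Proof. by rewrite lerDl mulr_ge0// invr_ge0 ltW. Qed.
Let psi0 X : 0 <= psi X. Proof. exact: le_trans ler01 (psi1 X). Qed.
Let lamT X : dotm (X *m M2) (X *m M2) = lam * T X.
Proof. by rewrite /T mulrA mulfV// mul1r. Qed.
Let Npsi X : Nr * psi X = Nr + T X.
Proof. by rewrite /psi mulrDr mulr1 mulrA mulfV// mul1r. Qed.

Let gT X : MX := (2 / lam) *: (X *m (M2 *m M2^T)).

Let hgrad_T : hgrad T gT.
Proof.
move=> X V.
have h1 := ddir_dotm (mddir_lin M2 X V) (mddir_lin M2 X V).
have := ddirM (ddir_cst lam^-1 X V) h1.
rewrite mul0r add0r (dotmC (V *m M2)) /gT dotmZl => h2.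
have -> : 2 / lam * dotm (X *m (M2 *m M2^T)) V =
   lam^-1 * (dotm (X *m M2) (V *m M2) + dotm (X *m M2) (V *m M2)).
  rewrite mulmxA dotm_mulr trmxK; ring.
exact: h2.
Qed.

Let hgrad_psi : hgrad psi (fun X => Nr^-1 *: gT X).
Proof.
move=> X V; have := hgradD (@hgrad_cst R N n 1) (hgradZ Nr^-1 hgrad_T) X V.
by rewrite add0r.
Qed.

(* Lower bounds on N - h via the projector onto the complement of the range of
   X (M - M2), which has rank at most m. *)
Let trace_bound X (beta : R) : 0 <= beta -> beta <= 1 ->
  (2 * beta - beta ^+ 2) * (Nr - mr) - beta ^+ 2 * T X <= Nr - h X.
Proof.
move=> b0 b1.
have [P [sP PP PC trP]] := orthogonal_projector (X *m (M *m (1%:M - Pi))).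
have rk : (\rank (X *m (M *m (1%:M - Pi))) <= m)%N.
  exact: leq_trans (mxrankM_maxr _ _) rkM1.
have PXM : P *m (X *m M) = P *m (X *m M2).
  have e : X *m M = X *m M2 + X *m (M *m (1%:M - Pi)).
    by rewrite !mulmxBr mulmx1 addrC subrK.
  by rewrite {1}e (mulmxDr P) PC addr0.
have := trace_residual_ge (X *m M) l0 beta sP PP.
apply: le_trans; rewrite PXM.
have hD := dotm_projector_le (X *m M2) sP PP.
rewrite lamT in hD.
have {}hD : dotm (P *m (X *m M2)) (P *m (X *m M2)) / lam <= T X.
  by rewrite ler_pdivrMr// mulrC.
have tm : Nr - mr <= \tr P by rewrite trP lerD2l lerN2 ler_nat.
have b2 : 0 <= 2 * beta - beta ^+ 2.
  by rewrite expr2; nra.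
have h1 := ler_wpM2l (sqr_ge0 beta) hD.
have h2 := ler_wpM2l b2 tm.
lra.
Qed.

Let h_ge0 X : 0 <= h X. Proof. exact: dotm_ridge_inv_ge0. Qed.

Let h_leN X : h X <= Nr.
Proof. by have := trace_bound X (lexx 0) ler01; rewrite expr0n /=; lra. Qed.

Let h_le X : h X <= mr + T X.
Proof. by have := trace_bound X ler01 (lexx 1); rewrite expr1n; lra. Qed.

(** Take beta = 1 / psi in [trace_bound], its maximiser up to terms in m. Because N + T = N psi,
    multiplying by psi leaves N - 2 m + m / psi. *)
Let psi_Nh X : Nr - 2 * mr <= psi X * (Nr - h X).
Proof.
have p0 : 0 < psi X := lt_le_trans ltr01 (psi1 X).
have pn : psi X != 0 by rewrite gt_eqF.
have b1 : (psi X)^-1 <= 1 by rewrite invf_le1.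
have b0 : 0 <= (psi X)^-1 by rewrite invr_ge0.
have := ler_wpM2l (psi0 X) (trace_bound X b0 b1).
apply: le_trans.
have -> : psi X * ((2 / psi X - (psi X)^-1 ^+ 2) * (Nr - mr) - (psi X)^-1 ^+ 2 * T X) =
  (2 * (Nr - mr) - (psi X)^-1 * (Nr + T X)) + (psi X)^-1 * mr by field.
rewrite -Npsi mulrCA mulVf// mulr1.
by have := mulr_ge0 b0 m0; lra.
Qed.

(* phi grows at most at relative rate c lam a along the field X M2 M2^T, whose
   divergence against X is N lam a. *)
Let slow (c : R) (phi : MX -> R) :=
  [/\ tame phi, forall X, 0 <= phi X & exists2 G, hgrad phi G &
    forall X, dotm (G X) (X *m (M2 *m M2^T)) <= c * (lam * a) * phi X].

Let slow1 : slow 0 (fun=> 1).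
Proof.
split=> //; first exact: tame_cst.
by exists (fun=> 0); [exact: hgrad_cst|move=> X; rewrite dotm0l mul0r mul0r].
Qed.

(** Rates add under products, and T alone has rate 2. *)
Let slowT c phi : 0 <= c -> slow c phi -> slow (c + 2) (fun X => T X * phi X).
Proof.
move=> c0 [tp p0 [G hG Gle]]; split.
- exact: tameM.
- by move=> X; exact: mulr_ge0.
exists (fun X => phi X *: gT X + T X *: G X); first exact: hgradM.
move=> X; rewrite dotmDl !dotmZl.
have h1 : dotm (X *m (M2 *m M2^T)) (X *m (M2 *m M2^T)) <= lam * T X * (lam * a).
  rewrite mulmxA (le_trans (dotm_mul_le _ _))// lamT dotm_tr M2M2//.
have h2 : 2 / lam * dotm (X *m (M2 *m M2^T)) (X *m (M2 *m M2^T)) <= 2 * (lam * a) * T X.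
  have l2 : 0 <= 2 / lam by rewrite divr_ge0// ltW.
  rewrite (le_trans (ler_wpM2l l2 h1))// le_eqVlt; apply/orP; left; apply/eqP; by field.
have := ler_wpM2l (p0 X) h2; have := ler_wpM2l (T_ge0 X) (Gle X); lra.
Qed.

(** Of the two terms in [e1], the first has a favourable sign after multiplication by -2 and is
    dropped; the second, which stems from lam W in [gram_ridge_inv], is at most lam a t. *)
Let slow_t : slow 2 t.
Proof.
split => //; exists (grad_t lam M); first exact: hgrad_t.
move=> X; rewrite /grad_t dotmZl mulmxA.
set A := M2^T *m M2.
have e1 : dotm (X *m M *m W X *m M^T *m M *m W X *m M^T) (X *m M2 *m M2^T) =
    dotm A (W X *m A) - lam * dotm (M *m W X *m M2^T) (M *m W X *m M2^T).
  have -> : dotm (X *m M *m W X *m M^T *m M *m W X *m M^T) (X *m M2 *m M2^T) =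
      dotm Pi ((X *m M)^T *m (X *m M) *m W X *m (M^T *m M *m W X *m A)).
    rewrite dotm_outer -(mulmxA _ M^T M2) MtM2 -/A dotmC (mulmxA X M Pi) dotm_mull.
    by rewrite !mulmxA.
  rewrite gram_ridge_inv// mulmxBl mul1mx -scalemxAl dotmBr dotmZr; congr (_ - _ * _).
    rewrite -(mulmxA (M^T *m M)).
    have -> : M^T *m M *m (W X *m A) = (M^T *m M)^T *m (W X *m A).
      by rewrite trmx_mul trmxK.
    by rewrite -dotm_mull -(mulmxA M^T M Pi) MtM2.
  have -> : W X *m (M^T *m M *m W X *m A) =
      (W X)^T *m (M^T *m (M *m W X *m M2^T)) *m (M2^T)^T.
    by rewrite ridge_inv_sym trmxK /A !mulmxA.
  by rewrite dotm_outer PiM2 -dotm_mull -dotm_mull mulmxA.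
have p1 : 0 <= dotm A (W X *m A) by exact: dotm_ridge_inv_ge0.
have p2 : dotm (M *m W X *m M2^T) (M *m W X *m M2^T) <= t X * a.
  have h1 := dotm_BW_le (X *m M) l0 M M2^T.
  have h2 := dotm_ridge_inv_le (X *m M) l0 M2^T.
  rewrite dotm_tr M2M2 ler_pM2l// in h2.
  exact: le_trans h1 (ler_wpM2l (t0 X) h2).
rewrite e1; have := ler_wpM2l (ltW l0) p2; lra.
Qed.

(** Integration by parts against X M2 M2^T yields the factor (1 + c / N) a, and c <= N makes it 2
    a. *)
Let Ex_T_step c phi : c <= Nr -> slow c phi ->
  E (fun X => T X * phi X) <= 2 * a * E phi.
Proof.
move=> cN [tp p0 [G hG Gle]].
pose K := M2 *m M2^T.
have tG : mtame G := hgrad_tame tp hG.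
have tK : mtame (fun X => X *m K) by exact: mtame_lin.
have h1 X V : mddir (fun X => X *m K) X V (1%:M *m V *m K).
  by rewrite mul1mx; exact: mddir_lin.
have h2 X : mdiv (fun V => 1%:M *m V *m K) = (fun=> Nr * (lam * a)) X.
  by rewrite mdiv_sandwich mxtrace1 mxtrace_mulC -M2M2.
have tTp : tame (fun X => T X * phi X) by exact: tameM.
have e := gm_div_scaled hE tp hG tK h1 h2.
clear h1 h2.
have eL : (fun X => phi X * dotm X (X *m K)) = (fun X => lam * (T X * phi X)).
  apply/funext => X; rewrite /K mulmxA.
  have -> : dotm X (X *m M2 *m M2^T) = dotm (X *m M2) (X *m M2) by rewrite dotm_mulr.
  by rewrite lamT; ring.
rewrite eL (gmZ hE)// in e.
have tdG : tame (fun X => dotm (G X) (X *m K)) by exact: tame_dotm.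
have hle : E (fun X => phi X * (Nr * (lam * a)) + dotm (G X) (X *m K)) <=
    E (fun X => ((Nr + c) * (lam * a)) * phi X).
  apply: (gm_le hE).
  - by apply: tameD => //; apply: tameM => //; exact: tame_cst.
  - exact: tameZ.
  - by move=> X; have := Gle X; rewrite -/K; lra.
rewrite (gmZ hE)// in hle.
have Ep0 : 0 <= E phi := gm_ge0 hE tp p0.
have : Nr * (lam * E (fun X => T X * phi X)) <= ((Nr + c) * (lam * a)) * E phi.
  by rewrite e mulVKf.
have : (Nr + c) * (lam * a * E phi) <= (Nr + Nr) * (lam * a * E phi).
  have q : 0 <= lam * a * E phi by rewrite mulr_ge0// mulr_ge0// ltW.
  by apply: ler_wpM2r => //; rewrite lerD2l.
move=> i1 i2; rewrite -(ler_pM2l N0) -(ler_pM2l l0); lra.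
Qed.

(** The trailing 1 matches what [slowT] produces from the constant function. *)
Let T1 X := T X * 1.
Let T2 X := T X * T1 X.
Let T3 X := T X * T2 X.
Let tT1 : tame T1. Proof. by apply: tameM => //; exact: tame_cst. Qed.
Let tT2 : tame T2. Proof. exact: tameM. Qed.
Let tT3 : tame T3. Proof. exact: tameM. Qed.

Let s1 : slow (0 + 2) T1 := slowT (lexx 0) slow1.
Let s2 : slow (0 + 2 + 2) T2.
Proof. by apply: slowT => //; rewrite add0r. Qed.

Let ET1 : E T1 <= 2 * a.
Proof.
by have := @Ex_T_step 0 (fun=> 1) (ltW N0) slow1; rewrite (gm_cst hE) mulr1.
Qed.
Let ET2 : E T2 <= 2 * a * E T1.
Proof. by apply: Ex_T_step s1; have := N16; lra. Qed.
Let ET3 : E T3 <= 2 * a * E T2.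
Proof. by apply: Ex_T_step s2; have := N16; lra. Qed.

Let tTt : tame (fun X => T X * t X). Proof. exact: tameM. Qed.
Let tTTt : tame (fun X => T X * (T X * t X)). Proof. exact: tameM. Qed.
Let ETt : E (fun X => T X * t X) <= 2 * a * E t.
Proof. by apply: Ex_T_step slow_t; have := N16; lra. Qed.
Let ETTt : E (fun X => T X * (T X * t X)) <= 2 * a * E (fun X => T X * t X).
Proof.
by apply: (@Ex_T_step (2 + 2)); [have := N16; lra|exact: slowT slow_t].
Qed.

Let E_lin (f g1 g2 g3 : MX -> R) c0 c1 c2 c3 : tame g1 -> tame g2 -> tame g3 ->
  (forall X, f X = c0 + c1 * g1 X + c2 * g2 X + c3 * g3 X) ->
  E f = c0 + c1 * E g1 + c2 * E g2 + c3 * E g3.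
Proof.
move=> t1 t2 t3 /funext ->.
have u1 : tame (fun X => c1 * g1 X) by exact: tameZ.
have u2 : tame (fun X => c2 * g2 X) by exact: tameZ.
have u3 : tame (fun X => c3 * g3 X) by exact: tameZ.
have u0 : tame (fun _ : MX => c0) by exact: tame_cst.
have u01 : tame (fun X => c0 + c1 * g1 X) by exact: tameD.
have u012 : tame (fun X => c0 + c1 * g1 X + c2 * g2 X) by exact: tameD.
by rewrite (gmD hE u012 u3) (gmD hE u01 u2) (gmD hE u0 u1) (gm_cst hE) !(gmZ hE).
Qed.

Let ns : R := Nr^-1.
Let ns0 : 0 < ns. Proof. by rewrite invr_gt0. Qed.
Let nsa : ns * a <= 1 / 16.
Proof. by rewrite -(ler_pM2l N0) /ns mulrA mulfV// mul1r; have := HN; have := m0; lra. Qed.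
Let nsm : ns * mr <= 1 / 16.
Proof. by rewrite -(ler_pM2l N0) /ns mulrA mulfV// mul1r; have := HN; have := a0; lra. Qed.
Let ns16 : ns <= 1 / 16.
Proof. by rewrite -(ler_pM2l N0) /ns mulfV//; have := N16; lra. Qed.
Let psiE X : psi X = 1 + ns * T X. Proof. by []. Qed.

Let ET1_ge0 : 0 <= E T1. Proof. by apply: (gm_ge0 hE) => // X; rewrite mulr_ge0. Qed.
Let ET2_ge0 : 0 <= E T2.
Proof. by apply: (gm_ge0 hE) => // X; rewrite mulr_ge0// mulr_ge0. Qed.
Let Et_ge0 : 0 <= E t. Proof. exact: (gm_ge0 hE). Qed.
Let ETt_ge0 : 0 <= E (fun X => T X * t X).
Proof. by apply: (gm_ge0 hE) => // X; rewrite mulr_ge0. Qed.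

(* As ns a and ns m are at most 1/16, each factor ns T costs at most 1/8 in
   expectation. *)
Let nT2 : ns * E T2 <= 1 / 8 * E T1.
Proof.
have := ler_wpM2l (ltW ns0) ET2; have := ler_wpM2r ET1_ge0 nsa; lra.
Qed.
Let nT3 : ns * E T3 <= 1 / 8 * E T2.
Proof.
have := ler_wpM2l (ltW ns0) ET3; have := ler_wpM2r ET2_ge0 nsa; lra.
Qed.
Let nTt : ns * E (fun X => T X * t X) <= 1 / 8 * E t.
Proof.
have := ler_wpM2l (ltW ns0) ETt; have := ler_wpM2r Et_ge0 nsa; lra.
Qed.
Let nTTt : ns * E (fun X => T X * (T X * t X)) <= 1 / 8 * E (fun X => T X * t X).
Proof.
have := ler_wpM2l (ltW ns0) ETTt; have := ler_wpM2r ETt_ge0 nsa; lra.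
Qed.

Let Epsit : E (fun X => psi X * t X) <= 2 * E t.
Proof.
rewrite (@E_lin _ t (fun X => T X * t X) T1 0 1 ns 0)//; last first.
  by move=> X; rewrite psiE; ring.
have := nTt; have := Et_ge0; lra.
Qed.

Let Epsi2t : E (fun X => psi X * psi X * t X) <= 2 * E t.
Proof.
rewrite (@E_lin _ t (fun X => T X * t X) (fun X => T X * (T X * t X)) 0 1 (2 * ns) (ns * ns))//; last first.
  by move=> X; rewrite psiE; ring.
have h1 := ler_wpM2l (ltW ns0) nTTt; have := nTt; have := Et_ge0; lra.
Qed.

Let Epsi : E psi <= 9 / 8.
Proof.
rewrite (@E_lin _ T1 T1 T1 1 ns 0 0)//; last by move=> X; rewrite psiE /T1; ring.
have := ler_wpM2l (ltW ns0) ET1; have := nsa; lra.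
Qed.

Let tame_mT : tame (fun X => mr + T X).
Proof. by apply: tameD => //; exact: tame_cst. Qed.

Let Epsih : E (fun X => psi X * h X) <= mr + 3 * a.
Proof.
apply: (@le_trans _ _ (E (fun X => psi X * (mr + T X)))).
  by apply: (gm_le hE) => [||X]; [exact: tameM..|rewrite ler_wpM2l].
rewrite (@E_lin _ T1 T2 T1 mr (1 + ns * mr) ns 0)//; last first.
  by move=> X; rewrite psiE /T2 /T1; ring.
have := nT2; have := ET1; have := ler_wpM2r ET1_ge0 nsm; have := a0; lra.
Qed.

Let Epsi2mT : E (fun X => psi X * psi X * (mr + T X)) <= mr + 3 * a.
Proof.
rewrite (@E_lin _ T1 T2 T3 mr (1 + 2 * (ns * mr)) (2 * ns + ns * mr * ns) (ns * ns))//; last first.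
  by move=> X; rewrite psiE /T3 /T2 /T1; ring.
have := ler_wpM2l (ltW ns0) nT3; have := nT2; have := ET1.
have nm0 : 0 <= ns * mr by rewrite mulr_ge0// ltW.
have := ler_wpM2l nm0 nT2; have := ler_wpM2r ET1_ge0 nsm; have := a0; lra.
Qed.

Let mtame_gT : mtame gT.
Proof. by apply: mtame_scale; [exact: tame_cst|exact: mtame_lin]. Qed.

Let mtame_gpsi : mtame (fun X => Nr^-1 *: gT X).
Proof. by apply: mtame_scale => //; exact: tame_cst. Qed.

(** Up to nonnegative factors this is |M2|^2 - lam <M2^T, W M2^T>, and lam W <= 1. The sign allows
    the derivative of psi to be dropped when bounding the mean of t. *)
Let gpsi_CWM_ge0 X : 0 <= dotm (Nr^-1 *: gT X) (X *m M *m W X *m M^T).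
Proof.
rewrite /gT !dotmZl mulr_ge0 ?(ltW ns0)// mulr_ge0 ?divr_ge0 ?(ltW l0)//.
have -> : dotm (X *m (M2 *m M2^T)) (X *m M *m W X *m M^T) =
    dotm M2 M2 - lam * dotm M2^T (W X *m M2^T).
  set A := M2^T *m M2.
  have -> : dotm (X *m (M2 *m M2^T)) (X *m M *m W X *m M^T) =
      dotm Pi ((X *m M)^T *m (X *m M) *m W X *m A).
    rewrite mulmxA dotmC dotm_outer -(mulmxA _ M^T M2) MtM2 -/A dotmC (mulmxA X M Pi) dotm_mull.
    by rewrite !mulmxA.
  rewrite gram_ridge_inv// mulmxBl mul1mx -scalemxAl dotmBr dotmZr; congr (_ - _ * _).
    by rewrite /A -dotm_mull M2Pi.
  have -> : W X *m A = W X *m M2^T *m (M2^T)^T by rewrite trmxK /A mulmxA.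
  by rewrite dotm_outer PiM2.
rewrite subr_ge0; have := dotm_ridge_inv_le (X *m M) l0 M2^T.
by rewrite dotm_tr.
Qed.

Let hE_CWM X : dotm X (X *m M *m W X *m M^T) = h X.
Proof.
have -> : dotm X (X *m M *m W X *m M^T) = dotm (X *m M) (X *m M *m W X) by rewrite dotm_mulr.
by rewrite /tr_hat -(dotm_tr (X *m M) (X *m M *m W X)) (trmx_mul (X *m M) (W X)) ridge_inv_sym.
Qed.

(** Integration by parts against psi X M W M^T: with [psi_Nh], N E (psi h) is at least (N - 2 m) E t
    - E (psi t), hence at least N E t / 2, while E (psi h) is at most m + 3 a. *)
Let Et : E t <= 2 * (mr + 3 * a).
Proof.
have e := gm_div_scaled hE tame_psi hgrad_psi (mtame_CWM M l0) (mddir_CWM M l0) (mdiv_CWM lam M).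
have eL : (fun X => psi X * dotm X (X *m M *m W X *m M^T)) = (fun X => psi X * h X).
  by apply/funext => X; rewrite hE_CWM.
rewrite eL in e.
have tJ : tame (fun X => dotm (X *m M *m W X *m M^T) (X *m M *m W X *m M^T)).
  by apply: tame_dotm; exact: mtame_CWM.
have tht : tame (fun X => h X * t X) by exact: tameM.
have tpt : tame (fun X => psi X * t X) by exact: tameM.
have tg : tame (fun X => dotm (Nr^-1 *: gT X) (X *m M *m W X *m M^T)).
  by apply: tame_dotm => //; exact: mtame_CWM.
have hle : E (fun X => (Nr - 2 * mr) * t X - psi X * t X) <=
   E (fun X => psi X * (Nr * t X - dotm (X *m M *m W X *m M^T) (X *m M *m W X *m M^T) - h X * t X)
     + dotm (Nr^-1 *: gT X) (X *m M *m W X *m M^T)).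
  apply: (gm_le hE).
  - by apply: tameB => //; exact: tameZ.
  - apply: tameD => //; apply: tameM => //; apply: tameB => //; apply: tameB => //.
    exact: tameZ.
  - move=> X; have h1 := gpsi_CWM_ge0 X.
    have h2 := ler_wpM2r (t0 X) (psi_Nh X).
    have h3 := dotm_CW_le (X *m M) l0 M^T.
    have h4 := ler_wpM2l (psi0 X) h3; rewrite -/(t X) in h4; lra.
rewrite (gmB hE)// ?(gmZ hE)// in hle; last exact: tameZ.
have hNE : Nr * E (fun X => psi X * h X) = E (fun X => psi X * (Nr * t X - dotm (X *m M *m W X *m M^T) (X *m M *m W X *m M^T) - h X * t X)
     + dotm (Nr^-1 *: gT X) (X *m M *m W X *m M^T)).
  by rewrite e mulVKf.
rewrite -hNE in hle.
have h5 := ler_wpM2l (ltW N0) Epsih.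
have h6 : Nr * E t / 2 <= (Nr - 2 * mr - 2) * E t.
  have : 0 <= (Nr / 2 - 2 * mr - 2) * E t.
    by rewrite mulr_ge0//; have := HN; have := a0; have := m0; lra.
  lra.
have h7 : Nr * E t / 2 <= Nr * (mr + 3 * a) by have := Epsit; lra.
rewrite -(ler_pM2l N0); lra.
Qed.

(** The optimal cost of the unsketched problem. *)
Let Delta := dotm r r + lam * dotm x x.
Let Delta_ge0 : 0 <= Delta.
Proof. by rewrite addr_ge0 ?dotm_ge0// mulr_ge0 ?dotm_ge0// ltW. Qed.

(** Integration by parts against X r r^T replaces |X r|^2 by |r|^2; the gradient of the weight costs
    a relative c / N, small enough to be absorbed on the left. *)
Let Ex_f0_step c phi G : tame phi -> hgrad phi G ->
  (forall X, dotm (G X) (X *m r *m r^T) <= c * (phi X * f0 X)) ->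
  E (fun X => phi X * f0 X) <= Delta * E phi + ns * c * E (fun X => phi X * f0 X).
Proof.
move=> tp hG Gle.
have tG := hgrad_tame tp hG.
pose K := r *m r^T.
have tK : mtame (fun X => X *m K) by exact: mtame_lin.
have h1 X V : mddir (fun X => X *m K) X V (1%:M *m V *m K).
  by rewrite mul1mx; exact: mddir_lin.
have h2 X : mdiv (fun V => 1%:M *m V *m K) = (fun=> Nr * dotm r r) X.
  by rewrite mdiv_sandwich mxtrace1 mxtrace_outer.
have e := gm_div_scaled hE tp hG tK h1 h2.
clear h1 h2.
have tpf : tame (fun X => phi X * f0 X) by exact: tameM.
have tpr : tame (fun X => phi X * dotm X (X *m K)).
  by apply: tameM => //; apply: tame_dotm => //; exact: mtame_id.
have eF : E (fun X => phi X * f0 X) =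
    E (fun X => phi X * dotm X (X *m K)) + lam * dotm x x * E phi.
  rewrite -(gmZ hE)// -(gmD hE)//; last exact: tameZ.
  congr E; apply/funext => X; rewrite /K mulmxA dotm_outer /risk0; ring.
have hle : E (fun X => phi X * (Nr * dotm r r) + dotm (G X) (X *m K)) <=
    E (fun X => Nr * dotm r r * phi X + c * (phi X * f0 X)).
  apply: (gm_le hE).
  - apply: tameD; last exact: tame_dotm.
    by apply: tameM => //; exact: tame_cst.
  - by apply: tameD; exact: tameZ.
  - by move=> X; have := Gle X; rewrite -mulmxA -/K; lra.
rewrite (gmD hE (tameZ _ tp) (tameZ c tpf)) !(gmZ hE)// in hle.
have {}hle := ler_wpM2l (ltW ns0) hle.
rewrite -e -/ns in hle.
have nN : ns * Nr = 1 by rewrite /ns mulVf.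
have e3 : ns * (Nr * dotm r r * E phi + c * E (fun X => phi X * f0 X)) =
   dotm r r * E phi + ns * c * E (fun X => phi X * f0 X).
  by rewrite mulrDr !mulrA nN mul1r.
rewrite e3 in hle; rewrite {1}eF /Delta.
lra.
Qed.

Let gT_r_le X : dotm (gT X) (X *m r *m r^T) <= Nr * psi X * f0 X.
Proof.
rewrite dotm_outer /gT -scalemxAl dotmZl.
have -> : X *m (M2 *m M2^T) *m r = lam *: (X *m M2 *m x).
  by rewrite -!(mulmxA X) -(mulmxA M2) M2r -!scalemxAr (mulmxA M2) M2Pi.
rewrite dotmZl (mulrA (2 / lam)) divfK// Npsi.
have h1 := dotm_young (X *m M2 *m x) (X *m r) ltr01.
rewrite invr1 !mul1r in h1.
have h2 := dotm_mul_le (X *m M2) x; rewrite lamT in h2.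
have h3 := mulr_ge0 (T_ge0 X) (dotm_ge0 (X *m r)).
have hx : 0 <= lam * dotm x x by rewrite mulr_ge0 ?dotm_ge0// ltW.
have h4 : 0 <= (Nr - 1) * dotm (X *m r) (X *m r).
  by rewrite mulr_ge0 ?dotm_ge0//; have := N16; lra.
have h5 := mulr_ge0 (ltW N0) hx.
rewrite /risk0; lra.
Qed.

Let scaled_gT_r_le X : ns * dotm (gT X) (X *m r *m r^T) <= psi X * f0 X.
Proof.
have h1 := ler_wpM2l (ltW ns0) (gT_r_le X).
have nN : ns * Nr = 1 by rewrite /ns mulVf.
have e1 : ns * (Nr * psi X * f0 X) = (ns * Nr) * (psi X * f0 X) by ring.
by rewrite e1 nN mul1r in h1.
Qed.

Let Epsif0 : E (fun X => psi X * f0 X) <= 2 * Delta.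
Proof.
have := @Ex_f0_step 1 psi (fun X => Nr^-1 *: gT X) tame_psi hgrad_psi _.
set e := E (fun X => psi X * f0 X) => st.
have {}st : e <= Delta * E psi + ns * 1 * e.
  apply: st => X; rewrite mul1r dotmZl; exact: scaled_gT_r_le.
have e0 : 0 <= e by apply: (gm_ge0 hE); [exact: tameM|move=> X; exact: mulr_ge0].
have := ler_wpM2r e0 ns16; have := ler_wpM2l Delta_ge0 Epsi; have := Delta_ge0; lra.
Qed.

Let Ef0 : E f0 <= Delta.
Proof.
have := @Ex_f0_step 0 (fun=> 1) (fun=> 0) (tame_cst _ _ _) (@hgrad_cst _ _ _ _).
have -> : (fun X => 1 * f0 X) = f0 by apply/funext => X; rewrite mul1r.
rewrite (gm_cst hE) mulr1 mulr0 mul0r addr0; apply => X.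
by rewrite dotm0l mul0r.
Qed.

Let Epsi2tf0 : E (fun X => psi X * psi X * t X * f0 X) <= 4 * Delta * E t.
Proof.
have hg := hgradM (hgradM hgrad_psi hgrad_psi) (hgrad_t (N := N) M l0).
have tp : tame (fun X => psi X * psi X * t X) by apply: tameM => //; exact: tameM.
(* One unit for each of the factors psi, psi and t. *)
have st := @Ex_f0_step 3 _ _ tp hg _.
set e := E (fun X => psi X * psi X * t X * f0 X) in st *.
have {}st : e <= Delta * E (fun X => psi X * psi X * t X) + ns * 3 * e.
  apply: st => X.
  cbv beta; move: (scaled_gT_r_le X) (grad_t_r_le l0 hr X).
  move: (gT X) (grad_t lam M X) => G1 G2 h1 h2.
  rewrite dotmDl !dotmZl dotmDl !dotmZl.
  have h3 := ler_wpM2l (mulr_ge0 (t0 X) (psi0 X)) h1.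
  have h4 := ler_wpM2l (mulr_ge0 (psi0 X) (psi0 X)) h2.
  rewrite -/ns; move: h3 h4; move: (dotm G1 _) (dotm G2 _) => d1 d2; lra.
have e0 : 0 <= e.
  apply: (gm_ge0 hE); first exact: tameM.
  by move=> X; rewrite mulr_ge0// mulr_ge0// mulr_ge0.
have := ler_wpM2r e0 ns16; have := ler_wpM2l Delta_ge0 Epsi2t.
have := mulr_ge0 Delta_ge0 Et_ge0; lra.
Qed.

Definition excess X : R := dotm (M *m z X) (M *m z X) + lam * dotm (z X) (z X).
(** [D3] is the divergence from [mdiv_rhoz], [g3] the contribution of the gradient of psi, and
    [bound] collects what the excess does not absorb. *)
Let D3 X := (N%:R - h X) * (lam * dotm (z X) x - dotm (M *m z X) (M *m z X))
  - 2 * lam * dotm (M *m z X) (M *m W X *m y X)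
  + dotm (rho X) (rho X) * t X + lam ^+ 2 * dotm (y X) (W X *m x).
Let g3 X := dotm (Nr^-1 *: gT X) (rho X *m (M *m z X)^T).
Let bound X := 2 * (dotm r r * (psi X * psi X * (mr + T X))) +
  psi X * psi X * t X * f0 X + psi X * f0 X + ns * a * f0 X.

Let g3E X : g3 X = 2 * ns * dotm (M *m z X) (M2 *m y X).
Proof.
rewrite /g3 dotmZl /gT dotmZl dotm_outer.
have -> : dotm (X *m (M2 *m M2^T) *m (M *m z X)) (rho X) = lam * dotm (M *m z X) (M2 *m y X).
  have -> : X *m (M2 *m M2^T) *m (M *m z X) = X *m M *m (Pi *m (M2^T *m (M *m z X))).
    by rewrite !mulmxA.
  rewrite dotm_mull (kkt l0 hr) dotmZr (mulmxA Pi) PiM2; congr (_ * _).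
  by rewrite dotm_mull trmxK.
by rewrite /ns; field; rewrite Nn0 lan0.
Qed.

(** The terms in N psi lam <z, x> cancel. Of the coefficient N - 2 m of |M z|^2 given by [psi_Nh],
    the Young inequalities in [b3] and [b4] spend N / 8 each and [b7] spends 1 / N, so N / 2
    remains. *)
Let key X : Nr / 2 * excess X <=
  Nr * (psi X * (lam * dotm (z X) (y X))) - (psi X * D3 X + g3 X) + bound X.
Proof.
have zy : dotm (z X) (y X) = dotm (z X) x + dotm (z X) (z X) by rewrite dotmDr.
rewrite zy g3E /D3 /excess /bound.
set mz := M *m z X; set Mn := dotm mz mz; set zz := dotm (z X) (z X).
set zx := dotm (z X) x.
have Mn0 : 0 <= Mn := dotm_ge0 _.
have zz0 : 0 <= lam * zz by rewrite mulr_ge0 ?dotm_ge0// ltW.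
have nN : ns * Nr = 1 by rewrite /ns mulVf.
have fle := sketched_risk_le l0 hr X.
have yy0 := dotm_ge0 (y X); have xx0 := dotm_ge0 x; have rr0 := dotm_ge0 (rho X).
have lyy : 0 <= lam * dotm (y X) (y X) by rewrite mulr_ge0// ltW.
have b1 : Nr * (lam * zz) <= psi X * (Nr * (lam * zz)).
  by rewrite ler_peMl// mulr_ge0// ltW.
have b2 := ler_wpM2r Mn0 (psi_Nh X).
have b3 : - (psi X * h X * (lam * zx)) <=
    Nr / 8 * Mn + 2 * (dotm r r * (psi X * psi X * (mr + T X))).
  have c0 : 0 < Nr / 4 by rewrite divr_gt0.
  have := dotm_young mz (- (psi X * h X) *: r) c0.
  rewrite !dotmZr !dotmZl (dot_Mz_r hr) -/Mn -/zx invf_div => yg.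
  (* The product of the bounds h <= N and h <= m + T; this N offsets the 1 / N from Young's
     inequality. *)
  have hh2 : h X * h X <= Nr * (mr + T X).
    by apply: ler_pM.
  have := ler_wpM2l (mulr_ge0 (mulr_ge0 (psi0 X) (psi0 X)) (dotm_ge0 r)) hh2.
  move=> /(ler_wpM2l (ltW ns0)).
  have -> : ns * (psi X * psi X * dotm r r * (Nr * (mr + T X))) =
    (ns * Nr) * (dotm r r * (psi X * psi X * (mr + T X))) by ring.
  rewrite nN mul1r => hh3.
  rewrite -/ns in yg; lra.
have b4 : - (psi X * (2 * lam * dotm mz (M *m W X *m y X))) <=
    Nr / 8 * Mn + 1 / 2 * (psi X * psi X * t X * (lam * dotm (y X) (y X))).
  have c0 : 0 < Nr / 8 by rewrite divr_gt0.
  have := dotm_young mz (- (psi X * lam) *: (M *m W X *m y X)) c0.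
  rewrite !dotmZr !dotmZl -/Mn invf_div => yg.
  have h1 := dotm_MWy_le M l0 X (y X).
  have h2 := ler_wpM2l (mulr_ge0 (mulr_ge0 (psi0 X) (psi0 X)) (ltW l0)) h1.
  have h3 : 8 * ns * (psi X * psi X * lam * (t X * dotm (y X) (y X))) <=
      1 / 2 * (psi X * psi X * t X * (lam * dotm (y X) (y X))).
    have q0 : 0 <= psi X * psi X * lam * (t X * dotm (y X) (y X)).
      by rewrite !mulr_ge0// ltW.
    have := ler_wpM2r q0 ns16; lra.
  have h4 := ler_wpM2l (ltW ns0) h2.
  rewrite -/ns in yg; lra.
have b5 : psi X * (dotm (rho X) (rho X) * t X) <= psi X * psi X * t X * dotm (rho X) (rho X).
  have := ler_wpM2r (mulr_ge0 (mulr_ge0 (psi0 X) (t0 X)) rr0) (psi1 X); lra.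
(* Now that [b5] has raised psi to psi^2, |rho|^2 and the lam |y|^2 of [b4] carry the same weight
   and recombine into the sketched cost of y, at most f0. *)
have b5' := ler_wpM2l (mulr_ge0 (mulr_ge0 (psi0 X) (psi0 X)) (t0 X)) fle.
have b5'' : 0 <= psi X * psi X * t X * (lam * dotm (y X) (y X)) by rewrite !mulr_ge0// ltW.
have b6 : psi X * (lam ^+ 2 * dotm (y X) (W X *m x)) <= psi X * f0 X.
  rewrite ler_wpM2l//; have := lam_dotm_yWx_le M x l0 X (y X).
  have := dotm_ge0 (X *m r); rewrite /risk0 in fle *; lra.
have b7 : 2 * ns * dotm mz (M2 *m y X) <= ns * Mn + ns * a * f0 X.
  have := dotm_young mz (M2 *m y X) ltr01; rewrite invr1 !mul1r -/Mn => yg.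
  have h1 := dotm_mul_le M2 (y X); rewrite M2M2 in h1.
  have h2 : lam * a * dotm (y X) (y X) <= a * f0 X.
    have := ler_wpM2l a0 fle; have := mulr_ge0 a0 rr0; lra.
  have := ler_wpM2l (ltW ns0) (le_trans yg (lerD (lexx Mn) (le_trans h1 h2))); lra.
have b8 : (Nr / 2) * Mn <= (Nr - 2 * mr - Nr / 8 - Nr / 8 - ns) * Mn.
  by rewrite ler_wpM2r//; have := HN; have := a0; have := m0; have := ns16; lra.
have b9 : 0 <= Nr * (lam * zz) by rewrite mulr_ge0// ltW.
rewrite -/mz -/zx in b3 b4 *.
lra.
Qed.

Let tmz : mtame (fun X => M *m z X).
Proof. by apply: mtameM; [exact: mtame_cst|exact: mtame_z]. Qed.
Let ty : mtame (fun X => y X).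
Proof. by apply: mtameD; [exact: mtame_cst|exact: mtame_z]. Qed.
Let tD3 : tame D3.
Proof.
have tzx : tame (fun X => lam * dotm (z X) x).
  by apply: tameZ; apply: tame_dotm; [exact: mtame_z|exact: mtame_cst].
have tmm : tame (fun X => dotm (M *m z X) (M *m z X)) by exact: tame_dotm.
have tNh : tame (fun X => N%:R - h X) by apply: tameB => //; exact: tame_cst.
apply: tameD; [apply: tameD; [apply: tameB|]|].
- by apply: tameM => //; exact: tameB.
- apply: tameZ; apply: tame_dotm => //; apply: mtameM => //.
  by apply: mtameM; [exact: mtame_cst|exact: mtame_W].
- by apply: tameM => //; apply: tame_dotm; exact: mtame_rho.
- apply: tameZ; apply: tame_dotm => //.
  by apply: mtameM; [exact: mtame_W|exact: mtame_cst].
Qed.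
Let tg3 : tame g3.
Proof.
apply: tame_dotm => //; apply: mtameM; [exact: mtame_rho|exact: mtame_tr].
Qed.
Lemma tame_excess : tame excess.
Proof.
apply: tameD; first exact: tame_dotm.
by apply: tameZ; apply: tame_dotm; exact: mtame_z.
Qed.

(** In the mean of [key], everything before [bound] on the right vanishes by integration by parts.
    The 10 is 2 from the cross term plus 4 times 2 from psi^2 t f0; the 3 covers the last two terms
    of [bound]. *)
Lemma expected_excess_le :
  E excess <= 2 / Nr * (10 * (mr + 3 * a) + 3) * (dotm r r + lam * dotm x x).
Proof.
have e := gm_div_scaled hE tame_psi hgrad_psi
  (mtameM (mtame_rho M r l0) (mtame_tr tmz)) (mddir_rhoz M r l0) (mdiv_rhoz l0 hr).
have eL : (fun X => psi X * dotm X (rho X *m (M *m z X)^T)) =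
    (fun X => psi X * (lam * dotm (z X) (y X))).
  by apply/funext => X; rewrite (dotm_X_rhoz l0 hr).
rewrite eL in e.
have tzy : tame (fun X => psi X * (lam * dotm (z X) (y X))).
  by apply: tameM => //; apply: tameZ; apply: tame_dotm => //; exact: mtame_z.
have tR : tame (fun X => psi X * D3 X + g3 X) by apply: tameD => //; exact: tameM.
have eN : Nr * E (fun X => psi X * (lam * dotm (z X) (y X))) = E (fun X => psi X * D3 X + g3 X).
  by rewrite e mulVKf.
have tb1 : tame (fun X => 2 * (dotm r r * (psi X * psi X * (mr + T X)))).
  by do 2 apply: tameZ; apply: tameM => //; exact: tameM.
have tb2 : tame (fun X => psi X * psi X * t X * f0 X).
  by apply: tameM => //; apply: tameM => //; exact: tameM.
have tb3 : tame (fun X => psi X * f0 X) by exact: tameM.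
have tb4 : tame (fun X => ns * a * f0 X) by exact: tameZ.
have tb12 := tameD tb1 tb2.
have tb123 := tameD tb12 tb3.
have tb : tame bound := tameD tb123 tb4.
have tNz := tameZ Nr tzy.
have tdiff := tameB tNz tR.
have hle : E (fun X => Nr / 2 * excess X) <=
    E (fun X => Nr * (psi X * (lam * dotm (z X) (y X))) - (psi X * D3 X + g3 X) + bound X).
  by apply: (gm_le hE); [apply: tameZ; exact: tame_excess|exact: tameD|exact: key].
have Eb : E bound = 2 * (dotm r r * E (fun X => psi X * psi X * (mr + T X))) +
    E (fun X => psi X * psi X * t X * f0 X) + E (fun X => psi X * f0 X) + ns * a * E f0.
  rewrite (gmD hE tb123 tb4) (gmD hE tb12 tb3) (gmD hE tb1 tb2).
  rewrite (gmZ hE 2 (f := fun X => dotm r r * (psi X * psi X * (mr + T X)))); last first.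
    by apply: tameZ; apply: tameM => //; exact: tameM.
  rewrite (gmZ hE (dotm r r) (f := fun X => psi X * psi X * (mr + T X))); last first.
    by apply: tameM => //; exact: tameM.
  by rewrite (gmZ hE _ tame_f0).
rewrite (gmZ hE _ tame_excess) (gmD hE tdiff tb) (gmB hE tNz tR) (gmZ hE _ tzy) eN in hle.
rewrite subrr add0r Eb in hle.
rewrite -/Delta.
have rD : dotm r r <= Delta.
  by rewrite lerDl mulr_ge0 ?dotm_ge0// ltW.
have ma0 : 0 <= mr + 3 * a by have := a0; have := m0; lra.
have h1 := ler_wpM2l (dotm_ge0 r) Epsi2mT.
have h1' := ler_wpM2r ma0 rD.
have h2 := ler_wpM2l Delta_ge0 Et.
have h4 := ler_wpM2l (mulr_ge0 (ltW ns0) a0) Ef0.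
have h5 := ler_wpM2r Delta_ge0 nsa.
have h6 := Epsi2tf0; have h7 := Epsif0; have D0 := Delta_ge0.
have hfin : Nr / 2 * E excess <= (10 * (mr + 3 * a) + 3) * Delta by lra.
rewrite -(ler_pM2l (divr_gt0 N0 (ltr0n R 2))) (le_trans hfin)// le_eqVlt.
by apply/orP; left; apply/eqP; field.
Qed.

End expected_excess.

(** * Markov inequality and the theorem *)

Section argmin.
Variables (R : realType) (n k : nat) (lam : R) (M : 'M[R]_(n, k)) (b : 'cV[R]_n).

Lemma l2norm_sqr p (v : 'cV[R]_p) : l2norm v ^+ 2 = dotm v v.
Proof.
rewrite sqr_sqrtr; last by apply: sumr_ge0 => i _; exact: sqr_ge0.
by rewrite dotmE; apply: eq_bigr => i _; rewrite big_ord1 expr2.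
Qed.

Lemma ridge_costE x : ridge_cost lam M b x =
  dotm (M *m x - b) (M *m x - b) + lam * dotm x x.
Proof. by rewrite /ridge_cost !l2norm_sqr. Qed.

Lemma ridge_costD x u : ridge_cost lam M b (x + u) =
  ridge_cost lam M b x - 2 * dotm u (M^T *m (b - M *m x) - lam *: x) +
  (dotm (M *m u) (M *m u) + lam * dotm u u).
Proof.
rewrite !ridge_costE.
have -> : M *m (x + u) - b = (M *m x - b) + M *m u by rewrite mulmxDr addrAC.
have -> : b - M *m x = - (M *m x - b) by rewrite opprB.
move: (M *m x - b) => p.
rewrite mulmxN dotmBr dotmNr dotmZr -dotm_mull.
rewrite !dotmDl !dotmDr (dotmC p (M *m u)) (dotmC x u); ring.
Qed.

Lemma argmin_ridge_eq x : 0 < lam -> is_argmin (ridge_cost lam M b) x ->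
  M^T *m (b - M *m x) = lam *: x.
Proof.
move=> l0 hx; pose g := M^T *m (b - M *m x) - lam *: x.
apply: subr0_eq; rewrite -/g; apply: dotm_eq0.
pose G := dotm g g; pose Q := dotm (M *m g) (M *m g) + lam * G.
have G0 : 0 <= G := dotm_ge0 _.
have Q0 : 0 <= Q by rewrite addr_ge0 ?dotm_ge0// mulr_ge0// ltW.
apply/eqP; rewrite eq_le G0 andbT leNgt; apply/negP => Gp.
(* A step short enough that e Q < G: along g the quadratic term cannot make up for the linear gain 2
   e G. *)
pose e := G / (1 + Q).
have Q1 : 0 < 1 + Q by lra.
have e0 : 0 < e by rewrite divr_gt0.
have eQ : e * (1 + Q) = G by rewrite divfK// gt_eqF.
have := hx (x + e *: g).
rewrite ridge_costD -/g -scalemxAr !dotmZl !dotmZr -/G => h.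
have {}h : e * (2 * G) <= e * (e * Q) by rewrite /Q; lra.
rewrite (ler_pM2l e0) in h; lra.
Qed.

End argmin.

Lemma sketched_ridge_costE (R : realType) (l n k : nat) (lam : R) (S : 'M[R]_(l, n))
    (M : 'M[R]_(n, k)) b :
  sketched_ridge_cost lam S M b = ridge_cost lam (S *m M) (S *m b).
Proof.
apply/funext => y; rewrite /sketched_ridge_cost /ridge_cost.
by rewrite mulmxBr mulmxA.
Qed.

Lemma sketched_argminE (R : realType) (l n k : nat) (lam : R) (S : 'M[R]_(l, n))
    (M : 'M[R]_(n, k)) b x y : 0 < lam ->
  M^T *m (b - M *m x) = lam *: x ->
  is_argmin (sketched_ridge_cost lam S M b) y ->
  y = x + ridge_err lam M (b - M *m x) S.
Proof.
move=> l0 hr; rewrite sketched_ridge_costE => /(argmin_ridge_eq l0) hy.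
have eb : S *m b - S *m M *m y = S *m (b - M *m x) - S *m M *m (y - x).
  by rewrite (mulmxBr S) (mulmxBr (S *m M)) mulmxA opprB addrA subrK.
rewrite eb mulmxBr in hy.
have e : (lam%:M + (S *m M)^T *m (S *m M)) *m (y - x) =
    (S *m M)^T *m (S *m (b - M *m x)) - M^T *m (b - M *m x).
  by rewrite mulmxDl mul_scalar_mx hr scalerBr -hy -(mulmxA (S *m M)^T) addrAC subrK.
rewrite /ridge_err -e mulmxA mulVmx ?mul1mx; first by rewrite addrC subrK.
exact: ridge_unit.
Qed.

(** * Small statistical dimension: a direct second moment *)

Section small_matrix.
Variables (R : realType) (N n k : nat) (lam : R) (M : 'M[R]_(n, k)).
Variables (r : 'cV[R]_n) (E : ('M[R]_(N, n) -> R) -> R).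
Hypothesis hE : gaussian_mean E.
Hypothesis l0 : 0 < lam.
Hypothesis N0 : 0 < N%:R :> R.
Local Notation MX := 'M[R]_(N, n).

Let Nn0 : N%:R != 0 :> R. Proof. by rewrite gt_eqF. Qed.

Lemma gm_dotm_lin (u w : 'cV[R]_n) : E (fun X => dotm (X *m u) (X *m w)) = dotm u w.
Proof.
have tF : mtame (fun X : MX => X *m (w *m u^T)) by exact: mtame_lin.
have h1 X V : mddir (fun X : MX => X *m (w *m u^T)) X V (1%:M *m V *m (w *m u^T)).
  by rewrite mul1mx; exact: mddir_lin.
have e : E (fun X => dotm X (X *m (w *m u^T))) =
    N%:R^-1 * E (fun X => mdiv (fun V : MX => 1%:M *m V *m (w *m u^T))) := gm_div hE tF h1.
have eL : (fun X : MX => dotm X (X *m (w *m u^T))) = (fun X => dotm (X *m u) (X *m w)).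
  by apply/funext => X; rewrite mulmxA dotm_outer.
have eR : (fun X : MX => mdiv (fun V : MX => 1%:M *m V *m (w *m u^T))) = fun=> N%:R * dotm u w.
  by apply/funext => X; rewrite mdiv_sandwich mxtrace1 mxtrace_outer.
by rewrite eL eR (gm_cst hE) mulKf in e.
Qed.

Definition noise (X : MX) : 'cV[R]_k := (X *m M)^T *m (X *m r) - M^T *m r.
Local Notation q := noise.

Let tq : mtame q.
Proof.
apply: mtameB; last exact: mtame_cst.
by apply: mtameM; [apply: mtame_tr|]; exact: mtame_lin.
Qed.

Let mddir_q X V : mddir q X V ((V *m M)^T *m (X *m r) + (X *m M)^T *m (V *m r)).
Proof.
apply: mddir_eq.
  apply: mddirB; last exact: mddir_cst.
  by apply: mddirM; [apply: mddir_tr|]; exact: mddir_lin.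
by rewrite subr0.
Qed.

Lemma mddir_Xrq X V : mddir (fun X : MX => X *m r *m (M *m q X)^T) X V
  (1%:M *m V *m (r *m (M *m q X)^T) +
   (X *m r *m (X *m r)^T *m V *m (M *m M^T) +
    X *m r *m r^T *m V^T *m (X *m (M *m M^T)))).
Proof.
apply: mddir_eq.
  apply: mddirM; first exact: mddir_lin.
  by apply: mddir_tr; apply: mddir_mull; exact: mddir_q.
cbv beta; move: (q X) => w.
have trD (A B : 'cV[R]_k) : (A + B)^T = A^T + B^T by rewrite linearD.
by rewrite mul1mx (trmx_mul M (_ + _)) trD mulmxDl mulmxDr !trmx_mul !trmxK !mulmxA.
Qed.

(** |q|^2 = A - B, where A is the inner product of X with the field X r (M q)^T. The divergence of
    that field contains N B, so after division by N the means of B cancel. *)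
Lemma gm_noise : E (fun X => dotm (q X) (q X)) =
  N%:R^-1 * (dotm r r * dotm M M + dotm (M^T *m r) (M^T *m r)).
Proof.
pose A (X : MX) := dotm (q X) ((X *m M)^T *m (X *m r)).
pose B (X : MX) := dotm (q X) (M^T *m r).
pose C (X : MX) := dotm (X *m r) (X *m r).
pose D (X : MX) := dotm (X *m (M *m (M^T *m r))) (X *m r).
have tA : tame A.
  apply: tame_dotm => //; apply: mtameM; last exact: mtame_lin.
  by apply: mtame_tr; exact: mtame_lin.
have tB : tame B by apply: tame_dotm => //; exact: mtame_cst.
have tC : tame C by apply: tame_dotm; exact: mtame_lin.
have tD : tame D by apply: tame_dotm; exact: mtame_lin.
have tF : mtame (fun X : MX => X *m r *m (M *m q X)^T).
  apply: mtameM; first exact: mtame_lin.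
  by apply: mtame_tr; apply: mtameM => //; exact: mtame_cst.
have e := gm_div hE tF mddir_Xrq.
have eL : (fun X : MX => dotm X (X *m r *m (M *m q X)^T)) = A.
  by apply/funext => X; rewrite dotm_outer mulmxA dotm_mull.
have eR : (fun X : MX => mdiv (fun V : MX => 1%:M *m V *m (r *m (M *m q X)^T) +
   (X *m r *m (X *m r)^T *m V *m (M *m M^T) +
    X *m r *m r^T *m V^T *m (X *m (M *m M^T))))) =
    (fun X => N%:R * B X + (dotm M M * C X + D X)).
  apply/funext => X; rewrite !mdivD !mdiv_sandwich mdiv_sandwich_tr mxtrace1 !mxtrace_outer.
  rewrite dotm_mull; congr (_ + (_ + _)).
    by rewrite mulrC; congr (_ * _); rewrite mxtrace_mulC.
  by rewrite dotmC dotm_outer -!mulmxA.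
have {}e : E A = N%:R^-1 * E (fun X => N%:R * B X + (dotm M M * C X + D X)).
  by rewrite -eL -eR; exact: e.
have tMC := tameZ (dotm M M) tC.
rewrite (gmD hE (tameZ _ tB) (tameD tMC tD)) (gmD hE tMC tD) !(gmZ hE)// !gm_dotm_lin in e.
have -> : (fun X => dotm (q X) (q X)) = (fun X => A X - B X).
  by apply/funext => X; rewrite -dotmBr.
rewrite (gmB hE tA tB) e dotm_mull; by field.
Qed.

(** If |M|^2 <= lam then |M z|^2 <= lam |z|^2, so the excess is at most 2 lam |z|^2, hence at most
    (2 / lam) |q|^2. *)
Lemma expected_excess_small : dotm M M <= lam ->
  E (excess lam M r) <= 4 / N%:R * (dotm M M / lam) * dotm r r.
Proof.
move=> Ml.
have tqq : tame (fun X => dotm (q X) (q X)) by exact: tame_dotm.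
have h1 X : excess lam M r X <= 2 / lam * dotm (q X) (q X).
  have z1 := dotm_W_le (X *m M) l0 (q X).
  have z2 := dotm_ridge_inv_le (X *m M) l0 (q X).
  have z3 := ler_wpM2l (ltW l0) z1.
  have -> : excess lam M r X =
    dotm (M *m (ridge_inv lam (X *m M) *m q X)) (M *m (ridge_inv lam (X *m M) *m q X)) +
    lam * dotm (ridge_inv lam (X *m M) *m q X) (ridge_inv lam (X *m M) *m q X) by [].
  move: z1 z2 z3; move: (ridge_inv lam (X *m M) *m q X) => z z1 z2 z3.
  have z4 := dotm_mul_le M z.
  have z5 := ler_wpM2r (dotm_ge0 z) Ml.
  rewrite mulrAC ler_pdivlMr//.
  have z6 := ler_wpM2l (ltW l0) (le_trans z4 z5); lra.
have h2 : E (excess lam M r) <= E (fun X => 2 / lam * dotm (q X) (q X)).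
  by apply: (gm_le hE) => //; [exact: tame_excess|exact: tameZ].
rewrite (gmZ hE)// gm_noise in h2.
apply: le_trans h2 _.
have h3 : dotm (M^T *m r) (M^T *m r) <= dotm M M * dotm r r.
  by rewrite -(dotm_tr M M); exact: dotm_mul_le.
have c0 : 0 <= 2 / lam * N%:R^-1 by rewrite mulr_ge0 ?invr_ge0 ?divr_ge0// ltW.
have := ler_wpM2l c0 h3.
have -> : 4 / N%:R * (dotm M M / lam) * dotm r r =
  2 * (2 / lam * N%:R^-1 * (dotm M M * dotm r r)) by field; rewrite Nn0 gt_eqF.
rewrite !mulrDr !mulrA; lra.
Qed.

End small_matrix.

(** For s >= 1/2 additive constants are multiples of s: the condition on N asks for 96 s <= N and
    the final bound for 344 s <= eps N, both covered by 1000. For s < 1/2 the bound is proportional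
    to s from the start. *)
Lemma expected_excess_eps (R : realType) (N n k : nat) (lam eps s : R)
    (M : 'M[R]_(n, k)) (r : 'cV[R]_n) (x : 'cV[R]_k) (E : ('M[R]_(N, n) -> R) -> R) :
  gaussian_mean E -> 0 < lam -> M^T *m r = lam *: x -> 0 < eps < 1 ->
  stat_dim lam M <= s -> 0 < N%:R :> R -> 1000 * s <= eps * N%:R ->
  E (excess lam M r) <= eps / 2 * (dotm r r + lam * dotm x x).
Proof.
move=> hE l0 hr /andP[e0 e1] sds N0 sN.
have sd0 := stat_dim_ge0 M l0.
have [Pi [m [sPi PiPi PiA [rk mle] dle]]] := spectral_split M l0.
have lx0 : 0 <= lam * dotm x x by rewrite mulr_ge0 ?dotm_ge0// ltW.
have rr0 := dotm_ge0 r.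
have eN : eps * N%:R <= N%:R by rewrite ler_piMl// ltW.
have [hs|hs] := leP (1 / 2) s.
  have ale : dotm (M *m Pi) (M *m Pi) / lam <= 2 * s.
    rewrite ler_pdivrMr// (le_trans dle)// ler_wpM2r ?(ltW l0)//; lra.
  have a0 : 0 <= dotm (M *m Pi) (M *m Pi) / lam by rewrite divr_ge0 ?dotm_ge0// ltW.
  have HN : 16 * (m%:R + dotm (M *m Pi) (M *m Pi) / lam + 1) <= N%:R by lra.
  have := expected_excess_le hE l0 hr sPi PiPi PiA rk HN.
  move/le_trans; apply; rewrite ler_wpM2r ?addr_ge0//.
  rewrite mulrAC ler_pdivrMr//; lra.
(* m is at most 2 s < 1; hence [Pi] leaves M unchanged and |M|^2 <= lam. *)
have m0 : m = 0%N.
  apply/eqP; rewrite -leqn0 -ltnS -(ltr_nat R); lra.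
have MPi : M *m Pi = M.
  move: rk; rewrite m0 leqn0 mxrank_eq0 mulmxBr mulmx1 subr_eq0 => /eqP <-//.
rewrite MPi in dle.
have Ml : dotm M M <= lam.
  by rewrite (le_trans dle)// ler_piMl ?(ltW l0)//; lra.
apply: (le_trans (expected_excess_small r hE l0 N0 Ml)).
have ale : dotm M M / lam <= 2 * s.
  rewrite ler_pdivrMr// (le_trans dle)// ler_wpM2r ?(ltW l0)//; lra.
have h1 : 4 / N%:R * (dotm M M / lam) <= eps / 2 by rewrite mulrAC ler_pdivrMr//; lra.
apply: (le_trans (ler_wpM2r rr0 h1)).
rewrite ler_wpM2l ?divr_ge0 ?(ltW e0)//; lra.
Qed.

Lemma excess_ge0 (R : realType) (N n k : nat) (lam : R) (M : 'M[R]_(n, k)) r (X : 'M[R]_(N, n)) :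
  0 < lam -> 0 <= excess lam M r X.
Proof. by move=> l0; rewrite addr_ge0 ?dotm_ge0// mulr_ge0 ?dotm_ge0// ltW. Qed.

Lemma gaussian_markov (R : realType) (dT : measure_display) (T : measurableType dT)
    (P : probability T R) (N n : nat) (S : 'I_N * 'I_n -> {RV P >-> R})
    (f : 'M[R]_(N, n) -> R) (c : R) :
  gaussian_sketch S -> tame f -> (forall X, 0 <= f X) -> 0 < c -> Ex S f <= c / 2 ->
  ((2^-1)%:E <= P [set w | (f (sketch_at S w) <= c)%R])%E.
Proof.
move=> gS tf f0 c0 Ef; pose g w := f (sketch_at S w).
have mg : measurable_fun setT g.
  by apply: (tame_measurable tf); exact: measurable_sketch.
pose A := [set w | g w <= c].
have mA : measurable A.
  have -> : A = setT `&` g @^-1` [set` `]-oo, c]].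
    by rewrite setTI; apply/seteqP; split => w; rewrite /A /= in_itv.
  exact: mg.
have mgE : measurable_fun setT (EFin \o g) by exact/measurable_EFinP.
have h := @le_integral_abse _ _ _ P setT measurableT (EFin \o g) c mgE c0.
have eI : (\int[P]_x `|(EFin \o g) x| = (Ex S f)%:E)%E.
  rewrite /Ex /Rintegral fineK; last exact: integrable_fin_num (tame_integrable gS tf).
  by apply: eq_integral => w _; rewrite gee0_abs ?lee_fin//; exact: f0.
rewrite eI in h.
have [p Pp] : exists p, P A = p%:E.
  by exists (fine (P A)); rewrite fineK// fin_num_measure.
have PC : P (~` A) = (1 - p)%:E by rewrite probability_setC// Pp.
have hC : (c%:E * P (~` A) <= (c / 2)%:E)%E.
  apply: (@le_trans _ _ (Ex S f)%:E); last by rewrite lee_fin.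
  apply: le_trans h; apply: lee_wpmul2l; first by rewrite lee_fin ltW.
  apply: le_measure; rewrite ?inE.
  - exact: measurableC.
  - apply: emeasurable_fun_c_infty => //; exact: measurableT_comp.
  - move=> w /= /negP; rewrite -ltNge => cg; split => //.
    by rewrite lee_fin (le_trans (ltW cg))// ler_norm.
rewrite PC -EFinM lee_fin (ler_pM2l c0) in hC.
rewrite -/g -/A Pp lee_fin; lra.
Qed.

Lemma excess_eq0 (R : realType) (N n k : nat) (lam : R) (M : 'M[R]_(n, k)) r (X : 'M[R]_(N, n)) :
  r = 0 -> excess lam M r X = 0.
Proof.
move=> ->; rewrite /excess /ridge_err !mulmx0 subr0 !mulmx0.
by rewrite !dotm0l mulr0 addr0.
Qed.

(** As eps < 1, ln (1 / eps) is positive; this keeps the number of rows positive even when s = 0. *)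
Lemma sketch_size_ge (R : realType) (eps s : R) : 0 < eps < 1 -> 0 <= s ->
  0 < sketch_size eps s /\ s <= eps * sketch_size eps s.
Proof.
move=> /andP[e0 e1] s0.
have l1 : 0 < ln (1 / eps) by apply: ln_gt0; rewrite div1r invf_gt1.
split; first by rewrite mulr_gt0 ?divr_gt0//; lra.
rewrite div1r in l1; rewrite /sketch_size !div1r mulrA divff ?gt_eqF// mul1r; lra.
Qed.

Theorem theorem2 (R : realType) :
  exists c1 p : R, 0 < c1 /\ 0 < p /\
  forall c2 : R, c1 <= c2 ->
  forall (lambda eps : R), 0 < lambda -> 0 < eps < 1 ->
  forall (n k d : nat) (M : 'I_d -> 'M[R]_(n, k)) (b : 'I_d -> 'cV[R]_n)
    (l : nat),
  theta_between c1 c2 (sketch_size eps (max_stat_dim lambda M)) l ->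
  forall (dT : measure_display) (T : measurableType dT) (P : probability T R)
    (S : 'I_l * 'I_n -> {RV P >-> R}),
  gaussian_sketch S ->
  forall (x : 'I_d -> 'cV[R]_k) (y : 'I_d -> T -> 'cV[R]_k),
  (forall i, is_argmin (ridge_cost lambda (M i) (b i)) (x i)) ->
  (forall i w,
     is_argmin (sketched_ridge_cost lambda (sketch_at S w) (M i) (b i))
       (y i w)) ->
  (p%:E <= P [set w | (\sum_(i < d) ridge_cost lambda (M i) (b i) (y i w) <=
                      (1 + eps) *
                        \sum_(i < d) ridge_cost lambda (M i) (b i) (x i))%R])%E.
Proof.
(* 1000 is the constant of [expected_excess_eps]; 1/2 is what Markov's inequality gives for a mean
   of at most eps D / 2 and the threshold eps D. *)
exists 1000, 2^-1; split; first by lra.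
split; first by lra.
move=> c2 _ lam eps l0 eps01 n k d M b l [lN _] dT T P S gS x y hx hy.
have /andP[e0 e1] := eps01.
set s := max_stat_dim lam M in lN.
have s0 : 0 <= s by exact: bigmax_ge_id.
have [ss0 sse] := sketch_size_ge eps01 s0.
have N0 : 0 < l%:R :> R by lra.
have sN : 1000 * s <= eps * l%:R.
  have := ler_wpM2l (ltW e0) lN; lra.
pose r i := b i - M i *m x i.
have hr i : (M i)^T *m r i = lam *: x i := argmin_ridge_eq l0 (hx i).
pose f (X : 'M[R]_(l, n)) : R := \sum_(i < d) excess lam (M i) (r i) X.
set D := \sum_(i < d) ridge_cost lam (M i) (b i) (x i).
have DE : D = \sum_(i < d) (dotm (r i) (r i) + lam * dotm (x i) (x i)).
  apply: eq_bigr => i _; rewrite ridge_costE -(opprB (b i)) dotmNl.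
  by rewrite dotmC dotmNl opprK.
have cost_y i w : ridge_cost lam (M i) (b i) (y i w) =
    ridge_cost lam (M i) (b i) (x i) + excess lam (M i) (r i) (sketch_at S w).
  rewrite (sketched_argminE l0 (hr i) (hy i w)) ridge_costD -/(r i) hr subrr.
  by rewrite dotmC dotm0l mulr0 subr0.
have -> : [set w | (\sum_(i < d) ridge_cost lam (M i) (b i) (y i w) <= (1 + eps) * D)%R] =
    [set w | (f (sketch_at S w) <= eps * D)%R].
  apply/funext => w; rewrite /mkset; apply/propext.
  have -> : \sum_(i < d) ridge_cost lam (M i) (b i) (y i w) = D + f (sketch_at S w).
    by rewrite -big_split; apply: eq_bigr => i _; exact: cost_y.
  by rewrite mulrDl mul1r lerD2l.
have tf : tame f by apply: tame_sum => i; exact: tame_excess.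
have f0 X : 0 <= f X by apply: sumr_ge0 => i _; exact: excess_ge0.
have Ed i : 0 <= dotm (r i) (r i) + lam * dotm (x i) (x i).
  by rewrite addr_ge0 ?dotm_ge0// mulr_ge0 ?dotm_ge0// ltW.
have D0 : 0 <= D by rewrite DE sumr_ge0.
have Ef : Ex S f <= eps * D / 2.
  rewrite (gm_sum (Ex_gaussian_mean gS)); last by move=> i; exact: tame_excess.
  rewrite mulrAC DE mulr_sumr; apply: ler_sum => i _.
  apply: (expected_excess_eps (Ex_gaussian_mean gS) l0 (hr i) eps01 _ N0 sN).
  exact: le_bigmax.
(* Markov's inequality needs a positive threshold. If D = 0, all residuals vanish and the excess is
   identically 0. *)
have [Dp|Dn] := ltP 0 D; first by apply: gaussian_markov => //; exact: mulr_gt0.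
have r0 i : r i = 0.
  have /eqP : D = 0 by apply/eqP; rewrite eq_le Dn D0.
  rewrite DE psumr_eq0// => /allP/(_ i); rewrite mem_index_enum => /(_ isT) /eqP h.
  apply: dotm_eq0; have := dotm_ge0 (r i); have := mulr_ge0 (ltW l0) (dotm_ge0 (x i)).
  by move=> h1 h2; apply/eqP; rewrite eq_le h2 andbT; lra.
have -> : [set w | (f (sketch_at S w) <= eps * D)%R] = setT.
  apply/seteqP; split => // w _ /=.
  rewrite /f big1 => [|i _]; last exact: excess_eq0.
  by rewrite mulr_ge0// ltW.
by rewrite probability_setT lee_fin; lra.
Qed.
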